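(* Let $\lambda_0\approx 0.189$ and $p_0\approx 0.894$ be the absolute constants defined in the context, and let $G=G_{n,p}$. Then the following hold asymptotically almost surely (i.e. with probability tending to $1$ as $n\to\infty$): (i) If $p$ is a constant with $0<p<\lambda_0$, or if $p=p(n)\in(0,1)$ satisfies $p=o(1)$, then $f(G)=\delta(G)+1$. (ii) If $p$ is a constant with $\lambda_0\le p\le p_0$, then $|f(G)-\lambda_0 n|=\tilde{O}(n^{1/2})$. (iii) If $p$ is a constant with $p_0<p<1$, or if $p=p(n)\in(0,1)$ satisfies $p=1-o(1)$, then $$f(G)=2+\min_{\substack{x,y\in V(G)\\ x\neq y}}\left|\left(N(x)\bigtriangleup N(y)\right)\setminus\{x,y\}\right|.$$
   Context: All graphs are finite, simple and undirected. For a graph $G$ with vertex set $V=V(G)\neq\emptyset$, a set $A\subseteq V$ and a vertex $x$, let $d_A(x)$ denote the number of neighbors of $x$ in $A$. The diagonal distance of $G$ is $$f(G)=\min\left\{|A|+\left|\{x\in V\setminus A : d_A(x)\text{ is odd}\}\right| : \emptyset\neq A\subseteq V\right\}.$$ $\delta(G)$ is the minimum degree of $G$, $N(x)$ is the set of neighbors of $x$ in $G$, and $\bigtriangleup$ denotes symmetric difference of sets. $G_{n,p}$ is the binomial random graph on $n$ vertices, in which each pair of distinct vertices is an edge independently with probability $p$. The notation $\tilde{O}(n^{1/2})$ hides a polylogarithmic factor: it means at most $n^{1/2}(\log n)^{C}$ for some constant $C$ and all sufficiently large $n$. Constants: let $H(x)=-x\log_2 x-(1-x)\log_2(1-x)$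 (with $H(0)=H(1)=0$) be the binary entropy function, let $$g_\lambda(\alpha)=H(\alpha)+(1-\alpha)\left(H\left(\frac{\lambda-\alpha}{1-\alpha}\right)-1\right),$$ and let $h(\lambda)=g_\lambda(2\lambda/3)$ for $\lambda\in[0,1]$. Then $\lambda_0= 0.1892896249\ldots$ is the unique solution in $[0,1]$ of $h(\lambda)=0$, and $p_0= 0.8941512242\ldots$ is the root of $2p-2p^2=\lambda_0$ lying in $(1/2,1)$. *)

(* Defs.v *)
From HB Require Import structures.
From mathcomp Require Import all_boot all_order all_algebra.
From mathcomp Require Import all_classical all_reals all_analysis.
Set Implicit Arguments.
Unset Strict Implicit.
Unset Printing Implicit Defensive.
Import Order.TTheory GRing.Theory Num.Theory.
Import numFieldNormedType.Exports.
Local Open Scope classical_set_scope.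
Local Open Scope ring_scope.

(* A finite simple undirected graph on V is given by its set of edges, each
   edge being a two-element subset of V. *)
Record sgraph (V : finType) := SGraph {
  edges : {set {set V}};
  edges_card2 : [forall e in edges, #|e| == 2%N] }.

HB.instance Definition _ (V : finType) := [isSub for @edges V].
HB.instance Definition _ (V : finType) := [Finite of sgraph V by <:].

Section Graph.
Variables (V : finType) (G : sgraph V).
Local Open Scope nat_scope.
Implicit Types (x y : V) (A : {set V}).

(* Loops are excluded: [set x; x] has cardinal 1. *)
Definition adj x y : bool := [set x; y]%SET \in edges G.

Definition nbh x : {set V} := [set y | adj x y]%SET.

Definition deg_in A x : nat := #|nbh x :&: A|.

Definition odd_outside A : {set V} := [set x in ~: A | odd (deg_in A x)]%SET.

(* In the three minima below the default value #|V| of the iterated minimum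
   is never below the true minimum: A = V contributes #|V| to diagdist, degrees
   are less than #|V|, and the sets in min_symdiff avoid x and y.  It is thus
   harmless when V is nonempty (with two distinct vertices for min_symdiff). *)
Definition diagdist : nat :=
  \big[minn/#|V|]_(A : {set V} | A != finset.set0) (#|A| + #|odd_outside A|).

Definition mindeg : nat := \big[minn/#|V|]_(x : V) #|nbh x|.

Definition symdiff (A B : {set V}) : {set V} := (A :\: B) :|: (B :\: A).

Definition min_symdiff : nat :=
  \big[minn/#|V|]_(xy : V * V | xy.1 != xy.2)
    #|symdiff (nbh xy.1) (nbh xy.2) :\: [set xy.1; xy.2]%SET|.

End Graph.

Section RandomGraph.
Variable R : realType.

Definition gnp_weight (n : nat) (p : R) (G : sgraph 'I_n) : R :=
  \prod_(e : {set 'I_n} | #|e| == 2%N) (if e \in edges G then p else 1 - p).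

Definition gnp_prob (n : nat) (p : R) (Q : pred (sgraph 'I_n)) : R :=
  \sum_(G : sgraph 'I_n | Q G) gnp_weight p G.

Definition aas (p : nat -> R) (Q : forall n, pred (sgraph 'I_n)) : Prop :=
  gnp_prob (p n) (Q n) @[n --> \oo] --> (1 : R).

End RandomGraph.

Section Constants.
Variable R : realType.
Implicit Types x l a p : R.

Definition log2 x : R := ln x / ln 2.

(* The conventions entropy 0 = entropy 1 = 0 hold because 0 * log2 0 = 0 and
   log2 1 = 0. *)
Definition entropy x : R := - x * log2 x - (1 - x) * log2 (1 - x).

Definition gfun l a : R :=
  entropy a + (1 - a) * (entropy ((l - a) / (1 - a)) - 1).

Definition hfun l : R := gfun l (2 * l / 3).

(* The chain rule for entropy gives hfun l = entropy l + l * log2 3 - 1 on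
   [0, 1], a concave function negative at 0 and positive at 1; hence the root
   selected here exists and is unique, and it lies in (0, 1/2), which also
   makes p0 well defined. *)
Definition lambda0 : R := xget 0 [set l | 0 <= l <= 1 /\ hfun l = 0].

Definition p0 : R :=
  xget 0 [set p | 1 / 2 < p < 1 /\ 2 * p - 2 * p ^+ 2 = lambda0].

End Constants.
Arguments lambda0 {R}.
Arguments p0 {R}.

(* Main.v *)
Require Import Defs.
From mathcomp Require Import all_boot all_order all_algebra.
From mathcomp Require Import all_classical all_reals all_analysis.
From mathcomp Require Import ring lra zify.
Import Order.TTheory GRing.Theory Num.Theory.
Import numFieldNormedType.Exports.

(** For a set A of k vertices, each vertex outside A has an odd number of
    neighbours in A with probability odd_prob p k = (1 - (1 - 2 p) ^ k) / 2,
    independently of the other ones.  The cost |A| + |odd A| is therefore governed by a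
    competition between single vertices (cost about p n), pairs (cost about
    2 p (1 - p) n) and large sets, for which odd_prob is close to 1/2.  For a large
    set A each B disjoint from A is the odd set with probability close to
    2 ^ |A| / 2 ^ n, so that the expected number of sets of cost at most m is the number
    of words of length n with at most m nonzero letters, three being available, divided
    by 2 ^ n.  This count passes from small to large at lambda0 n.  The
    three regimes tell which of the three kinds is cheapest.

    At constant density everything follows from an exponential first moment
    (first_moment, dense_lower): apart from the sizes k with odd_prob p k < g, no set
    costs less than g n - K sqrt n ln n, for any g <= lambda0.  For p < lambda0 the
    size k = 1, and for p > p0 the size k = 2, is the only minimizer of odd_prob p k and
    lies below lambda0; the best sets of these sizes give the minimum degree and the
    minimum symmetric difference by definition.

    Inside the window the lower bound is the case g = lambda0, and the upper bound is a
    second moment argument (no_hit_prob).  It uses sets A that contain a fixed set A0 of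
    logarithmic size.  The edges to A0 make the parity vectors of A and A' nearly
    uncorrelated as soon as A and A' differ in logarithmically many vertices, which is
    read off from character sums (gnp_mean_two_columns); the remaining pairs are so few
    that a slack of order sqrt n in the threshold pays for them (ideal_mean_ge).

    If p tends to 0, then either there are isolated vertices (two_isolated) and
    the claim is trivial, or n p >= 0.9 ln n.  In the second case a set beating the
    minimum degree must have unusually many common neighbours (mindeg_overlap), and the
    mean of a suitable exponential of that overlap can be computed exactly
    (overlap_prob, sparse_bad).  If p tends to 1, the same is done in the
    complement for sets of even size (symdiff_overlap), while sets of odd size have
    parity probability at least 1/2. *)

Set Implicit Arguments.
Unset Strict Implicit.
Unset Printing Implicit Defensive.
Local Open Scope ring_scope.

(** * Expectation over the binomial random graph *)

Section Expectation.
Variable R : realType.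
Implicit Types (n : nat) (p : R).

Definition gnp_mean n p (F : sgraph 'I_n -> R) : R :=
  \sum_(G : sgraph 'I_n) gnp_weight p G * F G.

Lemma edges_size2 (V : finType) (G : sgraph V) (e : {set V}) :
  e \in edges G -> #|e| == 2%N.
Proof. by move/(forall_inP (edges_card2 G)). Qed.

(** The weight of a graph is a product over pairs, so the mean of a product over
    pairs factors.  Every independence statement below is a consequence. *)
Lemma gnp_mean_edges n p (a b : {set 'I_n} -> R) :
  gnp_mean p (fun G => \prod_(e : {set 'I_n} | #|e| == 2%N)
                   (if e \in edges G then a e else b e)) =
  \prod_(e : {set 'I_n} | #|e| == 2%N) (p * a e + (1 - p) * b e).
Proof.
rewrite /gnp_mean /gnp_weight.
under eq_bigr do rewrite -big_split /=.
rewrite [RHS]big_mkcond /=.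
transitivity (\prod_(e : {set 'I_n})
   ((if #|e| == 2%N then p * a e else 0) +
    (if #|e| == 2%N then (1 - p) * b e else 1))); last first.
  by apply: eq_bigr => e _; case: ifP => _ //; rewrite add0r.
rewrite bigA_distr /=.
under [RHS]eq_bigl do rewrite inE.
rewrite [RHS](bigID (fun J : {set {set 'I_n}} => [forall e in J, #|e| == 2%N])) /=.
rewrite [X in _ = _ + X]big1 ?addr0; last first.
  move=> J; rewrite negb_forall_in => /exists_inP[e eJ /negbTE e2].
  by rewrite (bigD1 e) //= eJ e2 mul0r.
rewrite [RHS](reindex_omap (fun G : sgraph 'I_n => edges G) insub); last first.
  by move=> J HJ; rewrite insubT.
apply: eq_big => [G|G _].
  have -> : [forall e in edges G, #|e| == 2%N] by exact: edges_card2.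
  by rewrite (valK G) eqxx.
rewrite big_mkcond /=; apply: eq_bigr => e _.
by case: ifP => e2; case: ifP => // eG; move: (edges_size2 eG); rewrite e2.
Qed.

Lemma gnp_weight_ge0 n p (G : sgraph 'I_n) : 0 <= p <= 1 -> 0 <= gnp_weight p G.
Proof.
move=> /andP[p0 p1]; apply: prodr_ge0 => e _; case: ifP => _ //.
by rewrite subr_ge0.
Qed.

Lemma eq_gnp_mean n p (F F' : sgraph 'I_n -> R) : F =1 F' -> gnp_mean p F = gnp_mean p F'.
Proof. by move=> FF; apply: eq_bigr => G _; rewrite FF. Qed.

Lemma gnp_meanZ n p c (F : sgraph 'I_n -> R) :
  gnp_mean p (fun G => c * F G) = c * gnp_mean p F.
Proof. by rewrite /gnp_mean mulr_sumr; apply: eq_bigr => G _; rewrite mulrCA. Qed.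

Lemma gnp_meanD n p (F F' : sgraph 'I_n -> R) :
  gnp_mean p (fun G => F G + F' G) = gnp_mean p F + gnp_mean p F'.
Proof. by rewrite /gnp_mean -big_split; apply: eq_bigr => G _; rewrite mulrDr. Qed.

Lemma gnp_mean_sum n p (I : finType) (P : pred I) (F : I -> sgraph 'I_n -> R) :
  gnp_mean p (fun G => \sum_(i | P i) F i G) = \sum_(i | P i) gnp_mean p (F i).
Proof.
by rewrite /gnp_mean exchange_big /=; apply: eq_bigr => G _; rewrite mulr_sumr.
Qed.

Lemma ler_gnp_mean n p (F F' : sgraph 'I_n -> R) : 0 <= p <= 1 ->
  (forall G, F G <= F' G) -> gnp_mean p F <= gnp_mean p F'.
Proof.
by move=> p01 FF; apply: ler_sum => G _; rewrite ler_wpM2l ?gnp_weight_ge0.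
Qed.

Lemma gnp_mean_ge0 n p (F : sgraph 'I_n -> R) : 0 <= p <= 1 ->
  (forall G, 0 <= F G) -> 0 <= gnp_mean p F.
Proof. by move=> p01 F0; apply: sumr_ge0 => G _; rewrite mulr_ge0 ?gnp_weight_ge0. Qed.

Lemma gnp_mean1 n p : gnp_mean p (fun _ : sgraph 'I_n => 1) = 1.
Proof.
transitivity (gnp_mean p (fun G : sgraph 'I_n => \prod_(e : {set 'I_n} | #|e| == 2%N)
                   (if e \in edges G then 1 else 1 : R))).
  by apply: eq_gnp_mean => G; rewrite big1 // => e _; case: ifP.
by rewrite gnp_mean_edges big1 // => e _; lra.
Qed.

Lemma gnp_probE n p (Q : pred (sgraph 'I_n)) :
  gnp_prob p Q = gnp_mean p (fun G => (Q G)%:R).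
Proof.
rewrite /gnp_prob big_mkcond; apply: eq_bigr => G _.
by case: ifP => _; rewrite ?mulr1 ?mulr0.
Qed.

Lemma gnp_probC n p (Q : pred (sgraph 'I_n)) :
  gnp_prob p Q = 1 - gnp_prob p (predC Q).
Proof.
suff : gnp_prob p Q + gnp_prob p (predC Q) = 1 by lra.
rewrite !gnp_probE -gnp_meanD -[RHS](gnp_mean1 n p).
by apply: eq_gnp_mean => G /=; case: (Q G) => /=; rewrite ?addr0 ?add0r.
Qed.

Lemma gnp_prob_ge0 n p (Q : pred (sgraph 'I_n)) : 0 <= p <= 1 -> 0 <= gnp_prob p Q.
Proof. by move=> p01; rewrite gnp_probE gnp_mean_ge0. Qed.

Lemma gnp_prob_markov n p (Q : pred (sgraph 'I_n)) (F : sgraph 'I_n -> R) :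
  0 <= p <= 1 -> (forall G, 0 <= F G) -> (forall G, Q G -> 1 <= F G) ->
  gnp_prob p Q <= gnp_mean p F.
Proof.
move=> p01 F0 QF; rewrite gnp_probE; apply: ler_gnp_mean => // G.
by case QG: (Q G) => /=; [exact: QF|exact: F0].
Qed.

Lemma gnp_prob_sub n p (Q Q' : pred (sgraph 'I_n)) : 0 <= p <= 1 ->
  (forall G, Q G -> Q' G) -> gnp_prob p Q <= gnp_prob p Q'.
Proof.
move=> p01 QQ; rewrite [in leRHS]gnp_probE; apply: gnp_prob_markov => // G /QQ -> //.
Qed.

Lemma gnp_probU n p (Q Q1 Q2 : pred (sgraph 'I_n)) : 0 <= p <= 1 ->
  (forall G, Q G -> Q1 G || Q2 G) -> gnp_prob p Q <= gnp_prob p Q1 + gnp_prob p Q2.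
Proof.
move=> p01 QQ; rewrite !(gnp_probE _ Q1) !(gnp_probE _ Q2) -gnp_meanD; apply: gnp_prob_markov => // G.
by move/QQ/orP => [] -> /=; rewrite ?lerDl ?lerDr.
Qed.

Lemma gnp_prob_exists n p (I : finType) (P : pred I) (Q : I -> pred (sgraph 'I_n)) :
  0 <= p <= 1 ->
  gnp_prob p (fun G => [exists i, P i && Q i G]) <= \sum_(i | P i) gnp_prob p (Q i).
Proof.
move=> p01; under [leRHS]eq_bigr do rewrite gnp_probE.
rewrite -gnp_mean_sum; apply: gnp_prob_markov => // [G|G /existsP[i /andP[Pi Qi]]].
  exact: sumr_ge0.
by rewrite (bigD1 i) //= Qi lerDl sumr_ge0.
Qed.

(** Used with families that name edges by vertices or by pairs (z, y), for which
    the product over all edges has to be regrouped. *)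
Lemma gnp_mean_indep n p (I : finType) (P : pred I) (ed : I -> {set 'I_n})
    (a b : I -> R) :
  {in P &, injective ed} -> {in P, forall i, #|ed i| == 2%N} ->
  gnp_mean p (fun G => \prod_(i | P i) (if ed i \in edges G then a i else b i)) =
  \prod_(i | P i) (p * a i + (1 - p) * b i).
Proof.
move=> inj ed2.
pose f c e : R := \prod_(i | P i && (ed i == e)) c i.
transitivity (gnp_mean p (fun G => \prod_(e : {set 'I_n} | #|e| == 2%N)
                   (if e \in edges G then f a e else f b e))).
  apply: eq_gnp_mean => G.
  rewrite (partition_big ed (fun e => #|e| == 2%N)) //.
  apply: eq_bigr => e e2; rewrite /f; case: ifP => eG; apply: eq_bigr => i /andP[_ /eqP->];
  by rewrite eG.
rewrite gnp_mean_edges [RHS](partition_big ed (fun e => #|e| == 2%N)) //.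
apply: eq_bigr => e e2; rewrite /f.
case: (pickP (fun i => P i && (ed i == e))) => [i Pi|no].
  have H j : P j && (ed j == e) = (j == i).
    apply/idP/eqP => [|->//]; case/andP: Pi => Pi /eqP ei /andP[Pj /eqP ej].
    by apply: inj => //; rewrite ei ej.
  by rewrite !(eq_bigl _ _ H) !big_pred1_eq.
by rewrite !big_pred0 //; lra.
Qed.

End Expectation.

(** * Columns: independence and parity *)

Section Columns.
Variable R : realType.
Implicit Types (n : nat) (p : R).

Lemma adjC (V : finType) (G : sgraph V) x y : adj G x y = adj G y x.
Proof. by rewrite /adj finset.setUC. Qed.

Lemma adjxx (V : finType) (G : sgraph V) x : adj G x x = false.
Proof. by apply/negP => /edges_size2; rewrite finset.setUid cards1. Qed.

Lemma exp_deg_in n (G : sgraph 'I_n) (A : {set 'I_n}) z (a : R) :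
  a ^+ deg_in G A z = \prod_(y in A) (if [set z; y]%SET \in edges G then a else 1).
Proof.
rewrite -big_mkcondr /= /deg_in -prodr_const; apply: eq_bigl => y.
by rewrite !inE andbC.
Qed.

Lemma column_edges_inj n (A : {set 'I_n}) :
  {in [pred i : 'I_n * 'I_n | (i.1 \notin A) && (i.2 \in A)] &,
    injective (fun i : 'I_n * 'I_n => [set i.1; i.2]%SET)}.
Proof.
move=> [z y] [z' y'] /=; rewrite !inE /= => /andP[zA yA] /andP[z'A y'A] E.
have := set21 z y; rewrite E !inE => /orP[] /eqP ez; last by rewrite ez y'A in zA.
have := set22 z y; rewrite E !inE => /orP[] /eqP ey; first by rewrite -ey yA in z'A.
by rewrite ez ey.
Qed.

Lemma column_edges_size2 n (A : {set 'I_n}) :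
  {in [pred i : 'I_n * 'I_n | (i.1 \notin A) && (i.2 \in A)],
    forall i : 'I_n * 'I_n, #|[set i.1; i.2]%SET| == 2%N}.
Proof.
move=> [z y] /=; rewrite inE /= => /andP[zA yA]; rewrite cards2.
by have -> : z != y by apply: contraNneq zA => ->.
Qed.

(** For z outside A the edges from z to A form disjoint blocks, so the degrees
    into A are independent.  Only functions al * a ^ d + be * b ^ d of the degree d
    occur in what follows; expanding the product over z turns the integrand into
    products over edges, which avoids any general theory of independence. *)
Lemma gnp_mean_columns n p (A : {set 'I_n}) (al be : 'I_n -> R) (a b : R) :
  gnp_mean p (fun G => \prod_(z | z \notin A)
     (al z * a ^+ deg_in G A z + be z * b ^+ deg_in G A z)) =
  \prod_(z | z \notin A)
     (al z * (1 - p + p * a) ^+ #|A| + be z * (1 - p + p * b) ^+ #|A|).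
Proof.
have distr (F F' : 'I_n -> R) : \prod_(z | z \notin A) (F z + F' z) =
    \sum_(J : {set 'I_n}) \prod_z (if z \in J then if z \notin A then F z else 0
                                   else if z \notin A then F' z else 1).
  rewrite big_mkcond /=.
  transitivity (\prod_z ((if z \notin A then F z else 0) +
                         (if z \notin A then F' z else 1))).
    by apply: eq_bigr => z _; case: ifP => //; rewrite add0r.
  by rewrite bigA_distr /=; apply: eq_bigl => J; rewrite inE.
rewrite distr.
under eq_gnp_mean do rewrite distr.
rewrite gnp_mean_sum; apply: eq_bigr => J _.
case: (boolP [exists z, (z \in J) && (z \in A)]) => [/existsP[z /andP[zJ zA]]|/existsPn JA].
  rewrite [RHS](bigD1 z) //= zJ zA /= mul0r.
  rewrite -[RHS](mul0r (gnp_mean p (fun _ : sgraph 'I_n => 0))) -gnp_meanZ.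
  by apply: eq_gnp_mean => G; rewrite (bigD1 z) //= zJ zA /= !mul0r.
pose c z := if z \in J then al z else be z.
pose t z := if z \in J then a else b.
transitivity (\prod_(z | z \notin A) (c z * (1 - p + p * t z) ^+ #|A|)); last first.
  rewrite big_mkcond /=; apply: eq_bigr => z _; rewrite /c /t.
  by move: (JA z); case: (z \in J); case: (z \in A).
transitivity (gnp_mean p (fun G => (\prod_(z | z \notin A) c z) *
  \prod_(i : 'I_n * 'I_n | (i.1 \notin A) && (i.2 \in A))
     (if [set i.1; i.2]%SET \in edges G then t i.1 else 1))).
  apply: eq_gnp_mean => G.
  rewrite -(pair_big (fun z => z \notin A) (fun y => y \in A)
    (fun z y => if [set z; y]%SET \in edges G then t z else 1)) /= -big_split /=.
  rewrite [RHS]big_mkcond /=; apply: eq_bigr => z _; rewrite -exp_deg_in /c /t.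
  by move: (JA z); case: (z \in J); case: (z \in A).
rewrite gnp_meanZ gnp_mean_indep; last 2 first.
- exact: column_edges_inj.
- exact: column_edges_size2.
rewrite big_split /=; congr (_ * _).
rewrite -(pair_big (fun z => z \notin A) (fun y => y \in A)
    (fun z y => p * t z + (1 - p) * 1)) /=; apply: eq_bigr => z _.
by rewrite prodr_const addrC mulr1.
Qed.

(** The probability that a vertex outside a k-set has an odd number of neighbours
    in it: the mean of (1 - (-1) ^ d) / 2 for d binomial. *)
Definition odd_prob p k : R := (1 - (1 - 2 * p) ^+ k) / 2.

Lemma card_notin n (A : {set 'I_n}) : #|[pred z | z \notin A]| = (n - #|A|)%N.
Proof.
rewrite -[X in (X - _)%N](card_ord n) -(cardC (mem A)) addKn.
by apply: eq_card.
Qed.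

(** The parity indicator as a combination of the two characters 1 and (-1) ^ d,
    which is the shape that gnp_mean_columns integrates. *)
Lemma exp_odd_outside n (G : sgraph 'I_n) (A : {set 'I_n}) (u : R) :
  u ^+ #|odd_outside G A| = \prod_(z | z \notin A)
     ((1 + u) / 2 * 1 ^+ deg_in G A z + (1 - u) / 2 * (-1) ^+ deg_in G A z).
Proof.
rewrite -prodr_const big_mkcond [RHS]big_mkcond /=; apply: eq_bigr => z _.
rewrite !inE; case: (z \in A) => //=; rewrite expr1n -signr_odd.
by case: odd => /=; rewrite ?expr1 ?expr0; field.
Qed.

Lemma gnp_mean_odd_outside n p (A : {set 'I_n}) (u : R) :
  gnp_mean p (fun G => u ^+ #|odd_outside G A|) =
  (1 - (1 - u) * odd_prob p #|A|) ^+ (n - #|A|).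
Proof.
under eq_gnp_mean do rewrite exp_odd_outside.
rewrite (gnp_mean_columns p A (fun=> _) (fun=> _)) prodr_const card_notin.
congr (_ ^+ _); rewrite /odd_prob.
have -> : 1 - p + p * 1 = 1 by ring.
have -> : 1 - p + p * -1 = 1 - 2 * p by ring.
by rewrite expr1n; field.
Qed.
End Columns.

(** * Extremal sets for the diagonal distance *)

Section Deterministic.
Local Open Scope nat_scope.
Variables (V : finType) (G : sgraph V).
Implicit Types (x y z : V) (A : {set V}).

Lemma bigminn_le (I : finType) (P : pred I) (F : I -> nat) N i :
  P i -> \big[minn/N]_(j | P j) F j <= F i.
Proof.
move=> Pi; rewrite -big_filter; have : i \in [seq j <- index_enum I | P j].
  by rewrite mem_filter Pi mem_index_enum.
elim: [seq j <- _ | _] => // j r IH; rewrite inE big_cons => /orP[/eqP<-|/IH le_r].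
  exact: geq_minl.
exact: leq_trans (geq_minr _ _) le_r.
Qed.

Lemma bigminn_ge (I : finType) (P : pred I) (F : I -> nat) N t :
  t <= N -> (forall i, P i -> t <= F i) -> t <= \big[minn/N]_(j | P j) F j.
Proof. by move=> tN tF; elim/big_ind: _ => // a b; rewrite leq_min => -> ->. Qed.

(** minn has no neutral element on nat, so the default value survives in the
    minimum and bounds it. *)
Lemma bigminn_le_default (I : finType) (P : pred I) (F : I -> nat) N :
  \big[minn/N]_(j | P j) F j <= N.
Proof.
elim/big_rec: _ => // i a _; exact: leq_trans (geq_minr _ _).
Qed.

Lemma odd_outsideT : odd_outside G finset.setT = finset.set0.
Proof. by apply/setP => z; rewrite !inE. Qed.

Lemma diagdist_le A : A != finset.set0 -> diagdist G <= #|A| + #|odd_outside G A|.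
Proof. by move=> A0; exact: (bigminn_le (P := fun A => A != finset.set0)). Qed.

Lemma diagdist_ge t : 0 < #|V| ->
  (forall A, A != finset.set0 -> t <= #|A| + #|odd_outside G A|) -> t <= diagdist G.
Proof.
move=> V0 H; apply: bigminn_ge => //.
have := H finset.setT; rewrite odd_outsideT cards0 addn0 cardsT; apply.
by rewrite -card_gt0 cardsT.
Qed.

Lemma diagdist_attained : 0 < #|V| ->
  exists2 A, A != finset.set0 & #|A| + #|odd_outside G A| <= diagdist G.
Proof.
move=> V0; suff /existsP[A /andP[A0 Ad]] :
    [exists A : {set V}, (A != finset.set0) && (#|A| + #|odd_outside G A| <= diagdist G)].
  by exists A.
apply: contraT => /existsPn no; have := @diagdist_ge (diagdist G).+1 V0; rewrite ltnn; apply.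
by move=> A A0; have := no A; rewrite A0 -ltnNge.
Qed.

Lemma deg_in1 x z : deg_in G [set x]%SET z = adj G z x.
Proof.
rewrite /deg_in; case: (boolP (adj G z x)) => zx.
  suff -> : nbh G z :&: [set x]%SET = [set x]%SET by rewrite cards1.
  by apply/setP => y; rewrite !inE; case: eqP => [->|]; rewrite ?andbF ?zx.
apply/eqP; rewrite cards_eq0; apply/eqP/setP => y; rewrite !inE.
by case: eqP => [->|]; rewrite ?andbF ?(negbTE zx).
Qed.

Lemma deg_inU A (B : {set V}) z : [disjoint A & B] -> deg_in G (A :|: B) z = deg_in G A z + deg_in G B z.
Proof.
move=> AB; rewrite /deg_in finset.setIUr cardsU.
have -> : (nbh G z :&: A) :&: (nbh G z :&: B) = finset.set0; last by rewrite cards0 subn0.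
apply/setP => y; rewrite !inE; case: (boolP (y \in A)) => [/(disjointFr AB) ->|];
by rewrite ?andbF.
Qed.

Lemma deg_in_sum A z : deg_in G A z = \sum_(y in A) adj G z y.
Proof.
rewrite /deg_in -sum1_card big_mkcond [RHS]big_mkcond /=; apply: eq_bigr => y _.
by rewrite !inE; case: adj; case: (y \in A).
Qed.

Lemma odd_outside1 x : odd_outside G [set x]%SET = nbh G x.
Proof.
apply/setP => z; rewrite !inE deg_in1 oddb adjC; case: eqP => // ->.
by rewrite adjxx.
Qed.

Lemma odd_outside2 x y : x != y ->
  odd_outside G [set x; y]%SET = symdiff (nbh G x) (nbh G y) :\: [set x; y]%SET.
Proof.
move=> xy; apply/setP => z; rewrite !inE deg_inU ?deg_in1; last first.
  by rewrite disjoints1 inE.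
rewrite oddD !oddb ![adj G z _]adjC; congr (_ && _).
by case: adj; case: adj.
Qed.

Lemma mindeg_le x : mindeg G <= #|nbh G x|.
Proof. exact: bigminn_le. Qed.

(** Singletons have cost 1 + degree; the default value of the minimum over the
    vertices causes no harm because it also bounds diagdist. *)
Lemma diagdist_mindeg : diagdist G <= mindeg G + 1.
Proof.
rewrite addn1 -ltnS.
suff : (diagdist G).-1 <= mindeg G by lia.
apply: bigminn_ge => [|x _].
  by have := bigminn_le_default (fun A : {set V} => A != finset.set0)
     (fun A => #|A| + #|odd_outside G A|) #|V|; rewrite -/(diagdist G); lia.
have := @diagdist_le [set x]%SET; rewrite odd_outside1 cards1 -card_gt0 cards1.
by move=> /(_ isT); lia.
Qed.

Lemma min_symdiff_le x y : x != y -> min_symdiff G <= #|odd_outside G [set x; y]%SET|.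
Proof.
move=> xy; rewrite odd_outside2 //.
exact: (@bigminn_le _ (fun xy : V * V => xy.1 != xy.2) _ _ (x, y)).
Qed.

Lemma diagdist_min_symdiff : diagdist G <= 2 + min_symdiff G.
Proof.
suff : diagdist G - 2 <= min_symdiff G by lia.
apply: bigminn_ge => [|[x y] /= xy].
  by have := bigminn_le_default (fun A : {set V} => A != finset.set0)
     (fun A => #|A| + #|odd_outside G A|) #|V|; rewrite -/(diagdist G); lia.
have := @diagdist_le [set x; y]%SET; rewrite odd_outside2 // cards2 xy -card_gt0 cards2.
by move=> /(_ isT); lia.
Qed.

(** Sets of one vertex give exactly 1 + degree, so equality can only be spoilt by
    a set of at least two vertices.  Both regimes of part (i) refute such a set. *)
Lemma diagdist_mindegP : 0 < #|V| ->
  (forall A, 2 <= #|A| -> ~~ (#|A| + #|odd_outside G A| <= mindeg G)) ->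
  diagdist G = mindeg G + 1.
Proof.
move=> V0 H; apply/eqP; rewrite eqn_leq diagdist_mindeg /=.
apply: diagdist_ge => // A; rewrite -card_gt0 => A0.
have [A2|A2] := leqP 2 #|A|; first by have := H A A2; lia.
have /cards1P[x Ax] : #|A| == 1 by lia.
by rewrite Ax odd_outside1 cards1; have := mindeg_le x; lia.
Qed.

(** Pairs give exactly 2 + |symmetric difference|, so equality can only be spoilt
    by a set whose size is not 2.  Single vertices are not exempt here. *)
Lemma diagdist_min_symdiffP : 0 < #|V| ->
  (forall A, 0 < #|A| -> #|A| != 2 -> ~~ (#|A| + #|odd_outside G A| <= 1 + min_symdiff G)) ->
  diagdist G = 2 + min_symdiff G.
Proof.
move=> V0 H; apply/eqP; rewrite eqn_leq diagdist_min_symdiff /=.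
apply: diagdist_ge => // A; rewrite -card_gt0 => A0.
have [/cards2P[x [y [xy ->]]]|A2] := boolP (#|A| == 2); last by have := H A A0 A2; lia.
by rewrite cards2 xy; have := min_symdiff_le xy; lia.
Qed.

End Deterministic.

(** * First moment bounds *)

Section FirstMoment.
Variable R : realType.
Implicit Types (n : nat) (p : R).

Lemma odd_prob_itv p k : 0 <= p <= 1 -> 0 <= odd_prob p k <= 1.
Proof.
move=> /andP[p0 p1].
have : `|(1 - 2 * p) ^+ k| <= 1 by rewrite normrX exprn_ile1 // ler_norml; lra.
by rewrite ler_norml /odd_prob => /andP[]; lra.
Qed.

Lemma sum_set_exp n (x y : R) :
  \sum_(A : {set 'I_n}) x ^+ #|A| * y ^+ (n - #|A|) = (x + y) ^+ n.
Proof.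
transitivity (\prod_(i < n) (x + y)); last by rewrite prodr_const card_ord.
rewrite bigA_distr /=; apply: eq_big => [A|A _]; first by rewrite inE.
rewrite -card_notin -!prodr_const [in LHS]big_mkcond [X in _ * X]big_mkcond -big_split /=.
by apply: eq_bigr => i _; rewrite inE; case: (i \in A); rewrite ?mulr1 ?mul1r.
Qed.

Lemma exp_le_expR (x : R) n : 0 <= 1 + x -> (1 + x) ^+ n <= expR (n%:R * x).
Proof. by move=> x0; rewrite expRM_natl lerXn2r ?nnegrE ?expR_ge0 ?expR_ge1Dx. Qed.

(** Markov's inequality for the weighted count of the sets A, the weight being
    exp(a (k0 - |A|) + s (m - |A| - |odd|)) >= 1.  Summing over all sets A by the
    binomial theorem replaces the entropy estimates for binomial coefficients: with
    a = 0 the bound is sharp to the exponential order, and a = ln n makes the factor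
    n ^ k0 appear for sets of size at most k0. *)
Lemma first_moment n p (P : pred nat) (k0 m a s g : R) :
  0 <= p <= 1 -> 0 <= a -> 0 <= s -> 0 <= g <= 1 ->
  (forall k, (k <= n)%N -> P k -> g <= odd_prob p k) ->
  gnp_prob p (fun G : sgraph 'I_n => [exists A : {set 'I_n},
     [&& P #|A|, #|A|%:R <= k0 & (#|A| + #|odd_outside G A|)%:R <= m]])
  <= expR (a * k0 + s * m) *
     (expR (- a - s) + (1 - (1 - expR (- s)) * g)) ^+ n.
Proof.
move=> p01 a0 s0 g01 Pg.
have u01 : 0 <= expR (- s) <= 1 by rewrite expR_ge0 expR_le1; lra.
pose F (G : sgraph 'I_n) := \sum_(A : {set 'I_n} | P #|A|)
  (expR (a * k0 + s * m) * expR (- a - s) ^+ #|A|) * expR (- s) ^+ #|odd_outside G A|.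
have F0 G (A : {set 'I_n}) : 0 <= (expR (a * k0 + s * m) * expR (- a - s) ^+ #|A|) *
   expR (- s) ^+ #|odd_outside G A|.
  by rewrite !mulr_ge0 ?exprn_ge0 ?expR_ge0.
apply: (@le_trans _ _ (gnp_mean p F)).
  apply: gnp_prob_markov => // [G|G /existsP[A /and3P[PA Ak Am]]].
    by apply: sumr_ge0.
  rewrite /F (bigD1 A) //= -[leLHS]addr0 lerD ?sumr_ge0 //.
  rewrite -!expRM_natl -!expRD -[leLHS]expR0 ler_expR.
  move: Am; rewrite natrD.
  set x := #|A|%:R in Ak *; set y := #|odd_outside G A|%:R => Am.
  have : 0 <= a * (k0 - x) by rewrite mulr_ge0 // subr_ge0.
  have : 0 <= s * (m - (x + y)) by rewrite mulr_ge0 // subr_ge0.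
  lra.
rewrite gnp_mean_sum.
apply: (@le_trans _ _ (\sum_(A : {set 'I_n}) expR (a * k0 + s * m) *
   (expR (- a - s) ^+ #|A| * (1 - (1 - expR (- s)) * g) ^+ (n - #|A|)))); last first.
  by rewrite -mulr_sumr sum_set_exp.
have b0 : 0 <= 1 - (1 - expR (- s)) * g by nra.
rewrite [leLHS]big_mkcond; apply: ler_sum => A _; case: ifP => PA; last first.
  by rewrite !mulr_ge0 ?exprn_ge0 ?expR_ge0.
rewrite gnp_meanZ gnp_mean_odd_outside mulrA ler_wpM2l ?mulr_ge0 ?exprn_ge0 ?expR_ge0 //.
have kn : (#|A| <= n)%N by rewrite -[X in (_ <= X)%N]card_ord max_card.
have := Pg _ kn PA; have := odd_prob_itv #|A| p01 => ok gk.
by rewrite lerXn2r ?nnegrE //; nra.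
Qed.

(** Chernoff's bound; for a vertex or a pair of vertices it controls the minimum
    degree or the minimum symmetric difference from above. *)
Lemma odd_outside_upper_tail n p (A : {set 'I_n}) (m s : R) :
  0 <= p <= 1 -> 0 <= s ->
  gnp_prob p (fun G => m <= #|odd_outside G A|%:R) <=
  expR (n%:R * ((expR s - 1) * odd_prob p #|A|) - s * m).
Proof.
move=> p01 s0; have := odd_prob_itv #|A| p01 => ok.
have es : 1 <= expR s by rewrite -expR0 ler_expR.
apply: (@le_trans _ _ (gnp_mean p (fun G => expR (- (s * m)) *
   expR s ^+ #|odd_outside G A|))).
  apply: gnp_prob_markov => // G mG.
  by rewrite -expRM_natl -expRD -[leLHS]expR0 ler_expR; nra.
rewrite gnp_meanZ gnp_mean_odd_outside mulrC expRD ler_wpM2r ?expR_ge0 //.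
have -> : 1 - (1 - expR s) * odd_prob p #|A| = 1 + (expR s - 1) * odd_prob p #|A| by ring.
apply: le_trans (exp_le_expR _ _) _; first by nra.
rewrite ler_expR ler_wpM2r //; first by nra.
by rewrite ler_nat leq_subr.
Qed.

End FirstMoment.

(** * The constants lambda0 and p0 *)

Section ConstantsTheory.
Local Open Scope classical_set_scope.
Local Open Scope ring_scope.
Variable R : realType.
Implicit Types (l y : R).

(** ln 2 times the entropy exponent H(l) + l log2 3 - 1 of the number of words
    of length n with l n nonzero letters among three, divided by 2 ^ n.  Such words
    encode disjoint pairs (A, odd set of A) weighted by 2 ^ |A|. *)
Definition ternary_gap l : R := l * ln 3 - l * ln l - (1 - l) * ln (1 - l) - ln 2.

Lemma ln2_gt0 : 0 < ln 2 :> R.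
Proof. by rewrite ln_gt0 // ltr1n. Qed.

(** The chain rule for entropy: choosing l n positions and then two thirds of them
    for A costs H(l) + l H(2/3), and l H(2/3) = l log2 3 - 2 l / 3. *)
Lemma hfunE l : 0 < l <= 1 -> hfun l * ln 2 = ternary_gap l.
Proof.
move=> /andP[l0 l1]; have l2 := ln2_gt0.
rewrite /hfun /gfun /entropy /log2 /ternary_gap.
have a0 : 0 < 1 - 2 * l / 3 by lra.
have -> : (l - 2 * l / 3) / (1 - 2 * l / 3) = (l / 3) / (1 - 2 * l / 3).
  by congr (_ / _); field.
have -> : 1 - l / 3 / (1 - 2 * l / 3) = (1 - l) / (1 - 2 * l / 3).
  by field; rewrite gt_eqF //; lra.
have -> : ln (2 * l / 3) = ln 2 + ln l - ln 3.
  by rewrite ln_div ?lnM ?posrE //; lra.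
have -> : ln (l / 3 / (1 - 2 * l / 3)) = ln l - ln 3 - ln (1 - 2 * l / 3).
  by rewrite !ln_div ?posrE ?divr_gt0 //; lra.
have E : (1 - l) * ln ((1 - l) / (1 - 2 * l / 3)) =
         (1 - l) * (ln (1 - l) - ln (1 - 2 * l / 3)).
  have [->|l1'] := eqVneq l 1; first by rewrite subrr !mul0r.
  by rewrite ln_div ?posrE //; lra.
set a := 1 - 2 * l / 3 in a0 E *.
have -> : (1 - l) / a * (ln ((1 - l) / a) / ln 2) =
   ((1 - l) * ln ((1 - l) / a)) / (a * ln 2) by field; rewrite !gt_eqF.
rewrite E; have -> : l = (1 - a) * 3 / 2 by rewrite /a; field.
by field; rewrite !gt_eqF.
Qed.

(** -l ln l is nonnegative and 1 - l <= 1/2, which leaves l (ln 3 - ln 2). *)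
Lemma ternary_gap_gt0 l : 1 / 2 <= l <= 1 -> 0 < ternary_gap l.
Proof.
move=> /andP[l12 l1]; rewrite /ternary_gap.
have l23 : ln 2 < ln 3 :> R by rewrite ltr_ln ?posrE //; lra.
have h1 : l * ln l <= 0 by rewrite mulr_ge0_le0 ?ln_le0 //; lra.
have h2 : (1 - l) * ln (1 - l) <= - (1 - l) * ln 2.
  have [->|l1'] := eqVneq l 1; first by rewrite subrr oppr0 !mul0r.
  rewrite mulNr -mulrN -lnV ?posrE // ler_wpM2l ?ler_ln ?posrE //; lra.
nra.
Qed.

Lemma ternary_gap_16 : ternary_gap (16^-1) < 0.
Proof.
have l2 := ln2_gt0.
have l3 : ln 3 <= 2 * ln 2 :> R.
  rewrite mulr_natl -lnXn // ler_ln ?posrE //; lra.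
have l16 : ln (16^-1) = - (4 * ln 2) :> R.
  rewrite lnV ?posrE // mulr_natl -lnXn //; congr (- ln _); ring.
have l15 : - ln (1 - 16^-1) <= ln 2 / 4 :> R.
  rewrite -lnV ?posrE //; last lra.
  suff : 4 * ln (1 - 16^-1)^-1 <= ln 2 :> R by lra.
  rewrite mulr_natl -lnXn; last by rewrite invr_gt0; lra.
  rewrite ler_ln ?posrE ?exprn_gt0 ?invr_gt0 //; try lra.
  by rewrite (_ : 1 - 16^-1 = 15 / 16 :> R) ?invf_div; [lra|field].
rewrite /ternary_gap l16; lra.
Qed.

Lemma ternary_gap_continuous l : 0 < l < 1 -> {for l, continuous ternary_gap}.
Proof.
move=> /andP[l0 l1]; rewrite /ternary_gap.
apply: cvgB; last exact: cvg_cst.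
apply: cvgB; first apply: cvgB.
- by apply: cvgM; [exact: cvg_id|exact: cvg_cst].
- by apply: cvgM; [exact: cvg_id|exact: continuous_ln].
have c1 : (1 - x) @[x --> l] --> 1 - l by apply: cvgB; [exact: cvg_cst|exact: cvg_id].
apply: cvgM => //; have h : {for 1 - l, continuous (@ln R)} by apply: continuous_ln; lra.
exact: cvg_comp c1 h.
Qed.

(** The sign change between 1/16 and 1/2 gives a root, and no root lies in
    [1/2, 1], so the selected one is below 1/2.  These are the only facts about the
    numerical value of lambda0 that the argument uses. *)
Lemma lambda0P : (0 < @lambda0 R < 1 / 2) /\ ternary_gap (@lambda0 R) = 0.
Proof.
have l2 := ln2_gt0.
have [c c01 hc] : exists2 c, c \in `[16^-1, 1 / 2] & ternary_gap c = 0.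
  apply: IVT; first lra.
    apply/continuous_in_subspaceT => x; rewrite inE /= in_itv /= => /andP[x1 x2].
    by apply: ternary_gap_continuous; lra.
  rewrite ge_min le_max (ltW ternary_gap_16) /=.
  have h : 0 < ternary_gap (1 / 2) by apply: ternary_gap_gt0; lra.
  by rewrite (ltW h) orbT.
move: c01; rewrite in_itv /= => /andP[c1 c2].
have : [set l : R | 0 <= l <= 1 /\ hfun l = 0]%classic (@lambda0 R).
  rewrite /lambda0; apply: xgetPex; exists c; split; first lra.
  apply: (mulIf (x := ln 2)); first by rewrite gt_eqF.
  by rewrite mul0r hfunE //; lra.
move=> /= [/andP[a0 a1] ha].
have a0' : 0 < @lambda0 R.
  rewrite lt_neqAle a0 andbT; apply/eqP => E; move: ha.
  have e0 : entropy 0 = 0 :> R.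
    by rewrite /entropy /log2 subr0 ln1; ring.
  by rewrite -E /hfun /gfun mulr0 mul0r !subr0 mul0r e0; lra.
have h := hfunE (l := lambda0); rewrite a0' a1 ha mul0r in h.
have {}h : ternary_gap (@lambda0 R) = 0 by rewrite h.
split=> //; rewrite a0' /= ltNge; apply/negP => al.
by have := @ternary_gap_gt0 lambda0; rewrite h ltxx al a1 => /(_ isT).
Qed.

(** The parameter y for which the ternary generating function (1 + 3 y) ^ n is
    concentrated on words of weight lambda0 * n. *)
Definition tilt : R := lambda0 / (3 * (1 - lambda0)).

Lemma tilt_itv : 0 < tilt < 1.
Proof.
have [/andP[a b] _] := lambda0P; rewrite /tilt divr_gt0 ?mulr_gt0 //=; try lra.
by rewrite ltr_pdivrMr ?mulr_gt0 //; lra.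
Qed.

Lemma tiltE : ln (1 + 3 * tilt) = lambda0 * ln tilt + ln 2.
Proof.
have [/andP[a b] h] := lambda0P.
have -> : 1 + 3 * tilt = (1 - lambda0)^-1 by rewrite /tilt; field; lra.
rewrite /tilt ln_div ?posrE ?mulr_gt0 //; try lra.
rewrite lnM ?posrE //; try lra.
rewrite lnV ?posrE; last lra.
move: h; rewrite /ternary_gap; lra.
Qed.

(** Weighted arithmetic-geometric mean inequality for 1 + 3 y with weights
    1 - lambda0 and lambda0; tiltE is its case of equality.  Hence
    (1 + 3 y) ^ n >= 2 ^ n y ^ (lambda0 n), with equality at the tilt. *)
Lemma tilt_le y : 0 < y -> lambda0 * ln y + ln 2 <= ln (1 + 3 * y).
Proof.
move=> y0; have [/andP[a b] h] := lambda0P.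
have ln_le z : 0 < z -> ln z <= z - 1 :> R.
  by move=> z0; have := @le_ln1Dx R (z - 1); rewrite subrKC; apply; lra.
set S := 1 + 3 * y; have S0 : 0 < S by rewrite /S; lra.
have := ln_le ((1 - lambda0)^-1 / S).
have := ln_le (3 * y / lambda0 / S).
rewrite !ln_div ?posrE ?divr_gt0 ?invr_gt0 ?mulr_gt0 //; try lra.
rewrite lnV ?posrE ?lnM ?posrE //; try lra.
move=> /(_ isT) h1 /(_ isT) h2; move: h; rewrite /ternary_gap => h.
have h1' : lambda0 * (ln 3 + ln y - ln lambda0 - ln S) <= lambda0 * (3 * y / lambda0 / S - 1).
  by rewrite ler_wpM2l //; lra.
have h2' : (1 - lambda0) * (- ln (1 - lambda0) - ln S) <= (1 - lambda0) * ((1 - lambda0)^-1 / S - 1).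
  by rewrite ler_wpM2l //; lra.
have E : lambda0 * (3 * y / lambda0 / S - 1) + (1 - lambda0) * ((1 - lambda0)^-1 / S - 1) = 0.
  by rewrite /S; field; rewrite !gt_eqF //; lra.
lra.
Qed.

Lemma p0P : (1 / 2 < @p0 R < 1) /\ 2 * @p0 R - 2 * p0 ^+ 2 = lambda0.
Proof.
have [/andP[a b] _] := lambda0P.
suff : [set p : R | 1 / 2 < p < 1 /\ 2 * p - 2 * p ^+ 2 = lambda0]%classic (@p0 R) by [].
rewrite /p0; apply: xgetPex.
have s0 : 0 <= 1 - 2 * lambda0 :> R by lra.
have s1 : 0 < Num.sqrt (1 - 2 * lambda0 :> R) by rewrite sqrtr_gt0; lra.
have s2 := sqr_sqrtr s0.
exists ((1 + Num.sqrt (1 - 2 * lambda0)) / 2); split; last by nra.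
apply/andP; split; first lra.
suff : Num.sqrt (1 - 2 * lambda0 :> R) < 1 by lra.
by rewrite ltNge; apply/negP => h; nra.
Qed.

End ConstantsTheory.
Arguments tilt {R}.

(** * Lower bound at constant density *)

Section Asymptotics.
Variable R : realType.
Local Open Scope classical_set_scope.
Local Open Scope ring_scope.
Implicit Types (n : nat) (p : R).

(** All asymptotic comparisons are made in terms of L = ln n, with n = expR L. *)
Lemma near_ln_ge (M : R) : \forall n \near \oo, M <= ln n%:R.
Proof.
near=> n; rewrite -[M]expRK ler_ln ?posrE ?expR_gt0 //; last first.
  by rewrite ltr0n; near: n; exact: nbhs_infty_gt.
by near: n; exact: nbhs_infty_ger.
Unshelve. all: by end_near. Qed.

Lemma aas_small (p_ : nat -> R) (Q : forall n, pred (sgraph 'I_n)) : (forall n, 0 <= p_ n <= 1) ->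
  (forall e : R, 0 < e -> \forall n \near \oo, gnp_prob (p_ n) (predC (Q n)) <= e) ->
  aas p_ Q.
Proof.
move=> p01 H; apply/cvgrPdist_le => e /H; apply: filterS => n h.
by rewrite (gnp_probC (p_ n) (Q n)) subKr ger0_norm ?gnp_prob_ge0.
Qed.

Lemma expRN_le2 (s : R) : 0 <= s -> expR (- s) <= 1 - s + s ^+ 2.
Proof.
move=> s0; rewrite expRN; apply: (@le_trans _ _ (1 + s)^-1).
  by rewrite lef_pV2 ?posrE ?expR_gt0 ?expR_ge1Dx //; lra.
rewrite -[leLHS]mul1r ler_pdivrMr; last lra.
have : 0 <= s ^+ 3 by apply: exprn_ge0.
lra.
Qed.

(** Up to K sqrt n ln n, no set A whose parity probability is at least
    g <= lambda0 beats g n.  Sets of logarithmic size are few, and for them a Chernoff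
    deviation of order sqrt n ln n beats the n ^ |A| choices.  For larger sets the
    parity probability is 1/2 - O(1/n), and the first moment at the tilt decays
    because the threshold lies below lambda0 n. *)
Lemma dense_lower p (g : R) (P : pred nat) : 0 < p < 1 -> 0 <= g <= lambda0 ->
  (forall k, P k -> g <= odd_prob p k) ->
  exists2 K : R, 0 <= K & forall e : R, 0 < e -> \forall n \near \oo,
    gnp_prob p (fun G : sgraph 'I_n => [exists A : {set 'I_n}, P #|A| &&
      ((#|A| + #|odd_outside G A|)%:R <= g * n%:R - K * (Num.sqrt n%:R * ln n%:R))]) <= e.
Proof.
move=> /andP[p0 p1] /andP[g0 gl] Pg.
have p01 : 0 <= p <= 1 by lra.
have [/andP[l0 l1] _] := @lambda0P R.
have g01 : 0 <= g <= 1 by lra.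
pose r : R := Num.max `|1 - 2 * p| (1 / 2).
have r1 : r < 1 by rewrite /r gt_max ltr_norml; lra.
have r2 : 1 / 2 <= r by rewrite /r le_max lexx orbT.
have r0 : 0 < r by lra.
pose c := - ln r.
have c0 : 0 < c by rewrite oppr_gt0 ln_lt0 //; lra.
exists (c^-1 + 2) => [|e e0]; first by rewrite addr_ge0 ?invr_ge0 //; lra.
set K := c^-1 + 2; have K2 : 2 <= K by rewrite lerDr invr_ge0 ltW.
have [y0 y1] := andP (tilt_itv R).
pose t0 : R := - ln tilt.
have t00 : 0 < t0 by rewrite oppr_gt0 ln_lt0 // y0.
near=> n.
have n0 : (0 < n)%N by near: n; exact: nbhs_infty_gt.
have nR0 : 0 < n%:R :> R by rewrite ltr0n.
set L : R := ln n%:R; set S : R := Num.sqrt n%:R.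
have L1 : 1 <= L by rewrite /L; near: n; exact: near_ln_ge.
have LE : 1 - ln (e / 2) <= L by rewrite /L; near: n; exact: near_ln_ge.
have LE2 : (1 - ln (e / 2)) / (t0 * K) <= L by rewrite /L; near: n; exact: near_ln_ge.
have L0 : 0 <= L by apply: le_trans L1.
have eL : expR L = n%:R by rewrite lnK.
have S2 : S ^+ 2 = n%:R by rewrite sqr_sqrtr // ltW.
have S1 : 1 <= S by rewrite -sqrtr1 ler_sqrt ?ler1n.
(* |1 - 2 p| ^ k <= 1 / n as soon as k >= L / c. *)
pose k0 := L / c; pose m := g * n%:R - K * (S * L).
apply: (@le_trans _ _ (e / 2 + e / 2)); last by rewrite -splitr.
apply: (@le_trans _ _ (
  gnp_prob p (fun G : sgraph 'I_n => [exists A : {set 'I_n},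
     [&& P #|A|, #|A|%:R <= k0 & (#|A| + #|odd_outside G A|)%:R <= m]]) +
  gnp_prob p (fun G : sgraph 'I_n => [exists A : {set 'I_n},
     [&& P #|A| && (k0 <= #|A|%:R), #|A|%:R <= n%:R :> R &
      (#|A| + #|odd_outside G A|)%:R <= m]]))).
  apply: gnp_probU => // G /existsP[A /andP[PA Am]].
  have An : #|A|%:R <= n%:R :> R by rewrite ler_nat -[X in (_ <= X)%N]card_ord max_card.
  have [Ak|Ak] := leP #|A|%:R k0; apply/orP; [left|right]; apply/existsP; exists A.
    by rewrite PA Ak.
  by rewrite PA An (ltW Ak).
have eln2 : expR (ln (e / 2)) = e / 2 by rewrite lnK // posrE; lra.
apply: lerD.
- pose s := L / S.
  have s0 : 0 <= s by rewrite divr_ge0 ?(le_trans _ S1).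
  have sS : s * S = L by rewrite /s divfK // gt_eqF // (lt_le_trans _ S1).
  apply: (le_trans (first_moment k0 m p01 L0 s0 g01 (fun k _ => Pg k))).
  have b : expR (- L - s) + (1 - (1 - expR (- s)) * g) =
    1 + (expR (- L - s) - (1 - expR (- s)) * g) by ring.
  have es := expRN_le2 s0; have es0 := expR_ge0 (- s).
  have els : n%:R * expR (- L - s) <= 1.
    by rewrite expRD expRN eL mulrA mulfV ?gt_eqF // mul1r expR_le1 oppr_le0.
  rewrite b -eln2; apply: le_trans (ler_wpM2l (expR_ge0 _) (exp_le_expR _ _)) _.
    have es1 : expR (- s) <= 1 by rewrite expR_le1 oppr_le0.
    have : (1 - expR (- s)) * g <= 1 * 1.
      by apply: ler_pM => //; move: es1 es0 g01; clear; lra.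
    by move: (expR_ge0 (- L - s)); clear; lra.
  rewrite -expRD ler_expR.
  have h1 : n%:R * ((1 - expR (- s)) * g) >= n%:R * ((s - s ^+ 2) * g).
    by rewrite ler_wpM2l // ler_wpM2r //; move: es; clear; lra.
  have h2 : n%:R * ((s - s ^+ 2) * g) = g * s * n%:R - g * L ^+ 2.
    by rewrite -S2 -sS; ring.
  have h3 : L * k0 = c^-1 * L ^+ 2 by rewrite /k0; ring.
  have h4 : s * m = g * s * n%:R - K * L ^+ 2.
    by rewrite /m -S2 -sS; ring.
  rewrite h3 h4 mulrBr.
  have LL : L <= L ^+ 2 by rewrite expr2 ler_peMl.
  have gL : g * L ^+ 2 <= 1 * L ^+ 2 by rewrite ler_wpM2r ?sqr_ge0 //; case/andP: g01.
  by move: h1 els LL gL LE; rewrite h2 /K; clear; lra.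
- apply: (le_trans (first_moment (P := fun k => P k && (k0 <= k%:R)) (a := 0) (s := t0)
    (g := 1 / 2 - 1 / 2 / n%:R) n%:R m p01 _ _ _ _)) => //.
  + exact: ltW.
  + have : n%:R^-1 <= 1 :> R by rewrite invf_le1 // ler1n.
    have : 0 <= n%:R^-1 :> R by rewrite invr_ge0 ltW.
    by clear; lra.
  + move=> k _ /andP[_ kk].
    have : `|(1 - 2 * p) ^+ k| <= n%:R^-1.
      rewrite normrX; apply: (@le_trans _ _ (r ^+ k)).
        by rewrite lerXn2r ?nnegrE ?normr_ge0 ?(ltW r0) // /r le_max lexx.
      rewrite -{1}(lnK r0) -expRM_natl -eL -expRN ler_expR.
      by move: kk; rewrite /k0 ler_pdivrMr // /c mulrN; clear; lra.
    by rewrite ler_norml /odd_prob => /andP[]; clear; lra.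
  have et : expR (- t0) = tilt by rewrite opprK lnK.
  rewrite oppr0 sub0r mul0r add0r et.
  set B : R := (1 + 3 * tilt) / 2.
  have lB : ln B = - t0 * lambda0.
    by rewrite /B ln_div ?posrE // ?tiltE /t0; [ring|move: y0; clear; lra].
  have B0 : 0 < B by rewrite /B; move: y0; clear; lra.
  apply: (@le_trans _ _ (expR (t0 * m) * (B ^+ n * (1 + n%:R^-1) ^+ n))).
    rewrite ler_wpM2l ?expR_ge0 // -exprMn.
    have ni : 0 < n%:R^-1 :> R by rewrite invr_gt0.
    have ni1 : n%:R^-1 <= 1 :> R by rewrite invf_le1 // ler1n.
    have ty : 0 <= (1 - tilt) * n%:R^-1 :> R.
      by rewrite mulr_ge0 ?(ltW ni) // subr_ge0 ltW.
    have bB : 0 <= (B - (1 - tilt) / 2) * n%:R^-1.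
      by rewrite mulr_ge0 ?(ltW ni) // /B; move: y0; clear; lra.
    rewrite lerXn2r ?nnegrE //; [| |rewrite /B in bB *]; move: y0 y1 ni ni1 ty bB;
      rewrite /B; clear; lra.
  apply: (@le_trans _ _ (expR (t0 * m) * (expR (n%:R * (- t0 * lambda0)) * expR 1))).
    have ni : 0 <= n%:R^-1 :> R by rewrite invr_ge0 ltW.
    have h1 : (1 + n%:R^-1) ^+ n <= expR 1 :> R.
      by apply: le_trans (exp_le_expR _ _) _; rewrite ?mulfV ?gt_eqF ?addr_ge0.
    have h2 : B ^+ n <= expR (n%:R * (- t0 * lambda0)) by rewrite expRM_natl -lB lnK.
    by rewrite ler_wpM2l ?expR_ge0 // ler_pM ?exprn_ge0 ?(ltW B0) ?addr_ge0.
  rewrite -!expRD -eln2 ler_expR.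
  have : t0 * m <= t0 * (lambda0 * n%:R - K * (S * L)).
    by rewrite ler_wpM2l ?(ltW t00) // /m lerD2r ler_wpM2r // ltW.
  have : (t0 * K) * L <= (t0 * K) * (S * L).
    by rewrite ler_wpM2l ?ler_peMl // mulr_ge0 ?(ltW t00) // (le_trans _ K2).
  move: LE2; rewrite ler_pdivrMr; last by rewrite mulr_gt0 // (lt_le_trans _ K2).
  by clear; lra.
Unshelve. all: by end_near. Qed.

End Asymptotics.

(** * One set in a sparse graph: parity and overlaps *)

Section Sparse.
Variable R : realType.
Implicit Types (n k h : nat) (p : R).

(** In a sparse graph a Chernoff bound on the odd set cannot pay for the number of
    sets A when n p is close to ln n.  What makes A bad is rather that its vertices
    share many neighbours: the event says that the sum over z outside A of
    deg_in A z - h [deg_in A z odd] is at least h, where vertices with one neighbour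
    in A contribute negatively.  Exponential moments with base w can be computed
    exactly, since w ^ (d - h [d odd]) is a combination of w ^ d and (- w) ^ d. *)
Lemma overlap_prob n p (A : {set 'I_n}) h (w : R) : 0 <= p <= 1 -> 1 <= w ->
  gnp_prob p (fun G => h * (1 + #|odd_outside G A|) <=
     \sum_(z | z \notin A) deg_in G A z)%N <=
  w ^- h * ((1 + w ^- h) / 2 * (1 - p + p * w) ^+ #|A| +
            (1 - w ^- h) / 2 * (1 - p + p * - w) ^+ #|A|) ^+ (n - #|A|).
Proof.
move=> p01 w1; have w0 : 0 < w by lra.
have v0 : 0 < w ^- h by rewrite invr_gt0 exprn_gt0.
set v := w ^- h in v0 *.
have cst (x : R) : x ^+ (n - #|A|) = \prod_(z | z \notin A) x.
  by rewrite prodr_const card_notin.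
rewrite cst; have /= <- := gnp_mean_columns p A (fun=> (1 + v) / 2) (fun=> (1 - v) / 2) w (- w).
rewrite -gnp_meanZ.
have E G : \prod_(z | z \notin A) ((1 + v) / 2 * w ^+ deg_in G A z +
    (1 - v) / 2 * (- w) ^+ deg_in G A z) =
    w ^+ (\sum_(z | z \notin A) deg_in G A z) * v ^+ #|odd_outside G A|.
  rewrite -prodrXr -prodr_const.
  rewrite [LHS]big_mkcond [X in _ = X * _]big_mkcond [X in _ = _ * X]big_mkcond.
  rewrite -big_split /=; apply: eq_bigr => z _; rewrite !inE.
  case: (z \in A) => //=; first by rewrite mulr1.
  rewrite exprNn -signr_odd; case: odd; rewrite ?expr1 ?expr0 ?mulr1 ?mul1r.
    set x := w ^+ _; by field.
  set x := w ^+ _; by field.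
apply: gnp_prob_markov => // G; rewrite E.
  by rewrite !mulr_ge0 ?exprn_ge0 ?ltW.
move=> hG; rewrite /v -exprVn -exprM mulrCA -exprD exprVn ler_pdivlMr ?exprn_gt0 // mul1r.
by apply: ler_weXn2l => //; move: hG; rewrite mulnDr muln1.
Qed.

Lemma odd_outside_lower_tail n p (A : {set 'I_n}) (m s : R) : 0 <= p <= 1 -> 0 <= s ->
  gnp_prob p (fun G => #|odd_outside G A|%:R <= m) <=
  expR (s * m) * (1 - (1 - expR (- s)) * odd_prob p #|A|) ^+ (n - #|A|).
Proof.
move=> p01 s0; rewrite -gnp_mean_odd_outside -gnp_meanZ.
apply: gnp_prob_markov => // G mG.
by rewrite -expRM_natl -expRD -[leLHS]expR0 ler_expR; nra.
Qed.

(** From expR (- y) >= 1 - y, which is why y has to stay away from 1. *)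
Lemma expR_le_half (y : R) : 0 <= y <= 1 / 2 -> expR y <= 1 + y + 2 * y ^+ 2.
Proof.
move=> y01; rewrite -[y in expR y]opprK expRN.
apply: (@le_trans _ _ (1 - y)^-1).
  by rewrite lef_pV2 ?posrE ?expR_gt0 ?expR_ge1Dx //; lra.
rewrite -[leLHS]mul1r ler_pdivrMr; last lra.
have : 0 <= y ^+ 2 * (1 - 2 * y) by rewrite mulr_ge0 ?sqr_ge0 //; lra.
lra.
Qed.

Lemma bernoulli_ineq (x : R) k : 0 <= x <= 1 -> 1 - k%:R * x <= (1 - x) ^+ k.
Proof.
move=> x01; elim: k => [|k IH]; first by rewrite mul0r subr0 expr0.
have : 0 <= k%:R :> R by []. 
rewrite exprS -natr1 => k0.
have : (1 - x) * (1 - k%:R * x) <= (1 - x) * (1 - x) ^+ k by rewrite ler_wpM2l //; lra.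
nra.
Qed.

(** C(n, k) <= (e n / k) ^ k, from k ^ k / k! <= e ^ k. *)
Lemma binomial_le n k : (0 < k)%N ->
  'C(n, k)%:R * k%:R ^+ k <= n%:R ^+ k * expR k%:R :> R.
Proof.
move=> k0; have kf : 0 < k`!%:R :> R by rewrite ltr0n fact_gt0.
rewrite -(ler_pM2r kf) mulrAC -natrM bin_ffact.
have h1 : (n ^_ k)%:R <= n%:R ^+ k :> R.
  rewrite -natrX ler_nat ffact_prod.
  rewrite -[X in (_ <= n ^ X)%N](card_ord k) -prod_nat_const.
  by apply: leq_prod => i _; rewrite leq_subr.
have h2 : k%:R ^+ k <= expR k%:R * k`!%:R :> R.
  rewrite -ler_pdivrMr //; case: k k0 {kf h1} => // k _.
  by have := @expR_ge1Dxn R k.+1%:R k (ler0n _ _); lra.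
by rewrite -mulrA ler_pM ?exprn_ge0.
Qed.

(** With t = k p w small, even degrees contribute 1 + O(t ^ 2) (degree 0, and
    pairs of edges) and odd degrees v O(t), both times (1 - p) ^ k. *)
Lemma column_mean_le p k (w v : R) : 0 <= p <= 1 / 2 -> 1 <= w -> 0 <= v <= 1 ->
  2 * (k%:R * p * w) <= 1 / 2 ->
  (1 + v) / 2 * (1 - p + p * w) ^+ k + (1 - v) / 2 * (1 - p + p * - w) ^+ k <=
  expR (- (k%:R * p) + 6 * (k%:R * p * w) ^+ 2 + 3 * v * (k%:R * p * w)).
Proof.
move=> /andP[p0 p1] w1 /andP[v0 v1] kpw.
have [->|k0] := posnP k.
  rewrite !expr0 !mul0r oppr0 expr0n /= !mulr0 !addr0 expR0; lra.
have k1 : 1 <= k%:R :> R by rewrite ler1n.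
set x := p * w / (1 - p).
have x0 : 0 <= x by rewrite divr_ge0 ?mulr_ge0 //; lra.
have kx : k%:R * x <= 2 * (k%:R * p * w).
  have -> : k%:R * x = (k%:R * p * w) / (1 - p) by rewrite /x; field; lra.
  rewrite ler_pdivrMr; last lra.
  have : 0 <= k%:R * p * w by rewrite !mulr_ge0 //; lra.
  nra.
have x1 : x <= 1 by move: kx kpw; set t := k%:R * p * w; nra.
have -> : 1 - p + p * w = (1 - p) * (1 + x) by rewrite /x; field; lra.
have -> : 1 - p + p * - w = (1 - p) * (1 - x) by rewrite /x; field; lra.
rewrite (exprMn k (1 - p) (1 + x)) (exprMn k (1 - p) (1 - x)).
set y := k%:R * x in kx; set t := k%:R * p * w in kpw kx *.
have y0 : 0 <= y by rewrite mulr_ge0 //; lra.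
have e1 : (1 + x) ^+ k <= 1 + y + 2 * y ^+ 2.
  apply: le_trans (exp_le_expR _ _) _; first lra.
  by apply: expR_le_half; rewrite -/y; lra.
have e2 : (1 - x) ^+ k <= 1 - y + y ^+ 2.
  apply: le_trans (exp_le_expR _ _) _; first lra.
  by rewrite mulrN; apply: expRN_le2; rewrite -/y; lra.
have e3 : 1 - y <= (1 - x) ^+ k by apply: bernoulli_ineq; lra.
have e4 : (1 - p) ^+ k <= expR (- (k%:R * p)).
  by apply: le_trans (exp_le_expR _ _) _; [lra|rewrite mulrN].
rewrite -addrA expRD.
have y2 : 0 <= y ^+ 2 by apply: sqr_ge0.
apply: (@le_trans _ _ ((1 - p) ^+ k * (1 + (6 * t ^+ 2 + 3 * v * t)))); last first.
  have t0 : 0 <= t by lra.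
  have vt : 0 <= v * t by rewrite mulr_ge0.
  have t2 := sqr_ge0 t.
  by apply: ler_pM; rewrite ?expR_ge1Dx ?exprn_ge0 //; lra.
have b0 : 0 <= (1 - p) ^+ k by rewrite exprn_ge0 //; lra.
move: e1 e2 e3 b0; set a := (1 + x) ^+ k; set b := (1 - x) ^+ k; set c := (1 - p) ^+ k.
move=> e1 e2 e3 b0.
have -> : (1 + v) / 2 * (c * a) + (1 - v) / 2 * (c * b) =
  c * ((a + b) / 2 + v * ((a - b) / 2)) by field.
rewrite ler_wpM2l //.
have h1 : v * ((a - b) / 2) <= v * (3 * t) by rewrite ler_wpM2l //; nra.
nra.
Qed.

End Sparse.

(** * Small and medium sets in sparse graphs *)

Section SparseRanges.
Variable R : realType.
Implicit Types (n k h : nat) (p : R).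

Lemma ln_le_sub1 (x : R) : 0 < x -> ln x <= x - 1.
Proof. by move=> x0; have := @le_ln1Dx R (x - 1); rewrite subrKC; apply; lra. Qed.

(** The slope only has to be small compared with the rate of the gain exp(- k n p). *)
Lemma ln_le_lin (x : R) : 0 < x -> ln x <= x / 5 + 3.
Proof.
move=> x0; have := @ln_le_sub1 (x / 5); have := @ln_le_sub1 5 (ltr0Sn R 4).
by rewrite ln_div ?posrE // divr_gt0 // => h /(_ isT); lra.
Qed.

Lemma ln_binomial_le n k : (0 < k)%N -> (0 < n)%N ->
  'C(n, k)%:R <= expR (k%:R * (ln n%:R + 1 - ln k%:R)) :> R.
Proof.
move=> k0 n0; have kR : 0 < k%:R :> R by rewrite ltr0n.
have nR : 0 < n%:R :> R by rewrite ltr0n.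
have := binomial_le R n k0.
rewrite -ler_pdivlMr ?exprn_gt0 // => h; apply: le_trans h _.
rewrite mulrBr mulrDr mulr1 expRB expRD !expRM_natl !lnK ?posrE //.
Qed.

Lemma sqr_expR_half_ln p : 0 < p -> expR (ln p / 2) ^+ 2 = p.
Proof. by move=> p0; rewrite -expRM_natl mulrC divfK // lnK. Qed.

Lemma range_positivity n k p : (2 <= k)%N -> 100 * k%:R <= (n%:R : R) -> 0 < p ->
  [/\ (2 : R) <= k%:R, (0 < n)%N, (0 : R) <= ln n%:R & 0 < n%:R * p].
Proof.
move=> k2 kn p0; have kR : 2 <= k%:R :> R by rewrite ler_nat.
have nR : 0 < n%:R :> R by move: kR kn; clear; lra.
have n0 : (0 < n)%N by rewrite -(ltr0n R).
by split=> //; rewrite ?mulr_gt0 // ln_ge0 // ler1n.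
Qed.

Lemma natr_subn_ge n k : 100 * k%:R <= (n%:R : R) -> 99 / 100 * n%:R <= ((n - k)%:R : R).
Proof.
move=> kn; have kR : 0 <= k%:R :> R by exact: ler0n.
rewrite natrB; first by move: kn; clear; lra.
by rewrite -(ler_nat R); move: kn kR; clear; lra.
Qed.

(** With w of order 1 / (k sqrt p) two edges into A cost k ^ 2 p ^ 2 w ^ 2 = O(p)
    per column, which is negligible against k p, while the factor w ^ - h gains a power
    (k sqrt p) ^ (k / 2).  The total is at most
    (n ^ (3/4) (n p) ^ (1/4) exp(- 0.93 n p)) ^ k up to constants, and
    0.75 < 0.9 * 0.93. *)
Lemma small_set_bound n k p h (A : {set 'I_n}) : (2 <= k)%N -> 100 * k%:R <= (n%:R : R) -> 0 < p -> p <= 1 / 2 ->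
  9 / 10 * ln n%:R <= n%:R * p ->
  let s := expR (ln p / 2) in (2 <= h)%N -> (k <= 2 * h)%N ->
  k%:R * s <= 1 / 10 * (1 / 100) -> #|A| = k ->
  'C(n, k)%:R * gnp_prob p (fun G => h * (1 + #|odd_outside G A|) <=
     \sum_(z | z \notin A) deg_in G A z)%N <= expR (40 - ln n%:R / 25) ^+ k.
Proof.
move=> k2 kn p0 p2 np s h2 kh ks Ak.
have [kR n0 L0 d0] := range_positivity k2 kn p0; have nk := natr_subn_ge kn.
have ln_p : ln p = ln (n%:R * p) - ln n%:R by rewrite lnM ?posrE ?ltr0n //; ring.
have s2 : s ^+ 2 = p by exact: sqr_expR_half_ln.
have s0 : 0 < s by exact: expR_gt0.
set L : R := ln n%:R in np L0 ln_p *; set d := n%:R * p in np d0 ln_p *.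
have kR0 : 0 < k%:R :> R by rewrite ltr0n ltnW.
have p01 : 0 <= p <= 1 by move: p0 p2; lra.
have ks0 : 0 < 10 * k%:R * s by rewrite !mulr_gt0 //; move: kR; lra.
(* This choice makes k p w equal to s / 10, the square root of p / 100. *)
pose w := (10 * k%:R * s)^-1.
have w100 : 100 <= w by rewrite /w -[leLHS]invrK lef_pV2 ?posrE // ?invr_gt0 //; lra.
have w1 : 1 <= w by lra.
have kpw : k%:R * p * w = s / 10.
  by rewrite /w -s2; field; rewrite !gt_eqF //; move: kR; lra.
have wk : w * (10 * k%:R * s) = 1 by rewrite mulVf // gt_eqF.
have s1 : s <= 1 / 10 * (1 / 100) by move: ks kR s0; nra.
have v1 : 0 <= w ^- h <= 10 * k%:R * s / 100.
  rewrite invr_ge0 exprn_ge0 /=; last lra.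
  apply: (@le_trans _ _ (w ^- 2)).
    by rewrite lef_pV2 ?posrE ?exprn_gt0 ?ler_weXn2l //; lra.
  rewrite expr2 invfM /w invrK ler_wpM2l //; first exact: ltW.
  by lra.
have Eb : (1 + w ^- h) / 2 * (1 - p + p * w) ^+ k +
            (1 - w ^- h) / 2 * (1 - p + p * - w) ^+ k <= expR (- (94 / 100 * k%:R * p)).
  have p12 : 0 <= p <= 1 / 2 by rewrite (ltW p0).
  have v01 : 0 <= w ^- h <= 1 by move: v1 ks; clear; lra.
  have t12 : 2 * (k%:R * p * w) <= 1 / 2 by rewrite kpw; move: s1; clear; lra.
  apply: le_trans (column_mean_le p12 w1 v01 t12) _.
  rewrite kpw ler_expR exprMn s2.
  have : 3 * w ^- h * (s / 10) <= 3 / 100 * k%:R * p.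
    have -> : 3 / 100 * k%:R * p = 3 * (10 * k%:R * s / 100) * (s / 10) by rewrite -s2; field.
    apply: ler_wpM2r; first by move: s0; clear; lra.
    by apply: ler_wpM2l => //; case/andP: v1.
  have : 2 * p <= k%:R * p by rewrite ler_pM2r.
  by clear; lra.
have E0 : 0 <= (1 + w ^- h) / 2 * (1 - p + p * w) ^+ k +
            (1 - w ^- h) / 2 * (1 - p + p * - w) ^+ k.
  have pw : p * w <= 1 / 2.
    have -> : p * w = s / (10 * k%:R) by rewrite /w -s2; field; rewrite !gt_eqF //; move: kR; lra.
    by rewrite ler_pdivrMr; move: kR s1; clear; lra.
  have pw0 : 0 <= p * w by rewrite mulr_ge0 ?(ltW p0) // (le_trans _ w1).
  have q1 : 0 <= 1 - p + p * w by move: p2 pw0; clear; lra.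
  have q2 : 0 <= 1 - p + p * - w by rewrite mulrN; move: p2 pw; clear; lra.
  have a1 : 0 <= (1 + w ^- h) / 2 by move: v1; clear; lra.
  have a2 : 0 <= (1 - w ^- h) / 2 by move: v1 ks; clear; lra.
  by rewrite addr_ge0 // mulr_ge0 // exprn_ge0.
apply: (@le_trans _ _ (expR (k%:R * (L + 1 - ln k%:R)) *
   (expR (- (h%:R * ln w)) * expR (- (94 / 100 * k%:R * p) * (99 / 100 * n%:R))))).
  apply: ler_pM => //; first by rewrite gnp_prob_ge0.
    exact: ln_binomial_le (ltnW k2) n0.
  apply: le_trans (overlap_prob A h p01 w1) _; rewrite Ak.
  rewrite expRN expRM_natl lnK ?posrE; last exact: lt_le_trans w1.
  rewrite ler_wpM2l //; first by case/andP: v1.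
  apply: (@le_trans _ _ (expR (- (94 / 100 * k%:R * p)) ^+ (n - k))).
    by rewrite lerXn2r ?nnegrE ?expR_ge0.
  rewrite -expRM_natr ler_expR ler_wnM2l // oppr_le0.
  by rewrite -mulrA mulr_ge0 ?(mulr_ge0 _ (ltW p0)) //; clear; lra.
rewrite -!expRD -expRM_natl ler_expR.
have lw : ln w = - (ln 10 + ln k%:R + ln p / 2).
  rewrite lnV ?posrE // !lnM ?posrE ?mulr_gt0 // expRK //.
have lw0 : 0 <= ln w by rewrite ln_ge0.
have hw : k%:R / 2 * ln w <= h%:R * ln w.
  rewrite ler_wpM2r // ler_pdivrMr // mulrC -natrM ler_nat //.
have lk : 0 <= ln k%:R :> R by rewrite ln_ge0 // ler1n ltnW.
have ld := ln_le_lin d0.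
have l10 := @ln_le_sub1 10 (ltr0Sn R 9).
have -> : - (94 / 100 * k%:R * p) * (99 / 100 * n%:R) = k%:R * (- (94 / 100 * (99 / 100) * d)).
  by rewrite /d; field.
apply: (@le_trans _ _ (k%:R * (L + 1 - ln k%:R - ln w / 2 - 94 / 100 * (99 / 100) * d))).
  by move: hw; clear; lra.
rewrite ler_wpM2l //; move: np lk ld l10 L0 d0; rewrite -/d lw ln_p; clear; lra.
Qed.

(** Here k is at least a large constant, so k n p dominates the threshold 5 n p and
    the odd set can be treated by a plain Chernoff bound; C(n, k) is now only about
    (n sqrt p) ^ k = (n (n p)) ^ (k / 2). *)
Lemma medium_set_bound n k p (A : {set 'I_n}) : (2 <= k)%N -> 100 * k%:R <= (n%:R : R) -> 0 < p -> p <= 1 / 2 ->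
  9 / 10 * ln n%:R <= n%:R * p ->
  let s := expR (ln p / 2) in 
  1 / 10 * (1 / 100) <= k%:R * s -> s <= (1 / 100) ^+ 3 -> k%:R * p <= 1 / 50 -> #|A| = k ->
  'C(n, k)%:R * gnp_prob p (fun G => #|odd_outside G A|%:R <= 5 * (n%:R * p))
    <= expR (40 - ln n%:R / 25) ^+ k.
Proof.
move=> k2 kn p0 p2 np s ks s6 kp Ak.
have [kR n0 L0 d0] := range_positivity k2 kn p0; have nk := natr_subn_ge kn.
have ln_p : ln p = ln (n%:R * p) - ln n%:R by rewrite lnM ?posrE ?ltr0n //; ring.
have s2 : s ^+ 2 = p by exact: sqr_expR_half_ln.
have s0 : 0 < s by exact: expR_gt0.
set L : R := ln n%:R in np L0 ln_p *; set d := n%:R * p in np d0 ln_p *.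
have p01 : 0 <= p <= 1 by move: p0 p2; lra.
have k1000 : 10 * 100 <= k%:R :> R.
  have : k%:R * s <= k%:R * (1 / 100) ^+ 3 by rewrite ler_wpM2l.
  lra.
have kp0 : 0 <= k%:R * p by rewrite mulr_ge0 // ltW.
have u20 : expR (- 5) <= 1 / 20 :> R.
  have h : 20 <= expR 5 :> R.
    apply: le_trans (@expR_ge1Dxn R 5 2 (ler0n _ _)); have -> : 3`!%:R = 6 :> R by [].
    lra.
  by rewrite expRN div1r lef_pV2 ?posrE ?expR_gt0.
have ok : 96 / 100 * (k%:R * p) <= odd_prob p k.
  have h : (1 - 2 * p) ^+ k <= 1 - (2 * (k%:R * p)) + (2 * (k%:R * p)) ^+ 2.
    apply: le_trans (exp_le_expR _ _) _; first by move: p2; lra.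
    rewrite (_ : k%:R * - (2 * p) = - (2 * (k%:R * p))); last by ring.
    by apply: expRN_le2; lra.
  rewrite /odd_prob; nra.
have ok1 := odd_prob_itv k p01.
apply: (@le_trans _ _ (expR (k%:R * (L + 1 - ln k%:R)) *
   (expR (5 * (5 * d)) * expR (- (95 / 100 * (96 / 100) * k%:R * p) * (99 / 100 * n%:R))))).
  apply: ler_pM => //; first by rewrite gnp_prob_ge0.
    exact: ln_binomial_le (ltnW k2) n0.
  apply: le_trans (odd_outside_lower_tail A _ p01 (_ : 0 <= 5)) _ => //; rewrite Ak.
  rewrite ler_wpM2l ?expR_ge0 //.
  apply: (@le_trans _ _ (expR (- (95 / 100 * (96 / 100) * k%:R * p)) ^+ (n - k))).
    have e5 := expR_ge0 (- 5 : R).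
    have h1 : 0 <= 1 - (1 - expR (- 5)) * odd_prob p k by nra.
    rewrite lerXn2r ?nnegrE ?expR_ge0 //.
    apply: le_trans (expR_ge1Dx _).
    have : 95 / 100 * (96 / 100 * (k%:R * p)) <= (1 - expR (-5)) * odd_prob p k.
      have u1 : 95 / 100 <= 1 - expR (- 5) :> R by move: u20; clear; lra.
      have z1 : 0 <= 95 / 100 :> R by clear; lra.
      have z2 : 0 <= 96 / 100 * (k%:R * p) by move: kp0; clear; lra.
      exact: ler_pM.
    by clear; lra.
  rewrite -expRM_natr ler_expR ler_wnM2l // oppr_le0.
  by rewrite -mulrA mulr_ge0 ?(mulr_ge0 _ (ltW p0)) //; clear; lra.
rewrite -!expRD -expRM_natl ler_expR.
have lk : - (3 * ln 10) - ln p / 2 <= ln k%:R.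
  have -> : - (3 * ln 10) - ln p / 2 = ln ((10 ^+ 3 * s)^-1).
    rewrite lnV ?posrE ?mulr_gt0 ?exprn_gt0 // lnM ?posrE ?exprn_gt0 // lnXn // expRK mulr_natl; ring.
  rewrite ler_ln ?posrE ?invr_gt0 ?mulr_gt0 ?exprn_gt0 //; last by lra.
  by rewrite -[leLHS]mul1r ler_pdivrMr ?mulr_gt0 ?exprn_gt0 //; lra.
have l10 := @ln_le_sub1 10 (ltr0Sn R 9).
have ld := ln_le_lin d0.
have -> : - (95 / 100 * (96 / 100) * k%:R * p) * (99 / 100 * n%:R) = k%:R * (- (95 / 100 * (96 / 100) * (99 / 100) * d)).
  by rewrite /d; field.
have h5 : 5 * (5 * d) <= k%:R * (1 / 40 * d).
  by have := ler_wpM2l (ltW d0) k1000; clear; lra.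
apply: (@le_trans _ _ (k%:R * (L + 1 - ln k%:R + 1 / 40 * d - 95 / 100 * (96 / 100) * (99 / 100) * d))).
  by move: h5; clear; lra.
rewrite ler_wpM2l //; move: np lk ld l10 L0 d0; rewrite -/d ln_p; clear; lra.
Qed.

End SparseRanges.

(** * Union bound in sparse graphs *)

Section SparseUnion.
Variable R : realType.
Implicit Types (n k : nat) (p : R).

(** For parity probabilities bounded below, sets of cost o(n) are excluded with
    exponentially small error: the first moment at u = g / 4 is (1 - g / 2) ^ n. *)
Lemma linear_regime (g : R) : 0 < g <= 1 -> exists2 c0 : R, 0 < c0 &
  forall n p (P : pred nat) (m : R), 0 <= p <= 1 ->
    (forall k, P k -> g <= odd_prob p k) -> m <= c0 * n%:R ->
  gnp_prob p (fun G : sgraph 'I_n => [exists A : {set 'I_n}, P #|A| &&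
      ((#|A| + #|odd_outside G A|)%:R <= m)]) <= expR (- (g / 4 * n%:R)).
Proof.
move=> /andP[g0 g1]; pose s := - ln (g / 4).
have s0 : 0 < s by rewrite oppr_gt0 ln_lt0 //; lra.
exists (g / 4 / s) => [|n p P m p01 Pg mn]; first by rewrite !divr_gt0.
have es : expR (- s) = g / 4 by rewrite opprK lnK // posrE; lra.
apply: (@le_trans _ _ (gnp_prob p (fun G : sgraph 'I_n => [exists A : {set 'I_n},
     [&& P #|A|, #|A|%:R <= n%:R :> R & (#|A| + #|odd_outside G A|)%:R <= m]]))).
  apply: gnp_prob_sub => // G /existsP[A /andP[PA Am]]; apply/existsP; exists A.
  by rewrite PA Am ler_nat -[X in (_ <= X)%N]card_ord max_card.
apply: (le_trans (first_moment (P := P) (a := 0) (s := s) (g := g) n%:R m p01 _ _ _ _)) => //.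
- exact: ltW.
- lra.
- by move=> k _; exact: Pg.
rewrite oppr0 sub0r mul0r add0r es.
have -> : g / 4 + (1 - (1 - g / 4) * g) = 1 + (g / 4 - (1 - g / 4) * g) by ring.
apply: le_trans (ler_wpM2l (expR_ge0 _) (exp_le_expR _ _)) _; first nra.
rewrite -expRD ler_expR.
have h1 : s * m <= g / 4 * n%:R.
  apply: (@le_trans _ _ (s * (g / 4 / s * n%:R))); first by rewrite ler_wpM2l // ltW.
  by rewrite mulrA [s * _]mulrC divfK // gt_eqF.
have h2 : n%:R * (g / 4 - (1 - g / 4) * g) <= n%:R * (- (g / 2)) by rewrite ler_wpM2l //; nra.
lra.
Qed.

Lemma sum_expS_le n (r : R) : 0 <= r <= 1 / 2 -> \sum_(i < n) r ^+ i.+1 <= 2 * r.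
Proof.
move=> r01; elim: n => [|n IH]; first by rewrite big_ord0; lra.
rewrite big_ord_recl expr1.
under eq_bigr do rewrite exprS.
rewrite -mulr_sumr /=.
have : r * \sum_(i < n) r ^+ i.+1 <= r * (2 * r) by rewrite ler_wpM2l //; lra.
nra.
Qed.

(** Converts a bound r ^ k on C(n, k) times the probability for one k-set into a
    union bound over all sets. *)
Lemma sum_sets_geometric n (r : R) : 0 <= r <= 1 / 2 ->
  \sum_(A : {set 'I_n} | (0 < #|A|)%N) r ^+ #|A| / 'C(n, #|A|)%:R <= 2 * r.
Proof.
move=> r01; apply: le_trans (sum_expS_le n r01).
have cardn (A : {set 'I_n}) : (#|A| < n.+1)%N.
  by rewrite ltnS -[X in (_ <= X)%N]card_ord max_card.
rewrite (partition_big (fun A : {set 'I_n} => Ordinal (cardn A)) xpredT) //=.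
rewrite big_ord_recl /= [X in X + _]big1 ?add0r; last first.
  by move=> A /andP[A0 /eqP/(congr1 val)] /= E; rewrite E in A0.
apply: ler_sum => i _.
have E (A : {set 'I_n}) : ((0 < #|A|)%N && (Ordinal (cardn A) == lift ord0 i)) =
    (#|A| == i.+1).
  apply/andP/eqP => [[_ /eqP/(congr1 val)] //|h]; split; first by rewrite h.
  by apply/eqP/val_inj; rewrite /= h.
rewrite (eq_bigl _ _ E) (eq_bigr (fun=> r ^+ i.+1 / 'C(n, i.+1)%:R)); last first.
  by move=> A /eqP->.
rewrite sumr_const.
have -> : #|[pred A : {set 'I_n} | #|A| == i.+1]| = 'C(n, i.+1).
  have := card_draws 'I_n i.+1; rewrite card_ord => <-.
  by apply: eq_card => A; rewrite !inE.
rewrite -[X in X <= _]mulr_natr divfK // pnatr_eq0 -lt0n bin_gt0; exact: ltn_ord.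
Qed.

(** Three ranges of |A|: below 1 / (1000 sqrt p), up to 1 / (50 p), and beyond.
    The last one has parity probability bounded below.  The function h is |A| for the
    minimum degree and |A| / 2 for the symmetric difference. *)
Lemma sparse_bad (e : R) : 0 < e -> exists2 p1 : R, 0 < p1 & exists M : R,
  forall n p (P : pred nat) (h : nat -> nat), 0 < p <= p1 -> M <= ln n%:R ->
  9 / 10 * ln n%:R <= n%:R * p ->
  (forall k, P k -> [/\ 2 <= k, 2 <= h k & k <= 2 * h k]%N) ->
  gnp_prob p (fun G : sgraph 'I_n => [exists A : {set 'I_n},
    [&& P #|A|, (#|A| + #|odd_outside G A|)%:R <= 5 * (n%:R * p) &
       (h #|A| * (1 + #|odd_outside G A|) <= \sum_(z | z \notin A) deg_in G A z)%N]])
  <= e.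
Proof.
move=> e0.
(* A lower bound for odd_prob p k when k p >= 1 / 50, as (1 - 2 p) ^ k <= expR (- 2 k p). *)
pose g : R := (1 - expR (- (1 / 25))) / 2.
have g01 : 0 < g <= 1.
  have : expR (- (1 / 25)) < 1 :> R by rewrite expR_lt1; lra.
  by have := expR_gt0 (- (1 / 25) : R); rewrite /g; lra.
have [c0 c00 lin] := linear_regime g01.
pose e' := Num.min (e / 4) (1 / 2).
have e'0 : 0 < e' by rewrite /e' lt_min; lra.
have e'1 : e' <= e / 4 by rewrite /e' ge_min lexx.
have e'2 : e' <= 1 / 2 by rewrite /e' ge_min lexx orbT.
exists (Num.min (c0 / 5) ((1 / 100) ^+ 6)).
  by rewrite lt_min exprn_gt0 ?divr_gt0.
exists (Num.max 1 (Num.max (25 * (40 - ln e')) (- ln (e / 2) / (g / 4)))).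
move=> n p P h /andP[p0]; rewrite le_min => /andP[pc p6].
rewrite !ge_max => /and3P[L1 Le' Leg] np hP.
set L := ln n%:R in L1 Le' Leg np *.
have n0 : (0 < n)%N.
  rewrite lt0n; apply/eqP => nz; move: L1; rewrite /L nz ln0 //; lra.
have nR : 0 < n%:R :> R by rewrite ltr0n.
have p12 : p <= 1 / 100 * (1 / 5) by lra.
have p01 : 0 <= p <= 1 by lra.
pose s := expR (ln p / 2).
have s2 : s ^+ 2 = p by rewrite -expRM_natl mulrC divfK // lnK.
have s6 : s <= (1 / 100) ^+ 3.
  have c6 : (0 : R) <= (1 / 100) ^+ 3 by rewrite exprn_ge0 //; lra.
  have sn : s \is Num.nneg by rewrite nnegrE expR_ge0.
  by rewrite -(ler_pXn2r (isT : (0 < 2)%N) sn) // s2 -exprM.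
pose r := expR (40 - L / 25).
have r0 : 0 <= r by exact: expR_ge0.
have re : r <= e' by rewrite /r -(lnK (e'0 : e' \is Num.pos)) ler_expR; lra.
apply: (@le_trans _ _ (e / 2 + e / 2)); last by lra.
pose bad (A : {set 'I_n}) (G : sgraph 'I_n) :=
  ((#|A| + #|odd_outside G A|)%:R <= 5 * (n%:R * p)) &&
  (h #|A| * (1 + #|odd_outside G A|) <= \sum_(z | z \notin A) deg_in G A z)%N.
pose Q (A : {set 'I_n}) := [&& P #|A|, 100 * #|A|%:R <= n%:R :> R & #|A|%:R * p <= 1 / 50].
apply: (@le_trans _ _ (
  gnp_prob p (fun G : sgraph 'I_n => [exists A : {set 'I_n}, Q A && bad A G]) +
  gnp_prob p (fun G : sgraph 'I_n => [exists A : {set 'I_n}, (1 / 50 <= #|A|%:R * p) &&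
      ((#|A| + #|odd_outside G A|)%:R <= 5 * (n%:R * p))]))).
  apply: gnp_probU => // G /existsP[A /and3P[PA Am Ah]].
  have [kp|kp] := leP (#|A|%:R * p) (1 / 50); apply/orP; [left|right]; apply/existsP; exists A.
    rewrite /Q /bad PA kp Am Ah !andbT /=.
    have : #|A|%:R <= (#|A| + #|odd_outside G A|)%:R :> R by rewrite ler_nat leq_addr.
    have : n%:R * p <= n%:R * (1 / 100 * (1 / 5)) by rewrite ler_wpM2l // ltW.
    lra.
  by rewrite (ltW kp) Am.
apply: lerD; last first.
  apply: le_trans (lin n p (fun k => 1 / 50 <= k%:R * p) _ p01 _ _) _.
  - move=> k kp; rewrite /odd_prob /g ler_wpM2r ?invr_ge0 // lerD2l lerN2.
    apply: le_trans (exp_le_expR _ _) _; first lra.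
    by rewrite ler_expR; lra.
  - have : n%:R * p <= n%:R * (c0 / 5) by rewrite ler_wpM2l // ltW.
    lra.
  rewrite -[leRHS]lnK; last by rewrite posrE; lra.
  have Ln : L <= n%:R by have := @ln_le_sub1 R _ nR; rewrite -/L; lra.
  rewrite ler_expR; move: Leg; rewrite ler_pdivrMr; last by lra.
  have : L * (g / 4) <= n%:R * (g / 4) by rewrite ler_wpM2r //; lra.
  lra.
apply: le_trans (gnp_prob_exists _ _ p01) _.
apply: (@le_trans _ _ (\sum_(A : {set 'I_n} | (0 < #|A|)%N) r ^+ #|A| / 'C(n, #|A|)%:R));
  last first.
  have r12 : 0 <= r <= 1 / 2 by rewrite r0 (le_trans re).
  by apply: le_trans (sum_sets_geometric _ r12) _; move: re e'1; clear; lra.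
rewrite big_mkcond [leRHS]big_mkcond /=; apply: ler_sum => A _.
have kn : (#|A| <= n)%N by rewrite -[X in (_ <= X)%N]card_ord max_card.
have C0 : 0 < 'C(n, #|A|)%:R :> R by rewrite ltr0n bin_gt0.
case: ifP => [/and3P[PA A100 Ap]|_]; last by case: ifP => // _; rewrite divr_ge0 ?exprn_ge0.
have [k2 h2 kh] := hP _ PA; have p2 : p <= 1 / 2 by move: p12; clear; lra.
rewrite (ltnW k2) ler_pdivlMr // mulrC.
have [ks|ks] := leP (#|A|%:R * s) (1 / 10 * (1 / 100)).
  have H := small_set_bound k2 A100 p0 p2 np h2 kh ks (erefl _); apply: le_trans H.
  rewrite ler_wpM2l ?(ltW C0) //; apply: gnp_prob_sub => // G; by case/andP.
have H := medium_set_bound k2 A100 p0 p2 np (ltW ks) s6 Ap (erefl _); apply: le_trans H.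
rewrite ler_wpM2l ?(ltW C0) //; apply: gnp_prob_sub => // G /andP[+ _].
by apply: le_trans; rewrite ler_nat leq_addl.
Qed.

End SparseUnion.

(** * Complements and overlapping neighbourhoods *)

Section Complement.
Variable V : finType.
Implicit Types (G : sgraph V) (A : {set V}).

Definition compl_edges G : {set {set V}} :=
  [set e : {set V} | (#|e| == 2%N) && (e \notin edges G)]%SET.

Lemma compl_edges_card2 G : [forall e in compl_edges G, #|e| == 2%N].
Proof. by apply/forall_inP => e; rewrite inE => /andP[]. Qed.

Definition compl_graph G := SGraph (compl_edges_card2 G).

Lemma compl_graphK : involutive compl_graph.
Proof.
move=> G; apply: val_inj; apply/setP => e; rewrite !inE.
case: (boolP (e \in edges G)) => eG; last by case: eqP.
by rewrite (edges_size2 eG).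
Qed.

Lemma adj_compl G x y : adj (compl_graph G) x y = (x != y) && ~~ adj G x y.
Proof. by rewrite /adj inE cards2; case: (x != y). Qed.

Lemma deg_in_compl G A z : z \notin A ->
  (deg_in (compl_graph G) A z + deg_in G A z = #|A|)%N.
Proof.
move=> zA; rewrite !deg_in_sum -big_split -sum1_card; apply: eq_bigr => y yA.
rewrite adj_compl (_ : z != y) /=; last by apply: contraNneq zA => ->.
by case: adj.
Qed.

(** deg_in A z changes to |A| - deg_in A z, which has the same parity. *)
Lemma odd_outside_compl G A : ~~ odd #|A| ->
  odd_outside (compl_graph G) A = odd_outside G A.
Proof.
move=> eA; apply/setP => z; rewrite !inE; case: (boolP (z \in A)) => //= zA.
by move: eA; rewrite -(deg_in_compl G zA) oddD; case: odd; case: odd.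
Qed.

End Complement.

Section Witnesses.
Local Open Scope nat_scope.
Variables (V : finType) (G : sgraph V).
Implicit Types (A : {set V}).

Lemma card_nbh x : #|nbh G x| = \sum_z adj G x z.
Proof. by rewrite -sum1_card big_mkcond /=; apply: eq_bigr => z _; rewrite inE; case: adj. Qed.

Lemma deg_in_lt A x : x \in A -> deg_in G A x < #|A|.
Proof.
move=> xA; apply: proper_card; apply/properP; split; first exact: subsetIr.
by exists x => //; rewrite !inE adjxx.
Qed.

Lemma sum_card_nbh A : \sum_(x in A) #|nbh G x| =
  \sum_(x in A) deg_in G A x + \sum_(z | z \notin A) deg_in G A z.
Proof.
under eq_bigr do rewrite card_nbh.
rewrite exchange_big /= (bigID (mem A)) /=.
by congr (_ + _); apply: eq_bigr => z _; rewrite deg_in_sum; apply: eq_bigr => y _;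
  rewrite adjC.
Qed.

(** Every x in A has degree at least |A| + |odd A|; add these inequalities over A
    and subtract the at most |A| (|A| - 1) incidences inside A. *)
Lemma mindeg_overlap A : #|A| + #|odd_outside G A| <= mindeg G ->
  #|A| * (1 + #|odd_outside G A|) <= \sum_(z | z \notin A) deg_in G A z.
Proof.
move=> Am.
have h1 : #|A| * (#|A| + #|odd_outside G A|) <= \sum_(x in A) #|nbh G x|.
  rewrite -sum_nat_const; apply: leq_sum => x _; exact: leq_trans Am (mindeg_le _ _).
have h2 : \sum_(x in A) deg_in G A x <= #|A| * #|A|.-1.
  rewrite -sum_nat_const; apply: leq_sum => x /deg_in_lt; lia.
rewrite sum_card_nbh in h1; case: #|A| h1 h2 => [|k] /=; first by rewrite mul0n.
move=> h1 h2; move: h1; rewrite !mulnDr; lia.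
Qed.

(** For x, y in A the part of the symmetric difference outside A has at most
    a x + a y elements, where a counts neighbours outside A, and the part inside A at
    most |A| - 2.  So a x + a y >= 1 + |odd A| for all pairs, and averaging over the
    ordered pairs gives half of |A| (1 + |odd A|). *)
Lemma symdiff_overlap A : ~~ odd #|A| -> 0 < #|A| ->
  (forall x y, x \in A -> y \in A -> x != y ->
     #|A| + #|odd_outside G A| <= 1 + #|odd_outside G [set x; y]%SET|) ->
  #|A|./2 * (1 + #|odd_outside G A|) <= \sum_(z | z \notin A) deg_in G A z.
Proof.
move=> eA A0 H; set t := 1 + #|odd_outside G A|.
pose a x := \sum_(z | z \notin A) adj G z x.
have axy x y : x \in A -> y \in A -> x != y -> t <= a x + a y.
  move=> xA yA xy; have := H x y xA yA xy.
  have sub : #|odd_outside G [set x; y]%SET| <= #|A :\: [set x; y]%SET| + (a x + a y).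
    rewrite -!sum1_card /a -big_split /= big_mkcond [X in _ <= X + _]big_mkcond.
    rewrite [X in _ <= _ + X]big_mkcond -big_split /=.
    apply: leq_sum => z _; rewrite !inE deg_inU ?deg_in1; last by rewrite disjoints1 inE.
    by case: (z == x); case: (z == y); case: (z \in A); case: adj; case: adj.
  have : #|A :\: [set x; y]%SET| = #|A| - 2.
    rewrite cardsD (_ : A :&: _ = [set x; y]%SET) ?cards2 ?xy //.
    apply/setP => z; rewrite !inE.
    by case: eqP => [->|]; [rewrite xA|case: eqP => [->|]; [rewrite yA|rewrite andbF]].
  have : 2 <= #|A|.
    have <- : #|[set x; y]%SET| = 2 by rewrite cards2 xy.
    by apply: subset_leq_card; apply/fintype.subsetP => z; rewrite !inE => /orP[] /eqP->.
  rewrite /t; lia.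
have Sa : \sum_(x in A) a x = \sum_(z | z \notin A) deg_in G A z.
  by rewrite /a exchange_big /=; apply: eq_bigr => z _; rewrite deg_in_sum.
rewrite -Sa.
(* The diagonal is included to let the double sum factor. *)
have dbl : \sum_(x in A) \sum_(y in A) (if x == y then 2 * a x else t) <=
   \sum_(x in A) \sum_(y in A) (a x + a y).
  apply: leq_sum => x xA; apply: leq_sum => y yA.
  by case: eqP => [->|/eqP xy]; [lia|exact: axy].
have R1 : \sum_(x in A) \sum_(y in A) (a x + a y) = 2 * #|A| * \sum_(x in A) a x.
  under eq_bigr do rewrite big_split /= sum_nat_const.
  rewrite big_split /= sum_nat_const -big_distrr /=; lia.
have R2 : \sum_(x in A) \sum_(y in A) (if x == y then 2 * a x else t) =
   2 * \sum_(x in A) a x + #|A| * (#|A|.-1 * t).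
  rewrite big_distrr /= -sum_nat_const -big_split /=; apply: eq_bigr => x xA.
  rewrite (bigD1 x) //= eqxx; congr (_ + _).
  rewrite (eq_bigr (fun=> t)); last by move=> y /andP[_ /negPf]; rewrite eq_sym => ->.
  rewrite sum_nat_const; congr (_ * _); have := cardsD1 x A; rewrite xA => ->.
  by rewrite /=; apply: eq_card => y; rewrite !inE andbC.
rewrite R1 R2 in dbl.
have [j Ej] : exists j, #|A| = j.*2.
  by exists #|A|./2; rewrite -[LHS]odd_double_half (negbTE eA).
move: dbl A0; set S := \sum_(x in A) a x; rewrite Ej doubleK => dbl j0.
have : j.*2.-1 * (j.*2 * t) <= j.*2.-1 * (2 * S) by move: dbl j0; case: j.*2 => //= i; lia.
rewrite leq_pmul2l; last by lia.
by rewrite -mul2n -mulnA leq_pmul2l.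
Qed.

End Witnesses.

(** * Isolated vertices *)

Section SparseTheorems.
Variable R : realType.
Implicit Types (n k : nat) (p : R).

Lemma gnp_weight_compl n p (G : sgraph 'I_n) :
  gnp_weight p (compl_graph G) = gnp_weight (1 - p) G.
Proof.
apply: eq_bigr => e e2; rewrite inE e2 /=.
by case: (e \in edges G) => //=; rewrite subKr.
Qed.

Lemma gnp_prob_compl n p (Q : pred (sgraph 'I_n)) :
  gnp_prob p Q = gnp_prob (1 - p) (fun G => Q (compl_graph G)).
Proof.
rewrite /gnp_prob (reindex_inj (inv_inj (@compl_graphK 'I_n))) /=.
by apply: eq_bigr => G _; rewrite gnp_weight_compl.
Qed.

Definition isolated (V : finType) (G : sgraph V) x := nbh G x == finset.set0.

(** The predicate P may drop a vertex whose edge to x is already known to be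
    absent; this makes the edge families of two vertices disjoint. *)
Lemma isolatedE n (G : sgraph 'I_n) x (P : pred 'I_n) : ~~ P x ->
  (forall z, z != x -> ~~ P z -> ~~ adj G x z) ->
  (isolated G x)%:R = \prod_(z | P z) (if [set x; z]%SET \in edges G then 0 else 1) :> R.
Proof.
move=> Px H; case: (boolP (isolated G x)) => [/eqP iso|].
  rewrite big1 // => z _; have : z \notin nbh G x by rewrite iso inE.
  by rewrite inE /adj => /negPf ->.
case/set0Pn => z; rewrite inE => xz.
have zx : z != x by apply: contraTneq xz => ->; rewrite adjxx.
have Pz : P z by apply: contraTT xz => Pz; exact: H.
by rewrite (bigD1 z) //= (_ : _ \in _ = true) ?mul0r.
Qed.

Lemma set2_inj (V : finType) (x : V) : injective (fun z => [set x; z]%SET).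
Proof.
move=> z z' /= E; have := set22 x z; rewrite E !inE => /orP[/eqP zx|/eqP //].
by have := set22 x z'; rewrite -E !inE zx orbb => /eqP ->.
Qed.

Lemma gnp_mean_isolated n p (x : 'I_n) :
  gnp_mean p (fun G => (isolated G x)%:R) = (1 - p) ^+ n.-1.
Proof.
transitivity (gnp_mean p (fun G => \prod_(z | z != x)
    (if [set x; z]%SET \in edges G then 0 else 1 : R))).
  apply: eq_gnp_mean => G; by apply: isolatedE; rewrite ?eqxx // => z ->.
rewrite (gnp_mean_indep p (fun=> 0) (fun=> 1)); last 2 first.
- by move=> z z' _ _; exact: set2_inj.
- by move=> z; rewrite unfold_in => zx; rewrite cards2 (eq_sym x) zx.
rewrite (eq_bigr (fun=> 1 - p)) => [|z _]; last by ring.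
rewrite prodr_const; congr (_ ^+ _).
by have := cardC1 x; rewrite card_ord => <-; apply: eq_card => z; rewrite !inE.
Qed.

Lemma gnp_mean_isolated2 n p (x y : 'I_n) : x != y ->
  gnp_mean p (fun G => (isolated G x)%:R * (isolated G y)%:R) =
  (1 - p) ^+ n.-1 * (1 - p) ^+ n.-2.
Proof.
move=> xy.
pose P (i : bool * 'I_n) := if i.1 then i.2 != x else (i.2 != x) && (i.2 != y).
pose ed (i : bool * 'I_n) := [set (if i.1 then x else y); i.2]%SET.
have prodP (F : bool -> 'I_n -> R) : \prod_(i | P i) F i.1 i.2 =
    (\prod_(z | z != x) F true z) * \prod_(z | (z != x) && (z != y)) F false z.
  rewrite -(pair_big_dep xpredT (fun b z => P (b, z)) (fun b z => F b z)) /=.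
  by rewrite big_bool.
transitivity (gnp_mean p (fun G => \prod_(i | P i) (if ed i \in edges G then 0 else 1))).
  apply: eq_gnp_mean => G; rewrite /ed.
  rewrite (prodP (fun b z => if [set if b then x else y; z]%SET \in edges G then 0 else 1)) /=.
  rewrite -(@isolatedE n G x (fun z => z != x)) ?eqxx //; last by move=> z ->.
  case: (boolP (isolated G x)) => [/eqP iso|]; last by rewrite !mul0r.
  rewrite !mul1r -isolatedE ?eqxx ?andbF // => z zy; rewrite negb_and zy orbF negbK.
  move=> /eqP ->; rewrite adjC.
  have : y \notin nbh G x by rewrite iso inE.
  by rewrite inE.
rewrite (gnp_mean_indep p (fun=> 0) (fun=> 1)); last 2 first.
- move=> [b z] [b' z']; rewrite !unfold_in /P /ed /=; case: b; case: b' => /= Pz Pz' E.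
  + by rewrite (set2_inj E).
  + have := set21 x z; rewrite E !inE (negPf xy) /= => /eqP xz'.
    by rewrite -xz' eqxx in Pz'.
  + have := set21 x z'; rewrite -E !inE (negPf xy) /= => /eqP xz.
    by rewrite -xz eqxx in Pz.
  + by rewrite (set2_inj E).
- move=> [b z]; rewrite unfold_in /P /ed cards2 /=; case: b => /=; first by rewrite (eq_sym x) => ->.
  by case/andP => _; rewrite (eq_sym y) => ->.
rewrite (eq_bigr (fun=> 1 - p)) => [|z _]; last by ring.
rewrite (prodP (fun _ _ => 1 - p)) !prodr_const.
have c1 : #|[pred z | z != x]| = n.-1.
  by have := cardC1 x; rewrite card_ord => <-; apply: eq_card => z; rewrite !inE.
have c2 : #|[pred z | (z != x) && (z != y)]| = n.-2.
  have := cardC (mem [set x; y]%SET); rewrite card_ord cards2 xy.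
  have -> : #|[predC mem [set x; y]%SET]| = #|[pred z | (z != x) && (z != y)]|.
    by apply: eq_card => z; rewrite !inE negb_or.
  by move/(congr1 (fun m => m.-2)).
by rewrite c1 c2.
Qed.

(** Chebyshev's inequality for the number of isolated vertices, whose mean is
    n (1 - p) ^ (n - 1) and whose pair correlations are only a factor 1 / (1 - p). *)
Lemma two_isolated n p : 0 < p <= 1 / 2 -> 2 <= n%:R * (1 - p) ^+ n.-1 ->
  gnp_prob p (fun G : sgraph 'I_n =>
    ~~ [exists x, exists y, [&& x != y, isolated G x & isolated G y]]) <=
  8 * p + 4 / (n%:R * (1 - p) ^+ n.-1).
Proof.
move=> /andP[p0 p1]; set mu := n%:R * (1 - p) ^+ n.-1 => mu2.
have p01 : 0 <= p <= 1 by lra.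
have mu0 : 0 < mu by lra.
pose X (G : sgraph 'I_n) : R := \sum_x (isolated G x)%:R.
apply: (@le_trans _ _ (gnp_mean p (fun G => 4 / mu ^+ 2 * (X G - mu) ^+ 2))).
  apply: gnp_prob_markov => // [G|G nG]; first by rewrite mulr_ge0 ?sqr_ge0 ?divr_ge0 ?sqr_ge0.
  have X1 : X G <= 1.
    case: (pickP (isolated G)) => [x ix|no].
      rewrite /X (bigD1 x) //= ix big1 ?addr0 // => y yx.
      case iy: (isolated G y) => //; case/negP: nG.
      by apply/existsP; exists x; apply/existsP; exists y; rewrite eq_sym yx ix iy.
    by rewrite /X big1 // => y _; rewrite no.
  rewrite mulrAC ler_pdivlMr ?exprn_gt0 // mul1r.
  have h : mu ^+ 2 <= (2 * (mu - X G)) ^+ 2 by rewrite lerXn2r ?nnegrE; lra.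
  lra.
rewrite gnp_meanZ.
have EX : gnp_mean p X = mu.
  rewrite /X gnp_mean_sum (eq_bigr (fun=> (1 - p) ^+ n.-1)) => [|x _]; last first.
    exact: gnp_mean_isolated.
  by rewrite sumr_const card_ord /mu mulr_natl.
have EX2 : gnp_mean p (fun G => X G ^+ 2) <= mu + mu ^+ 2 / (1 - p).
  have -> : gnp_mean p (fun G => X G ^+ 2) =
      \sum_(x < n) \sum_(y < n) gnp_mean p (fun G => (isolated G x)%:R * (isolated G y)%:R).
    under [RHS]eq_bigr => x _ do rewrite -gnp_mean_sum.
    rewrite -gnp_mean_sum; apply: eq_gnp_mean => G.
    by rewrite expr2 /X mulr_suml; apply: eq_bigr => x _; rewrite mulr_sumr.
  have le2 (x y : 'I_n) : gnp_mean p (fun G => (isolated G x)%:R * (isolated G y)%:R) <=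
      (if x == y then (1 - p) ^+ n.-1 else 0) + ((1 - p) ^+ n.-1) ^+ 2 / (1 - p).
    have q0 : 0 <= ((1 - p) ^+ n.-1) ^+ 2 / (1 - p).
      by rewrite divr_ge0 ?exprn_ge0 //; lra.
    case: eqP => [->|/eqP xy].
      have -> : gnp_mean p (fun G => (isolated G y)%:R * (isolated G y)%:R) = (1 - p) ^+ n.-1.
        rewrite -(gnp_mean_isolated p y); apply: eq_gnp_mean => G.
        by case: isolated; rewrite ?mulr1 ?mulr0.
      by rewrite lerDl.
    rewrite gnp_mean_isolated2 // add0r expr2 -mulrA ler_wpM2l ?exprn_ge0 //; first lra.
    rewrite ler_pdivlMr; last lra.
    rewrite -exprSr; case: (n) => [|[|m]] //=; rewrite expr1; lra.
  apply: le_trans (ler_sum _ (fun x _ => ler_sum _ (fun y _ => le2 x y))) _.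
  rewrite (eq_bigr (fun=> (1 - p) ^+ n.-1 + n%:R * (((1 - p) ^+ n.-1) ^+ 2 / (1 - p)))).
    rewrite sumr_const card_ord -[leLHS]mulr_natl mulrDr /mu lerD2l.
    by rewrite exprMn [n%:R ^+ 2]expr2 -!mulrA.
  move=> x _; rewrite big_split /= -big_mkcond /= (big_pred1 x); last first.
    by move=> y; rewrite eq_sym.
  by rewrite sumr_const card_ord mulr_natl.
have -> : gnp_mean p (fun G => (X G - mu) ^+ 2) =
    gnp_mean p (fun G => X G ^+ 2) - mu ^+ 2.
  transitivity (gnp_mean p (fun G => X G ^+ 2 + (- (2 * mu)) * X G + mu ^+ 2 * 1)).
    by apply: eq_gnp_mean => G; ring.
  by rewrite !gnp_meanD !gnp_meanZ EX gnp_mean1; ring.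
apply: (@le_trans _ _ (4 / mu ^+ 2 * (mu + mu ^+ 2 / (1 - p) - mu ^+ 2))).
  by rewrite ler_wpM2l ?divr_ge0 ?sqr_ge0 // lerD2r.
have -> : 4 / mu ^+ 2 * (mu + mu ^+ 2 / (1 - p) - mu ^+ 2) = 4 / mu + 4 * (p / (1 - p)).
  by field; lra.
have : p / (1 - p) <= 2 * p by rewrite ler_pdivrMr; [nra|lra].
lra.
Qed.

End SparseTheorems.

(** * Sparse graphs and their complements *)

Section SparseFinal.
Variable R : realType.
Implicit Types (n k : nat) (p : R).

(** Below 0.9 ln n / n the mean number of isolated vertices is at least n ^ (1/20). *)
Lemma isolated_below_threshold (e : R) : 0 < e -> exists2 p1 : R, 0 < p1 & exists M : R,
  forall n p, 0 < p <= p1 -> M <= ln n%:R -> n%:R * p < 9 / 10 * ln n%:R ->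
  gnp_prob p (fun G : sgraph 'I_n =>
    ~~ [exists x, exists y, [&& x != y, isolated G x & isolated G y]]) <= e.
Proof.
move=> e0; exists (Num.min (1 / 20) (e / 16)); first by rewrite lt_min; lra.
exists (Num.max 1 (Num.max (20 * ln 2) (20 * (- ln (e / 8))))).
move=> n p /andP[p0]; rewrite le_min => /andP[p20 pe].
rewrite !ge_max => /and3P[L1 L2 Le] np.
set L := ln n%:R in L1 L2 Le np *.
have n0 : (0 < n)%N.
  rewrite lt0n; apply/eqP => nz; move: L1; rewrite /L nz ln0 //; lra.
have nR : 0 < n%:R :> R by rewrite ltr0n.
have mu : expR (L / 20) <= n%:R * (1 - p) ^+ n.-1.
  have -> : L / 20 = L + (- (95 / 100 * L)) by lra.
  rewrite expRD lnK // ler_wpM2l //.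
  apply: (@le_trans _ _ ((1 - p) ^+ n)).
    have h : expR (- (p / (1 - p))) <= 1 - p.
      rewrite expRN -[leRHS]invrK lef_pV2 ?posrE ?expR_gt0 ?invr_gt0 //; last lra.
      apply: le_trans (expR_ge1Dx _).
      by rewrite (_ : 1 + p / (1 - p) = (1 - p)^-1) //; field; lra.
    apply: (@le_trans _ _ (expR (- (p / (1 - p))) ^+ n)); last first.
      by rewrite lerXn2r ?nnegrE ?expR_ge0 //; lra.
    rewrite -expRM_natl ler_expR mulrN lerN2 mulrA ler_pdivrMr; last lra.
    have : 95 / 100 * L * (95 / 100) <= 95 / 100 * L * (1 - p) by rewrite ler_wpM2l //; lra.
    lra.
  rewrite -[in leLHS](prednK n0) exprS ler_piMl ?exprn_ge0 //; lra.
have mu2 : 2 <= expR (L / 20).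
  by rewrite -[leLHS]lnK ?posrE // ler_expR; lra.
apply: le_trans (two_isolated _ (le_trans mu2 mu)) _; first lra.
have : 4 / (n%:R * (1 - p) ^+ n.-1) <= e / 2.
  apply: (@le_trans _ _ (4 / expR (L / 20))).
    by rewrite ler_wpM2l // lef_pV2 ?posrE ?expR_gt0 ?(lt_le_trans (expR_gt0 _) mu).
  rewrite -expRN; have : expR (- (L / 20)) <= e / 8.
    by rewrite -[leRHS]lnK ?ler_expR ?posrE; lra.
  lra.
lra.
Qed.

Lemma expR_half_le2 : expR (1 / 2) <= 2 :> R.
Proof.
have h : 0 <= (1 / 2 : R) <= 1 / 2 by lra.
by apply: le_trans (expR_le_half h) _; lra.
Qed.

(** Either there is an isolated vertex, and then mindeg is 0 and nothing can beat it, or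
    n p >= 0.9 ln n and a bad set A contradicts sparse_bad with h = |A|. *)
Lemma sparse_mindeg (e : R) : 0 < e -> exists2 p1 : R, 0 < p1 & exists M : R,
  forall n p, 0 < p <= p1 -> M <= ln n%:R ->
  gnp_prob p (fun G : sgraph 'I_n => diagdist G != mindeg G + 1)%N <= e.
Proof.
move=> e0; have e2 : 0 < e / 2 by lra.
have [p1 p10 [M1 H1]] := isolated_below_threshold e0.
have [p2 p20 [M2 H2]] := sparse_bad e2.
exists (Num.min (1 / 2) (Num.min p1 p2)); first by rewrite !lt_min p10 p20 andbT; lra.
exists (Num.max 1 (Num.max (- ln (e / 2)) (Num.max M1 M2))).
move=> n p /andP[p0]; rewrite !le_min => /and3P[p12 pp1 pp2].
rewrite !ge_max => /and4P[L1 Le LM1 LM2].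
have p01 : 0 <= p <= 1 by lra.
have n0 : (0 < n)%N.
  rewrite lt0n; apply/eqP => nz; move: L1; rewrite nz ln0 //; lra.
have bad G : (diagdist G != mindeg G + 1)%N -> exists A : {set 'I_n},
    (2 <= #|A|)%N && (#|A| + #|odd_outside G A| <= mindeg G)%N.
  move=> nd; apply/existsP; apply: contraNT nd => /existsPn no.
  apply/eqP/diagdist_mindegP; first by rewrite card_ord.
  by move=> A A2; have := no A; rewrite A2.
have [np|np] := ltP (n%:R * p) (9 / 10 * ln n%:R).
  apply: le_trans (H1 n p _ LM1 np); last by rewrite p0.
  apply: gnp_prob_sub => // G /bad[A /andP[A2 Am]].
  apply/negP => /existsP[x /existsP[y /and3P[_ /eqP ix _]]].
  by have := mindeg_le G x; rewrite ix cards0; move: A2 Am; clear; lia.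
pose v := Ordinal n0.
apply: (@le_trans _ _ (
  gnp_prob p (fun G : sgraph 'I_n => 5 * (n%:R * p) <= #|odd_outside G [set v]%SET|%:R) +
  gnp_prob p (fun G : sgraph 'I_n => [exists A : {set 'I_n},
    [&& (2 <= #|A|)%N, (#|A| + #|odd_outside G A|)%:R <= 5 * (n%:R * p) &
       (#|A| * (1 + #|odd_outside G A|) <= \sum_(z | z \notin A) deg_in G A z)%N]]))).
  apply: gnp_probU => // G /bad[A /andP[A2 Am]].
  have [//|dv] := leP (5 * (n%:R * p)) #|odd_outside G [set v]%SET|%:R.
  apply/orP; right; apply/existsP; exists A; rewrite A2 mindeg_overlap // andbT /=.
  apply: le_trans (ltW dv); rewrite ler_nat odd_outside1.
  exact: leq_trans Am (mindeg_le _ _).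
have -> : e = e / 2 + e / 2 by lra.
apply: lerD; last first.
  apply: (H2 n p (leq 2) id) => //; first by rewrite p0.
  by move=> k k2; split=> //; rewrite mul2n -addnn leq_addr.
apply: le_trans (odd_outside_upper_tail _ _ p01 (_ : 0 <= 1 / 2)) _; first lra.
rewrite cards1 /odd_prob expr1.
rewrite -[leRHS]lnK ?posrE // ler_expR.
have h := expR_half_le2; have : 0 <= n%:R * p by rewrite mulr_ge0 // ltW.
have -> : (1 - (1 - 2 * p)) / 2 = p by field.
move: np Le L1; set d := n%:R * p => np Le L1 d0.
have -> : n%:R * ((expR (1 / 2) - 1) * p) = (expR (1 / 2) - 1) * d by rewrite /d; ring.
have : (expR (1 / 2) - 1) * d <= 1 * d by rewrite ler_wpM2r //; lra.
lra.
Qed.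

(** In the complement H, a sparse graph: two isolated vertices of H make the
    minimum symmetric difference 0, and a bad A would then be an isolated vertex of the
    dense graph.  Otherwise n p >= 0.9 ln n.  Bad sets of odd size are excluded in the
    dense graph itself, where the parity probability is at least 1/2; those of even size
    have the same odd set in H and contradict sparse_bad with h = |A| / 2. *)
Lemma sparse_min_symdiff (e : R) : 0 < e -> exists2 p1 : R, 0 < p1 & exists M : R,
  forall n p, 0 < p <= p1 -> M <= ln n%:R ->
  gnp_prob (1 - p) (fun G : sgraph 'I_n => diagdist G != 2 + min_symdiff G)%N <= e.
Proof.
move=> e0; have e3 : 0 < e / 3 by lra.
have [p1 p10 [M1 H1]] := isolated_below_threshold e0.
have [p2 p20 [M2 H2]] := sparse_bad e3.
have half01 : 0 < (1 / 2 : R) <= 1 by lra.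
have [c0 c00 H3] := linear_regime half01.
exists (Num.min (1 / 2) (Num.min (c0 / 5) (Num.min p1 p2))).
  by rewrite !lt_min p10 p20 andbT divr_gt0 //; lra.
exists (Num.max 12 (Num.max (- (8 * ln (e / 3))) (Num.max M1 M2))).
move=> n p /andP[p0]; rewrite !le_min => /and4P[p12 pc pp1 pp2].
rewrite !ge_max => /and4P[L1 Le LM1 LM2].
have p01 : 0 <= p <= 1 by lra.
have q01 : 0 <= 1 - p <= 1 by lra.
have n0 : (0 < n)%N.
  rewrite lt0n; apply/eqP => nz; move: L1; rewrite nz ln0 //; lra.
have nR : 0 < n%:R :> R by rewrite ltr0n.
have Ln := ln_le_sub1 nR.
have n2 : (1 < n)%N by rewrite -(ltr_nat R); lra.
rewrite gnp_prob_compl subKr.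
have bad (G : sgraph 'I_n) : (diagdist G != 2 + min_symdiff G)%N ->
  exists A : {set 'I_n}, [&& (0 < #|A|)%N, #|A| != 2%N &
    (#|A| + #|odd_outside G A| <= 1 + min_symdiff G)%N].
  move=> nd; apply/existsP; apply: contraNT nd => /existsPn no.
  apply/eqP/diagdist_min_symdiffP; first by rewrite card_ord.
  by move=> A A0 A2; have := no A; rewrite A0 A2.
have msd (G : sgraph 'I_n) x y : x != y ->
    (min_symdiff (compl_graph G) <= #|odd_outside G [set x; y]%SET|)%N.
  move=> xy; rewrite -(@odd_outside_compl _ G) ?min_symdiff_le //.
  by rewrite cards2 xy.
have [np|np] := ltP (n%:R * p) (9 / 10 * ln n%:R).
  apply: le_trans (H1 n p _ LM1 np); last by rewrite p0.
  apply: gnp_prob_sub => // G /bad[A /and3P[A0 A2 Am]].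
  apply/negP => /existsP[x /existsP[y /and3P[xy ix iy]]].
  have isoP a z : isolated G a -> adj G a z = false.
    by move=> /eqP ia; have : z \notin nbh G a; [rewrite ia inE|rewrite inE => /negPf].
  have m0 : #|odd_outside G [set x; y]%SET| = 0%N.
    apply/eqP; rewrite cards_eq0; apply/eqP/setP => z; rewrite !inE deg_inU ?deg_in1.
      by rewrite ![adj G z _]adjC !isoP //= andbF.
    by rewrite disjoints1 inE.
  have := msd G x y xy; rewrite m0 leqn0 => /eqP ms0; rewrite ms0 addn0 in Am.
  have A1 : #|A| == 1%N by move: A0 Am; clear; lia.
  have [u Au] := cards1P A1; move: Am; rewrite Au cards1 odd_outside1 => Am.
  have nb0 : nbh (compl_graph G) u = finset.set0.
    by apply/eqP; rewrite -cards_eq0; move: Am; clear; lia.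
  have : exists2 a, isolated G a & a != u.
    by have [xu|xu] := eqVneq x u; [exists y; rewrite // -xu eq_sym|exists x].
  move=> [a ia au]; have : a \notin nbh (compl_graph G) u by rewrite nb0 inE.
  by rewrite inE adj_compl eq_sym au adjC isoP.
pose v0 : 'I_n := Ordinal n0; pose v1 : 'I_n := Ordinal n2.
have v01 : v0 != v1 by [].
have d10 : 10 <= n%:R * p by lra.
apply: (@le_trans _ _ (
  gnp_prob p (fun G : sgraph 'I_n =>
     5 * (n%:R * p) - 1 <= #|odd_outside G [set v0; v1]%SET|%:R) +
  gnp_prob p (fun G : sgraph 'I_n => [exists A : {set 'I_n}, odd #|A| &&
    ((#|A| + #|odd_outside (compl_graph G) A|)%:R <= 5 * (n%:R * p))] ||
   [exists A : {set 'I_n},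
    [&& (3 < #|A|)%N && ~~ odd #|A|, (#|A| + #|odd_outside G A|)%:R <= 5 * (n%:R * p) &
       (#|A|./2 * (1 + #|odd_outside G A|) <= \sum_(z | z \notin A) deg_in G A z)%N]]))).
  apply: gnp_probU => // G /bad[A /and3P[A0 A2 Am]].
  have [//|dv] := leP (5 * (n%:R * p) - 1) #|odd_outside G [set v0; v1]%SET|%:R.
  have mle : (#|A| + #|odd_outside (compl_graph G) A|)%:R <= 5 * (n%:R * p).
    have : (1 + min_symdiff (compl_graph G))%:R <= 1 + #|odd_outside G [set v0; v1]%SET|%:R :> R.
      by rewrite natrD lerD2l ler_nat msd.
    have : (#|A| + #|odd_outside (compl_graph G) A|)%:R <=
       (1 + min_symdiff (compl_graph G))%:R :> R by rewrite ler_nat.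
    lra.
  have [oA|eA] := boolP (odd #|A|); apply/orP; right; apply/orP; [left|right];
    apply/existsP; exists A; first by rewrite oA mle.
  rewrite odd_outside_compl // in Am mle.
  have A3 : (3 < #|A|)%N by move: A0 A2 eA; case: #|A| => [|[|[|[|]]]].
  rewrite A3 eA mle symdiff_overlap // => x y xA yA xy.
  by apply: leq_trans Am _; rewrite leq_add2l msd.
have -> : e = e / 3 + (e / 3 + e / 3) by lra.
apply: lerD.
  apply: le_trans (odd_outside_upper_tail _ _ p01 (_ : 0 <= 1 / 2)) _; first lra.
  rewrite cards2 v01 /odd_prob -[leRHS]lnK ?posrE // ler_expR.
  have h := expR_half_le2; move: np d10; set d := n%:R * p => np d10.
  have -> : n%:R * ((expR (1 / 2) - 1) * ((1 - (1 - 2 * p) ^+ 2) / 2)) =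
     (expR (1 / 2) - 1) * (2 * d * (1 - p)) by rewrite /d; field.
  have : (expR (1 / 2) - 1) * (2 * d * (1 - p)) <= 1 * (2 * d * 1).
    have e1 : 1 <= expR (1 / 2) :> R by rewrite -[leLHS]expR0 ler_expR.
    have d0 : 0 <= 2 * d by move: d10; clear; lra.
    apply: ler_pM; rewrite ?mulr_ge0 ?ler_wpM2l //; move: e1 h p01; clear; lra.
  by move: d10 np L1 Le; clear; lra.
apply: le_trans (gnp_probU p01 (fun G (h : _ || _) => h)) _.
apply: lerD.
  have -> : gnp_prob p (fun G : sgraph 'I_n => [exists A : {set 'I_n}, odd #|A| &&
    ((#|A| + #|odd_outside (compl_graph G) A|)%:R <= 5 * (n%:R * p))]) =
    gnp_prob (1 - p) (fun G : sgraph 'I_n => [exists A : {set 'I_n}, odd #|A| &&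
    ((#|A| + #|odd_outside G A|)%:R <= 5 * (n%:R * p))]).
    by rewrite [RHS]gnp_prob_compl subKr.
  apply: le_trans (H3 n (1 - p) odd _ q01 _ _) _.
  - move=> k ok; rewrite /odd_prob.
    have -> : 1 - 2 * (1 - p) = - (1 - 2 * p) by ring.
    rewrite exprNn -signr_odd ok expr1.
    have : 0 <= (1 - 2 * p) ^+ k by rewrite exprn_ge0 //; lra.
    lra.
  - have : n%:R * p <= n%:R * (c0 / 5) by rewrite ler_wpM2l // ltW.
    lra.
  rewrite -[leRHS]lnK ?posrE // ler_expR; lra.
apply: (H2 n p (fun k => (3 < k)%N && ~~ odd k) half) => //; first by rewrite p0.
by move=> k /andP[k3 ek]; have := odd_double_half k; rewrite (negbTE ek); move: k3; clear; split; lia.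
Qed.

End SparseFinal.

(** * Constant density *)

Section DenseTheorems.
Variable R : realType.
Local Open Scope classical_set_scope.
Local Open Scope ring_scope.
Implicit Types (n k : nat) (p : R).

(** sqrt n = expR (L / 2) >= (L / 2) ^ 3 / 6. *)
Lemma near_sqrt_ge_sqr (M : R) : \forall n \near \oo, M * ln n%:R ^+ 2 <= Num.sqrt n%:R.
Proof.
near=> n.
have n0 : 0 < n%:R :> R by rewrite ltr0n; near: n; exact: nbhs_infty_gt.
have L1 : 0 <= ln n%:R :> R by near: n; exact: near_ln_ge.
have L2 : 48 * M <= ln n%:R :> R by near: n; exact: near_ln_ge.
have -> : Num.sqrt n%:R = expR (ln n%:R / 2) :> R.
  apply/eqP; rewrite -(@eqrXn2 _ 2) ?sqrtr_ge0 ?expR_ge0 //.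
  by rewrite sqr_sqrtr ?ltW // -expRM_natl mulrC divfK // lnK.
set L := ln n%:R in L1 L2 *.
have := @expR_ge1Dxn R (L / 2) 2; rewrite (_ : 3`!%:R = 6 :> R) // => h.
have {}h := h (divr_ge0 L1 (ler0n _ 2)).
have : 48 * M * L ^+ 2 <= L * L ^+ 2 by rewrite ler_wpM2r ?sqr_ge0.
rewrite expr_div_n in h; rewrite -exprS; lra.
Unshelve. all: by end_near. Qed.

Lemma near_sqrt_ge (M : R) : \forall n \near \oo, M * ln n%:R <= Num.sqrt n%:R.
Proof.
near=> n; have L1 : 1 <= ln n%:R :> R by near: n; exact: near_ln_ge.
apply: (@le_trans _ _ (`|M| * ln n%:R ^+ 2)); last by near: n; exact: near_sqrt_ge_sqr.
have L0 : 0 <= ln n%:R :> R by apply: le_trans L1.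
apply: (@le_trans _ _ (`|M| * ln n%:R)); first by rewrite ler_wpM2r ?ler_norm.
by rewrite ler_wpM2l // expr2 ler_peMl.
Unshelve. all: by end_near. Qed.

Lemma odd_outside_linear_tail p k (b : R) : 0 < p < 1 -> odd_prob p k < b ->
  forall e : R, 0 < e -> \forall n \near \oo, forall A : {set 'I_n}, #|A| = k ->
    gnp_prob p (fun G => b * n%:R <= #|odd_outside G A|%:R) <= e.
Proof.
move=> /andP[p0 p1] kb e e0.
have p01 : 0 <= p <= 1 by lra.
have okp := odd_prob_itv k p01.
set q := odd_prob p k in kb okp.
pose s := Num.min (1 / 2) ((b - q) / 4).
have s0 : 0 < s by rewrite lt_min; lra.
have s2 : s <= 1 / 2 by rewrite ge_min lexx.
have sb : s <= (b - q) / 4 by rewrite ge_min lexx orbT.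
pose c := s * (b - q) / 2; have c0 : 0 < c by rewrite /c divr_gt0 ?mulr_gt0 //; lra.
near=> n.
have n0 : 0 < n%:R :> R by rewrite ltr0n; near: n; exact: nbhs_infty_gt.
have Le : - ln e / c <= ln n%:R by near: n; exact: near_ln_ge.
move=> A Ak; apply: le_trans (odd_outside_upper_tail _ _ p01 (ltW s0)) _.
rewrite Ak -/q -[leRHS]lnK ?posrE // ler_expR.
have s01 : 0 <= s <= 1 / 2 by lra.
have es := expR_le_half s01.
have h1 : (expR s - 1) * q <= s * (1 + 2 * s) * q.
  by rewrite ler_wpM2r; lra.
have h2 : s * (1 + 2 * s) * q <= s * (q + (b - q) / 2).
  by rewrite -mulrA ler_wpM2l //; nra.
have h3 : n%:R * ((expR s - 1) * q) <= n%:R * (s * (q + (b - q) / 2)).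
  by rewrite ler_wpM2l //; lra.
have Ln := ln_le_sub1 n0.
move: Le; rewrite ler_pdivrMr // => Le.
have h4 : c * ln n%:R <= c * n%:R by rewrite ler_wpM2l //; lra.
rewrite /c in Le h4 *; lra.
Unshelve. all: by end_near. Qed.

(** odd_prob p k increases with k for p < 1/2, so that all sets of at least two
    vertices have parity probability at least min (2 p (1 - p)) lambda0 > p, while one
    vertex already has degree about p n. *)
Lemma dense_mindeg p : 0 < p < lambda0 -> forall e : R, 0 < e -> \forall n \near \oo,
  gnp_prob p (fun G : sgraph 'I_n => diagdist G != mindeg G + 1)%N <= e.
Proof.
have [/andP[l0 l1] _] := @lambda0P R.
move=> /andP[p0 pl] e e0; have e2 : 0 < e / 2 by lra.
have p01 : 0 <= p <= 1 by lra.
have p01' : 0 < p < 1 by lra.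
pose g := Num.min (odd_prob p 2) lambda0.
have o2 : odd_prob p 2 = 2 * p * (1 - p) by rewrite /odd_prob; field.
have pg : p < g by rewrite lt_min o2 pl andbT; nra.
have g0l : 0 <= g <= lambda0 by rewrite ge_min lexx orbT andbT; lra.
have Pg k : (2 <= k)%N -> g <= odd_prob p k.
  move=> k2; rewrite ge_min; apply/orP; left.
  rewrite /odd_prob ler_wpM2r // lerD2l lerN2.
  by apply: ler_wiXn2l => //; lra.
have [K K0 low] := dense_lower p01' g0l Pg.
have o1 : odd_prob p 1 < (p + g) / 2 by rewrite /odd_prob expr1; lra.
have up := odd_outside_linear_tail p01' o1 e2.
have {}low := low _ e2.
near=> n.
have n0 : (0 < n)%N by near: n; exact: nbhs_infty_gt.
have S0 : 0 < Num.sqrt n%:R :> R by rewrite sqrtr_gt0 ltr0n.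
have SS : Num.sqrt n%:R ^+ 2 = n%:R :> R by rewrite sqr_sqrtr.
have SL : 2 * K / (g - p) * ln n%:R <= Num.sqrt n%:R by near: n; exact: near_sqrt_ge.
pose v := Ordinal n0.
have -> : e = e / 2 + e / 2 by field.
apply: (@le_trans _ _ (
  gnp_prob p (fun G : sgraph 'I_n => (p + g) / 2 * n%:R <= #|odd_outside G [set v]%SET|%:R) +
  gnp_prob p (fun G : sgraph 'I_n => [exists A : {set 'I_n}, (2 <= #|A|)%N &&
      ((#|A| + #|odd_outside G A|)%:R <= g * n%:R - K * (Num.sqrt n%:R * ln n%:R))]))).
  apply: gnp_probU => // G nd.
  have /existsP[A /andP[A2 Am]] : [exists A : {set 'I_n},
    (2 <= #|A|)%N && (#|A| + #|odd_outside G A| <= mindeg G)%N].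
    apply: contraNT nd => /existsPn no.
    apply/eqP/diagdist_mindegP; first by rewrite card_ord.
    by move=> A A2; have := no A; rewrite A2.
  have [//|dv] := leP ((p + g) / 2 * n%:R) #|odd_outside G [set v]%SET|%:R.
  apply/orP; right; apply/existsP; exists A; rewrite A2 /=.
  have h : (#|A| + #|odd_outside G A|)%:R <= #|odd_outside G [set v]%SET|%:R :> R.
    rewrite ler_nat odd_outside1; exact: leq_trans Am (mindeg_le _ _).
  have h2 : K * (Num.sqrt n%:R * ln n%:R) <= (g - p) / 2 * n%:R.
    rewrite [leRHS](_ : _ = (g - p) / 2 * Num.sqrt n%:R * Num.sqrt n%:R); last first.
      by rewrite -[X in _ * X = _]SS; ring.
    have -> : K * (Num.sqrt n%:R * ln n%:R) =
      (g - p) / 2 * Num.sqrt n%:R * (2 * K / (g - p) * ln n%:R).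
      by field; rewrite gt_eqF // subr_gt0.
    have gp : 0 <= (g - p) / 2 * Num.sqrt n%:R.
      by rewrite mulr_ge0 // divr_ge0 // subr_ge0 ltW.
    by rewrite ler_wpM2l.
  lra.
apply: lerD; last by near: n.
have : #|[set v]%SET| = 1%N by rewrite cards1.
move: ([set v]%SET); near: n; apply: filterS up => n h A; exact: h.
Unshelve. all: by end_near. Qed.

(** For p > p0 the smallest parity probability is odd_prob p 2 < lambda0, attained
    only at k = 2: odd sizes are above 1/2, and even sizes k >= 4 are at least
    odd_prob p 4. *)
Lemma dense_min_symdiff p : p0 < p < 1 -> forall e : R, 0 < e -> \forall n \near \oo,
  gnp_prob p (fun G : sgraph 'I_n => diagdist G != 2 + min_symdiff G)%N <= e.
Proof.
have [/andP[l0 l1] _] := @lambda0P R.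
have [/andP[q0 q1] q2] := @p0P R.
move=> /andP[pp p1] e e0; have e2 : 0 < e / 2 by lra.
have p01 : 0 <= p <= 1 by lra.
have p01' : 0 < p < 1 by lra.
pose g := Num.min (Num.min p (odd_prob p 4)) lambda0.
have o2 : odd_prob p 2 = 2 * p * (1 - p) by rewrite /odd_prob; field.
have pl : odd_prob p 2 < lambda0 by rewrite o2; nra.
have pg : odd_prob p 2 < g.
  rewrite !lt_min pl andbT o2; apply/andP; split; first by nra.
  rewrite -o2 /odd_prob ltr_pM2r ?invr_gt0 // ltrD2l ltrN2.
  have x0 : 0 < (1 - 2 * p) ^+ 2 by rewrite -sqrrN exprn_gt0 //; lra.
  have x1 : (1 - 2 * p) ^+ 2 < 1 by nra.
  rewrite (_ : (1 - 2 * p) ^+ 4 = ((1 - 2 * p) ^+ 2) ^+ 2); last by rewrite -exprM.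
  nra.
have o20 : 0 < odd_prob p 2 by rewrite o2 !mulr_gt0 //; lra.
have g0l : 0 <= g <= lambda0 by rewrite ge_min lexx orbT andbT; lra.
pose P k := (0 < k)%N && (k != 2%N).
have Pg k : P k -> g <= odd_prob p k.
  move=> /andP[k0 k2]; have [ok|ek] := boolP (odd k).
    have : 1 / 2 <= odd_prob p k.
      rewrite /odd_prob (_ : 1 - 2 * p = - (2 * p - 1)); last by ring.
      rewrite exprNn -signr_odd ok expr1.
      have : 0 <= (2 * p - 1) ^+ k by rewrite exprn_ge0 //; lra.
      lra.
    by apply: le_trans; case/andP: g0l; lra.
  rewrite !ge_min; apply/orP; left; apply/orP; right.
  rewrite /odd_prob ler_wpM2r // lerD2l lerN2.
  have ev m : ~~ odd m -> (1 - 2 * p) ^+ m = (2 * p - 1) ^+ m.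
    by move=> em; rewrite -[RHS]mul1r -(_ : (-1) ^+ m = 1) -?exprNn ?opprB // -signr_odd (negPf em).
  rewrite !ev //; apply: ler_wiXn2l => //; try lra.
  by move: k0 k2 ek; case: (k) => [|[|[|[|]]]].
have [K K0 low] := dense_lower p01' g0l Pg.
set q := odd_prob p 2 in pl pg o2 o20.
have o1 : odd_prob p 2 < (q + g) / 2 by rewrite -/q; lra.
have up := odd_outside_linear_tail p01' o1 e2.
have {}low := low _ e2.
near=> n.
have n1 : (1 < n)%N by near: n; exact: nbhs_infty_gt.
have n0 : (0 < n)%N by apply: ltnW.
have nR : 1 <= n%:R :> R by rewrite ler1n.
have S0 : 0 < Num.sqrt n%:R :> R by rewrite sqrtr_gt0 ltr0n.
have SS : Num.sqrt n%:R ^+ 2 = n%:R :> R by rewrite sqr_sqrtr.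
have SL : 4 * K / (g - q) * ln n%:R <= Num.sqrt n%:R by near: n; exact: near_sqrt_ge.
have nbig : 4 / (g - q) <= n%:R by near: n; exact: nbhs_infty_ger.
pose v0 : 'I_n := Ordinal n0; pose v1 : 'I_n := Ordinal n1.
have v01 : v0 != v1 by [].
have -> : e = e / 2 + e / 2 by field.
apply: (@le_trans _ _ (
  gnp_prob p (fun G : sgraph 'I_n =>
      (q + g) / 2 * n%:R <= #|odd_outside G [set v0; v1]%SET|%:R) +
  gnp_prob p (fun G : sgraph 'I_n => [exists A : {set 'I_n}, P #|A| &&
      ((#|A| + #|odd_outside G A|)%:R <= g * n%:R - K * (Num.sqrt n%:R * ln n%:R))]))).
  apply: gnp_probU => // G nd.
  have /existsP[A /andP[PA Am]] : [exists A : {set 'I_n},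
    P #|A| && (#|A| + #|odd_outside G A| <= 1 + min_symdiff G)%N].
    apply: contraNT nd => /existsPn no.
    apply/eqP/diagdist_min_symdiffP; first by rewrite card_ord.
    by move=> A A0 A2; have := no A; rewrite /P A0 A2.
  have [//|dv] := leP ((q + g) / 2 * n%:R) #|odd_outside G [set v0; v1]%SET|%:R.
  apply/orP; right; apply/existsP; exists A; rewrite PA /=.
  have h : (#|A| + #|odd_outside G A|)%:R <= 1 + #|odd_outside G [set v0; v1]%SET|%:R :> R.
    rewrite nat1r ler_nat; apply: leq_trans Am _; rewrite add1n ltnS.
    exact: min_symdiff_le.
  have h2 : K * (Num.sqrt n%:R * ln n%:R) <= (g - q) / 4 * n%:R.
    rewrite [leRHS](_ : _ = (g - q) / 4 * Num.sqrt n%:R * Num.sqrt n%:R); last first.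
      by rewrite -[X in _ * X = _]SS; ring.
    have -> : K * (Num.sqrt n%:R * ln n%:R) =
      (g - q) / 4 * Num.sqrt n%:R * (4 * K / (g - q) * ln n%:R).
      by field; rewrite gt_eqF // subr_gt0.
    have gp : 0 <= (g - q) / 4 * Num.sqrt n%:R.
      by rewrite mulr_ge0 // divr_ge0 // subr_ge0 ltW.
    by rewrite ler_wpM2l.
  have h3 : 1 <= (g - q) / 4 * n%:R.
    by move: nbig; rewrite ler_pdivrMr ?subr_gt0 //; clear; lra.
  lra.
apply: lerD; last by near: n.
have : #|[set v0; v1]%SET| = 2%N by rewrite cards2 v01.
move: ([set v0; v1]%SET); near: n; apply: filterS up => n h A; exact: h.
Unshelve. all: by end_near. Qed.

(** The window is exactly the set of p for which no size k has parity probability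
    below lambda0; the two endpoints come from k = 1 and k = 2. *)
Lemma dense_diagdist_lower p : lambda0 <= p <= p0 -> exists2 K : R, 0 <= K &
  forall e : R, 0 < e -> \forall n \near \oo,
  gnp_prob p (fun G : sgraph 'I_n =>
    (diagdist G)%:R <= lambda0 * n%:R - K * (Num.sqrt n%:R * ln n%:R)) <= e.
Proof.
have [/andP[l0 l1] _] := @lambda0P R.
have [/andP[q0 q1] q2] := @p0P R.
move=> /andP[lp pp].
have p01 : 0 <= p <= 1 by lra.
have p01' : 0 < p < 1 by lra.
have Pg k : (0 < k)%N -> lambda0 <= odd_prob p k.
  move=> k0; have [p12|p12] := leP p (1 / 2).
    have : (1 - 2 * p) ^+ k <= (1 - 2 * p) ^+ 1 by apply: ler_wiXn2l => //; lra.
    by rewrite expr1 /odd_prob; lra.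
  have [ok|ek] := boolP (odd k).
    rewrite /odd_prob (_ : 1 - 2 * p = - (2 * p - 1)); last by ring.
    rewrite exprNn -signr_odd ok expr1.
    have : 0 <= (2 * p - 1) ^+ k by rewrite exprn_ge0 //; lra.
    lra.
  have ev m : ~~ odd m -> (1 - 2 * p) ^+ m = (2 * p - 1) ^+ m.
    by move=> em; rewrite -[RHS]mul1r -(_ : (-1) ^+ m = 1) -?exprNn ?opprB // -signr_odd (negPf em).
  have : (2 * p - 1) ^+ k <= (2 * p - 1) ^+ 2.
    apply: ler_wiXn2l; try lra.
    by move: k0 ek; case: (k) => [|[|]].
  rewrite /odd_prob ev //.
  have : 2 * p - 2 * p ^+ 2 >= 2 * p0 - 2 * p0 ^+ 2 by nra.
  lra.
have ll : 0 <= @lambda0 R <= lambda0 by rewrite lexx andbT ltW.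
have [K K0 low] := dense_lower p01' ll Pg.
exists K => // e e0; have {}low := low _ e0.
near=> n.
have n0 : (0 < n)%N by near: n; exact: nbhs_infty_gt.
apply: (@le_trans _ _ (gnp_prob p (fun G : sgraph 'I_n => [exists A : {set 'I_n}, (0 < #|A|)%N &&
      ((#|A| + #|odd_outside G A|)%:R <= lambda0 * n%:R - K * (Num.sqrt n%:R * ln n%:R))]))).
  apply: gnp_prob_sub => // G Gle; have [|A A0 Ad] := @diagdist_attained _ G.
    by rewrite card_ord.
  apply/existsP; exists A; rewrite card_gt0 A0 /=.
  by apply: le_trans Gle; rewrite ler_nat.
by near: n.
Unshelve. all: by end_near. Qed.

End DenseTheorems.

(** * Character sums over two columns *)

Section SecondMoment.
Variable R : realType.
Implicit Types (n l : nat) (p : R).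

Lemma prod1D_sets (I : finType) (P : pred I) (f : I -> R) :
  \prod_(z | P z) (1 + f z) = \sum_(Z : {set I} | [forall z in Z, P z]) \prod_(z in Z) f z.
Proof.
rewrite big_mkcond /=.
transitivity (\prod_z ((if P z then f z else 0) + 1)).
  by apply: eq_bigr => z _; case: ifP => _; rewrite ?add0r // addrC.
rewrite bigA_distr /= [RHS]big_mkcond /=.
apply: eq_big => [Z|Z _]; first by rewrite inE.
case: (boolP [forall z in Z, P z]) => [/forall_inP ZP|].
  rewrite [RHS]big_mkcond /=; apply: eq_bigr => z _.
  by case: ifP => // /ZP ->.
rewrite negb_forall_in => /exists_inP[z zZ nPz].
by rewrite (bigD1 z) //= zZ (negPf nPz) mul0r.
Qed.

(** A character is a product of independent signs; each edge on which it is
    nontrivial contributes a factor 1 - 2 p. *)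
Lemma char_mean_le n p (w : {set 'I_n} -> R) (S : {set {set 'I_n}}) : 0 <= p <= 1 ->
  (forall e, w e = 1 \/ w e = -1) -> (forall e, e \in S -> (#|e| == 2%N) /\ w e = -1) ->
  `|gnp_mean p (fun G => \prod_(e : {set 'I_n} | #|e| == 2%N)
      (if e \in edges G then w e else 1))| <= `|1 - 2 * p| ^+ #|S|.
Proof.
move=> p01 w1 wS; rewrite (gnp_mean_edges p w (fun=> 1)) normr_prod.
have -> : `|1 - 2 * p| ^+ #|S| =
    \prod_(e : {set 'I_n} | #|e| == 2%N) (if e \in S then `|1 - 2 * p| else 1).
  rewrite -prodr_const big_mkcond [RHS]big_mkcond /=; apply: eq_bigr => e _.
  by case: ifP => [/wS[-> _]|_] //; case: ifP.
apply: ler_prod => e _; rewrite normr_ge0 /=; case: ifP => [/wS[_ ->]|_].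
  by rewrite (_ : p * -1 + (1 - p) * 1 = 1 - 2 * p) //; ring.
by case: (w1 e) => ->; rewrite ler_norml; lra.
Qed.

(** The sign that the edge e receives in the product of the characters
    (-1) ^ deg_in A z over z in Z; e may occur twice, once from each endpoint. *)
Definition column_sign n (Z A e : {set 'I_n}) : R :=
  \prod_(t : 'I_n * 'I_n | ((t.1 \in Z) && (t.2 \in A)) && ([set t.1; t.2]%SET == e)) (-1).

Lemma column_sign1 n (Z A e : {set 'I_n}) : column_sign Z A e = 1 \/ column_sign Z A e = -1.
Proof.
rewrite /column_sign prodr_const -signr_odd.
by case: odd; [right; rewrite expr1|left; rewrite expr0].
Qed.

Lemma column_sign2 n (Z A : {set 'I_n}) z y : z != y ->
  column_sign Z A [set z; y]%SET =
  (-1) ^+ ((z \in Z) && (y \in A)) * (-1) ^+ ((y \in Z) && (z \in A)).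
Proof.
move=> zy; rewrite /column_sign.
have E (t : 'I_n * 'I_n) : ([set t.1; t.2]%SET == [set z; y]%SET) = (t == (z, y)) || (t == (y, z)).
  apply/eqP/orP => [e|[] /eqP -> //=]; last by rewrite finset.setUC.
  have t12 : t.1 != t.2.
    have := cards2 z y; rewrite -e cards2 zy; by case: (t.1 != t.2).
  have := set21 t.1 t.2; rewrite e !inE => /orP[] /eqP e1.
    have := set22 t.1 t.2; rewrite e !inE => /orP[] /eqP e2.
      by rewrite e1 e2 eqxx in t12.
    by left; rewrite -e1 -e2; case: (t).
  have := set22 t.1 t.2; rewrite e !inE => /orP[] /eqP e2.
    by right; rewrite -e1 -e2; case: (t).
  by rewrite e1 e2 eqxx in t12.
rewrite (eq_bigl (fun t => ((t.1 \in Z) && (t.2 \in A)) && ((t == (z, y)) || (t == (y, z))))).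
  2: by move=> t; rewrite E.
have ne : (z, y) != (y, z) by rewrite xpair_eqE negb_and zy.
rewrite big_mkcond /= (bigD1 (z, y)) //= (bigD1 (y, z)) //=; last by rewrite eq_sym.
rewrite !eqxx orbT !andbT big1 ?mulr1; first by case: (_ && _); case: (_ && _).
by move=> t /andP[/negPf -> /negPf ->]; rewrite andbF.
Qed.

Lemma prod_columns n (Z A : {set 'I_n}) (G : sgraph 'I_n) :
  (forall z, z \in Z -> z \notin A) ->
  \prod_(z in Z) (-1) ^+ deg_in G A z = \prod_(e : {set 'I_n} | #|e| == 2%N)
     (if e \in edges G then column_sign Z A e else 1) :> R.
Proof.
move=> ZA; under eq_bigr do rewrite exp_deg_in.
rewrite (pair_big (fun z => z \in Z) (fun y => y \in A)
    (fun z y => if [set z; y]%SET \in edges G then (-1) else 1 : R)) /=.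
rewrite (partition_big (fun t : 'I_n * 'I_n => [set t.1; t.2]%SET) (fun e => #|e| == 2%N)) /=.
  apply: eq_bigr => e _; rewrite /column_sign; case: ifP => eG.
    by apply: eq_bigr => t /andP[_ /eqP ->]; rewrite eG.
  by rewrite big1 // => t /andP[_ /eqP ->]; rewrite eG.
move=> t /andP[tZ tA]; rewrite cards2.
by have -> : t.1 != t.2 by apply: contraTneq tA => <-; exact: ZA.
Qed.

(** The two parity vectors are nearly uncorrelated because every z in Z or Z' has l
    private edges: to A0, if z lies in only one of Z and Z' (a vertex of A0 is never an
    index itself), and to the symmetric difference of A and A' if z lies in both (the
    common part of A and A' cancels).  The fixed set A0 is there to provide the first
    kind, since A and A' might otherwise be disjoint. *)
Lemma gnp_mean_two_columns n p l (A0 A A' Z Z' : {set 'I_n}) : 0 <= p <= 1 ->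
  A0 \subset A -> A0 \subset A' -> (l <= #|A0|)%N -> (l <= #|symdiff A A'|)%N ->
  (forall z, z \in Z -> z \notin A) -> (forall z, z \in Z' -> z \notin A') ->
  `|gnp_mean p (fun G => (\prod_(z in Z) (-1) ^+ deg_in G A z) *
                         (\prod_(z in Z') (-1) ^+ deg_in G A' z))| <=
  (`|1 - 2 * p| ^+ l) ^+ #|Z :|: Z'|.
Proof.
move=> p01 /fintype.subsetP A0A /fintype.subsetP A0A' lA0 lAA' ZA Z'A'.
pose Sz z := if (z \in Z) && (z \in Z') then symdiff A A' else A0.
pose T := [set t : 'I_n * 'I_n | (t.1 \in Z :|: Z') && (t.2 \in Sz t.1)]%SET.
pose S := [set [set t.1; t.2]%SET | t in T]%SET.
have TP t : t \in T -> [/\ t.1 != t.2,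
    column_sign Z A [set t.1; t.2]%SET * column_sign Z' A' [set t.1; t.2]%SET = -1 &
    forall t', t' \in T -> t.1 = t'.2 -> t.2 = t'.1 -> False].
  case: t => z y; rewrite inE /= inE /Sz => /andP[zZ].
  case: ifP => [/andP[z1 z2]|zz].
    have [zA zA'] := (ZA z z1, Z'A' z z2).
    rewrite !inE => ys.
    have zy : z != y.
      by apply: contraTneq ys => <-; rewrite (negPf zA) (negPf zA').
    split=> //.
      rewrite !column_sign2 // z1 z2 (negPf zA) (negPf zA') !andbF /=.
      by move: ys; case: (y \in A); case: (y \in A') => //= _; ring.
    move=> [z' y']; rewrite inE /= /Sz => /andP[_ y's] zy' _; move: y's; rewrite -zy'.
    by case: ifP => _; rewrite ?inE ?(negPf zA) ?(negPf zA') //= => /A0A; rewrite (negPf zA).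
  move=> yA0; have [yA yA'] := (A0A y yA0, A0A' y yA0).
  have yZ : (y \in Z) = false by apply/negP => /ZA; rewrite yA.
  have yZ' : (y \in Z') = false by apply/negP => /Z'A'; rewrite yA'.
  have zy : z != y by apply: contraTneq zZ => ->; rewrite yZ yZ'.
  split=> //.
    rewrite !column_sign2 // yA yA' yZ yZ' /= !andbT.
    by move: zZ zz; case: (z \in Z); case: (z \in Z') => //= _ _; ring.
  move=> [z' y']; rewrite inE /= !inE => /andP[z'Z _] _ yz'.
  by rewrite -yz' yZ yZ' in z'Z.
have SE : {in T &, injective (fun t : 'I_n * 'I_n => [set t.1; t.2]%SET)}.
  move=> t t' tT t'T e; have [t12 _ no] := TP t tT.
  have := set21 t.1 t.2; rewrite e !inE => /orP[] /eqP e1.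
    have := set22 t.1 t.2; rewrite e !inE => /orP[] /eqP e2.
      by move: t12; rewrite e1 e2 eqxx.
    exact: injective_projections.
  have := set22 t.1 t.2; rewrite e !inE => /orP[] /eqP e2.
    by case: (no t' t'T e1 e2).
  by move: t12; rewrite e1 e2 eqxx.
have cardS : (l * #|Z :|: Z'| <= #|S|)%N.
  rewrite card_in_imset // -[X in (_ <= X)%N]sum1_card.
  rewrite (eq_bigl (fun t => (t.1 \in Z :|: Z') && (t.2 \in Sz t.1))); last first.
    by move=> t; rewrite inE.
  rewrite -(pair_big_dep (fun z => z \in Z :|: Z') (fun z y => y \in Sz z) (fun _ _ => 1%N)) /=.
  rewrite mulnC -sum_nat_const; apply: leq_sum => z _; rewrite sum1_card /Sz.
  by case: ifP.
rewrite -exprM.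
have r01 : 0 <= `|1 - 2 * p| <= 1 by rewrite normr_ge0 ler_norml; lra.
apply: (@le_trans _ _ (`|1 - 2 * p| ^+ #|S|)); last first.
  by case/andP: r01 => r0 r1; apply: ler_wiXn2l.
rewrite (eq_gnp_mean p (F' := fun G => \prod_(e : {set 'I_n} | #|e| == 2%N)
      (if e \in edges G then column_sign Z A e * column_sign Z' A' e else 1))); last first.
  move=> G; rewrite !prod_columns // -big_split /=; apply: eq_bigr => e _.
  by case: ifP; rewrite ?mulr1.
apply: char_mean_le => //.
  by move=> e; case: (column_sign1 Z A e) => ->; case: (column_sign1 Z' A' e) => ->;
    rewrite ?mulrNN ?mulr1 ?mul1r ?mulN1r ?opprK; [left|right|right|left].
move=> e /imsetP[t tT ->]; have [t12 ct _] := TP t tT.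
by rewrite cards2 t12.
Qed.

End SecondMoment.

(** * Second moment *)

Section Hits.
Variable R : realType.
Implicit Types (n l : nat) (p : R).

Definition hit n (A B : {set 'I_n}) (G : sgraph 'I_n) : R := (odd_outside G A == B)%:R.

Definition sgn_in n (B : {set 'I_n}) (z : 'I_n) : R := if z \in B then -1 else 1.

(** The probability of a prescribed odd set if all parities were fair and
    independent. *)
Definition ideal_prob n (A : {set 'I_n}) : R := 2^-1 ^+ (n - #|A|).

Lemma hit_prod n (A B : {set 'I_n}) G : [disjoint A & B] ->
  hit A B G = ideal_prob A * \prod_(z | z \notin A) (1 + sgn_in B z * (-1) ^+ deg_in G A z).
Proof.
move=> AB; rewrite /ideal_prob -card_notin -prodr_const -big_split /=.
have fac z : z \notin A -> 2^-1 * (1 + sgn_in B z * (-1) ^+ deg_in G A z) =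
    ((z \in odd_outside G A) == (z \in B))%:R :> R.
  move=> zA; rewrite !inE zA /= /sgn_in -signr_odd.
  by case: odd; case: (z \in B) => /=; rewrite ?expr1 ?expr0; field.
rewrite (eq_bigr _ fac) /hit; case: eqP => [<-|/eqP ne].
  by rewrite big1 // => z zA; rewrite eqxx.
have [z zd] : exists z, (z \in odd_outside G A) != (z \in B).
  apply/existsP; apply: contraNT ne => /existsPn h; apply/eqP/setP => z.
  by have := h z; rewrite negbK => /eqP.
have zA : z \notin A.
  apply/negP => zA; move: zd; rewrite !inE zA /=.
  by rewrite (disjointFr AB zA).
by rewrite (bigD1 z) //= (negPf zd) mul0r.
Qed.

Lemma hit_ge0 n (A B : {set 'I_n}) G : 0 <= hit A B G.
Proof. exact: ler0n. Qed.

Lemma ideal_prob_gt0 n (A : {set 'I_n}) : 0 < ideal_prob A.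
Proof. by rewrite exprn_gt0 ?invr_gt0. Qed.

Lemma mean_hit_bounds n l p (A B : {set 'I_n}) (eta : R) : 0 <= p <= 1 ->
  [disjoint A & B] -> (l <= #|A|)%N -> `|1 - 2 * p| ^+ l <= eta -> eta <= 1 ->
  ideal_prob A * (1 - eta) ^+ n <= gnp_mean p (hit A B) <= ideal_prob A * (1 + eta) ^+ n.
Proof.
move=> p01 AB lA le_eta eta1.
have r01 : 0 <= `|1 - 2 * p| <= 1 by rewrite normr_ge0 ler_norml; lra.
have eta0 : 0 <= eta by apply: le_trans le_eta; rewrite exprn_ge0.
rewrite (eq_gnp_mean p (F' := fun G => ideal_prob A * \prod_(z | z \notin A)
    (1 * 1 ^+ deg_in G A z + sgn_in B z * (-1) ^+ deg_in G A z))); last first.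
  move=> G; rewrite hit_prod //; congr (_ * _); apply: eq_bigr => z _.
  by rewrite expr1n mulr1.
rewrite gnp_meanZ (gnp_mean_columns p A (fun=> 1)).
have -> : 1 - p + p * 1 = 1 by ring.
have -> : 1 - p + p * -1 = 1 - 2 * p by ring.
rewrite expr1n mulr1.
have rA : `|(1 - 2 * p) ^+ #|A| | <= eta.
  by rewrite normrX; apply: le_trans le_eta; apply: ler_wiXn2l => //; lra.
have fac z : 1 - eta <= 1 + sgn_in B z * (1 - 2 * p) ^+ #|A| <= 1 + eta.
  by move: rA; rewrite ler_norml /sgn_in; case: ifP => _; lra.
have cst (x : R) : \prod_(z | z \notin A) x = x ^+ (n - #|A|) by rewrite prodr_const card_notin.
apply/andP; split; rewrite ler_pM2l ?ideal_prob_gt0 //.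
  apply: (@le_trans _ _ ((1 - eta) ^+ (n - #|A|))).
    by apply: ler_wiXn2l; rewrite ?leq_subr //; lra.
  rewrite -cst; apply: ler_prod => z _; case/andP: (fac z) => -> _; rewrite andbT; lra.
apply: (@le_trans _ _ ((1 + eta) ^+ (n - #|A|))).
  rewrite -cst; apply: ler_prod => z _; case/andP: (fac z) => h ->; rewrite andbT.
  by apply: le_trans h; lra.
by apply: ler_weXn2l; rewrite ?leq_subr //; lra.
Qed.

Lemma sum_setU_exp n (eta : R) :
  \sum_(Z : {set 'I_n}) \sum_(Z' : {set 'I_n}) eta ^+ #|Z :|: Z'| = (1 + 3 * eta) ^+ n.
Proof.
transitivity (\sum_(Z : {set 'I_n}) \prod_z (if z \in Z then 2 * eta else 1 + eta)).
  apply: eq_bigr => Z _.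
  transitivity (\prod_z (eta + if z \in Z then eta else 1)).
    rewrite bigA_distr /=; apply: eq_big => [Z'|Z' _]; first by rewrite inE.
    rewrite -prodr_const big_mkcond /=; apply: eq_bigr => z _; rewrite inE.
    by case: (z \in Z); case: (z \in Z').
  by apply: eq_bigr => z _; case: ifP => _; ring.
transitivity (\prod_(z < n) (2 * eta + (1 + eta))).
  by rewrite bigA_distr /=; apply: eq_bigl => Z; rewrite inE.
by rewrite prodr_const card_ord; congr (_ ^+ _); ring.
Qed.

Lemma mean_two_hits_far n l p (A0 A A' B B' : {set 'I_n}) : 0 <= p <= 1 ->
  A0 \subset A -> A0 \subset A' -> (l <= #|A0|)%N -> (l <= #|symdiff A A'|)%N ->
  [disjoint A & B] -> [disjoint A' & B'] ->
  gnp_mean p (fun G => hit A B G * hit A' B' G) <=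
  ideal_prob A * ideal_prob A' * (1 + 3 * `|1 - 2 * p| ^+ l) ^+ n.
Proof.
move=> p01 A0A A0A' lA0 lAA' AB A'B'.
rewrite (eq_gnp_mean p (F' := fun G => (ideal_prob A * ideal_prob A') *
   \sum_(Z : {set 'I_n} | [forall z in Z, z \notin A])
   \sum_(Z' : {set 'I_n} | [forall z in Z', z \notin A'])
     ((\prod_(z in Z) sgn_in B z) * (\prod_(z in Z') sgn_in B' z)) *
     ((\prod_(z in Z) (-1) ^+ deg_in G A z) * (\prod_(z in Z') (-1) ^+ deg_in G A' z)))); last first.
  move=> G; rewrite !hit_prod // !prod1D_sets mulrACA; congr (_ * _).
  rewrite mulr_suml; apply: eq_bigr => Z _; rewrite mulr_sumr; apply: eq_bigr => Z' _.
  by rewrite !big_split /= mulrACA.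
rewrite gnp_meanZ ler_pM2l ?mulr_gt0 ?ideal_prob_gt0 // gnp_mean_sum.
set eta := `|_| ^+ l; have eta0 : 0 <= eta by rewrite exprn_ge0.
rewrite -sum_setU_exp big_mkcond; apply: ler_sum => Z _; case: ifP => [ZA|_]; last first.
  by apply: sumr_ge0 => Z' _; apply: exprn_ge0.
rewrite gnp_mean_sum big_mkcond; apply: ler_sum => Z' _; case: ifP => [Z'A'|_]; last first.
  exact: exprn_ge0.
have sg (C D : {set 'I_n}) : `|\prod_(z in D) sgn_in C z| = 1.
  rewrite normr_prod big1 // => z _; rewrite /sgn_in; case: ifP => _; rewrite ?normrN normr1 //.
rewrite gnp_meanZ; apply: le_trans (ler_norm _) _; rewrite !normrM !sg !mul1r.
by apply: (gnp_mean_two_columns (A0 := A0)) => //; apply/forall_inP.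
Qed.

Lemma symdiffK (I : finType) (A : {set I}) : involutive (symdiff A).
Proof.
move=> B; apply/setP => z; rewrite !inE.
by case: (z \in A); case: (z \in B).
Qed.

(** Counted by a weighted sum over all symmetric differences with weight n ^ (l - size). *)
Lemma near_sets_le n l (A : {set 'I_n}) : (0 < n)%N ->
  \sum_(A' : {set 'I_n}) (#|symdiff A A'| < l)%N%:R <= n%:R ^+ l * expR 1 :> R.
Proof.
move=> n0; have nR : 0 < n%:R :> R by rewrite ltr0n.
have n1 : 1 <= n%:R :> R by rewrite ler1n.
rewrite (reindex_inj (inv_inj (symdiffK A))) /=; under eq_bigr do rewrite symdiffK.
apply: (@le_trans _ _ (\sum_(D : {set 'I_n})
    n%:R ^+ l * (n%:R^-1 ^+ #|D| * 1 ^+ (n - #|D|)))).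
  apply: ler_sum => D _; rewrite expr1n mulr1; case: ltnP => [Dl|_] /=; last first.
    by rewrite mulr_ge0 ?exprn_ge0 // invr_ge0 ltW.
  by rewrite exprVn ler_pdivlMr ?exprn_gt0 // mul1r ler_weXn2l // ltnW.
rewrite -mulr_sumr sum_set_exp ler_wpM2l ?exprn_ge0 //.
rewrite addrC; apply: le_trans (exp_le_expR _ _) _; last by rewrite mulfV // gt_eqF.
by rewrite addr_ge0 // invr_ge0 ltW.
Qed.

Section NoHit.
Variables (n l : nat) (p M : R) (A0 : {set 'I_n}).
Hypotheses (n0 : (0 < n)%N) (p01 : 0 <= p <= 1) (lA0 : (l <= #|A0|)%N).
Let eta := `|1 - 2 * p| ^+ l.
Hypothesis eta1 : eta < 1.

Definition target (w : {set 'I_n} * {set 'I_n}) :=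
  [&& A0 \subset w.1, [disjoint w.1 & w.2] & (#|w.1| + #|w.2|)%:R <= M].

Definition ideal_mean : R := \sum_(w | target w) ideal_prob w.1.

(** Chebyshev's inequality for the number of hit targets.  Targets whose sets
    differ in at least l vertices are nearly uncorrelated.  The others are not estimated
    at all: given A there are at most e n ^ l sets near A, and each has one odd set; this
    factor is negligible against the ideal mean, which is exponential in sqrt n. *)
Lemma no_hit_prob : 0 < ideal_mean ->
  gnp_prob p (fun G => \sum_(w | target w) hit w.1 w.2 G == 0) <=
  (1 + 3 * eta) ^+ n / ((1 - eta) ^+ n) ^+ 2 +
  n%:R ^+ l * expR 1 / ((1 - eta) ^+ n * ideal_mean) - 1.
Proof.
set mu := ideal_mean => mu0.
have eta0 : 0 <= eta by rewrite exprn_ge0.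
pose X (G : sgraph 'I_n) := \sum_(w | target w) hit w.1 w.2 G.
pose a := gnp_mean p X.
have b0 : 0 < (1 - eta) ^+ n by rewrite exprn_gt0 // subr_gt0.
have cardA w : target w -> (l <= #|w.1|)%N.
  by case/and3P => A0w _ _; apply: leq_trans lA0 (subset_leq_card A0w).
have a_ge : (1 - eta) ^+ n * mu <= a.
  rewrite /a /X gnp_mean_sum /mu /ideal_mean mulr_sumr; apply: ler_sum => w tw.
  rewrite mulrC; have [_ dw _] := and3P tw.
  by have /andP[] := mean_hit_bounds p01 dw (cardA w tw) (lexx _) (ltW eta1).
have a0 : 0 < a by apply: lt_le_trans a_ge; rewrite mulr_gt0.
set N := n%:R ^+ l * expR 1.
have N0 : 0 <= N by rewrite mulr_ge0 ?exprn_ge0 ?expR_ge0.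
have EX2 : gnp_mean p (fun G => X G ^+ 2) <= (1 + 3 * eta) ^+ n * mu ^+ 2 + N * a.
  rewrite (eq_gnp_mean p (F' := fun G => \sum_(w | target w) \sum_(w' | target w')
     hit w.1 w.2 G * hit w'.1 w'.2 G)); last first.
    move=> G; rewrite expr2 /X mulr_suml; apply: eq_bigr => w _.
    by rewrite mulr_sumr.
  rewrite gnp_mean_sum.
  have -> : (1 + 3 * eta) ^+ n * mu ^+ 2 + N * a = \sum_(w | target w)
     (\sum_(w' | target w') ideal_prob w.1 * ideal_prob w'.1 * (1 + 3 * eta) ^+ n +
      N * gnp_mean p (hit w.1 w.2)).
    rewrite big_split /= -mulr_sumr -gnp_mean_sum; congr (_ + _).
    transitivity (mu * (mu * (1 + 3 * eta) ^+ n)); first by rewrite mulrC expr2 mulrA.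
    rewrite {1}/mu /ideal_mean mulr_suml; apply: eq_bigr => w _.
    rewrite /mu /ideal_mean mulr_suml mulr_sumr; apply: eq_bigr => w' _.
    by rewrite mulrA.
  apply: ler_sum => w tw; have [A0w dw _] := and3P tw.
  rewrite gnp_mean_sum.
  pose near (w' : {set 'I_n} * {set 'I_n}) := (#|symdiff w.1 w'.1| < l)%N.
  apply: (@le_trans _ _ (\sum_(w' | target w') (ideal_prob w.1 * ideal_prob w'.1 * (1 + 3 * eta) ^+ n +
     gnp_mean p (fun G => hit w.1 w.2 G * ((near w')%:R * hit w'.1 w'.2 G))))).
    apply: ler_sum => w' tw'; have [A0w' dw' _] := and3P tw'.
    have [nw|fw] := boolP (near w').
      rewrite (eq_gnp_mean p (F' := fun G => hit w.1 w.2 G * hit w'.1 w'.2 G)); last first.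
        by move=> G; rewrite mul1r.
      by rewrite lerDr !mulr_ge0 ?exprn_ge0 ?ltW ?ideal_prob_gt0 //; lra.
    apply: (@le_trans _ _ (ideal_prob w.1 * ideal_prob w'.1 * (1 + 3 * eta) ^+ n)).
      by apply: (mean_two_hits_far (A0 := A0)); rewrite // leqNgt.
    by rewrite lerDl gnp_mean_ge0 // => G; rewrite !mulr_ge0 ?hit_ge0.
  rewrite big_split /= lerD2l -gnp_mean_sum -gnp_meanZ; apply: ler_gnp_mean => // G.
  rewrite -mulr_sumr mulrC ler_wpM2r ?hit_ge0 //.
  apply: le_trans (near_sets_le l w.1 n0).
  apply: (@le_trans _ _ (\sum_(w' : {set 'I_n} * {set 'I_n}) (near w')%:R * hit w'.1 w'.2 G)).
    rewrite big_mkcond; apply: ler_sum => w' _; case: ifP => // _.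
    by rewrite mulr_ge0 ?hit_ge0.
  rewrite -(pair_big xpredT xpredT (fun A' B' => (#|symdiff w.1 A'| < l)%N%:R * hit A' B' G)) /=.
  apply: ler_sum => A' _; rewrite -mulr_sumr ler_piMr //.
  rewrite (bigD1 (odd_outside G A')) //= /hit eqxx big1 ?addr0 // => B' /negPf.
  by rewrite eq_sym => ->.
apply: (@le_trans _ _ (gnp_mean p (fun G => a ^- 2 * (X G - a) ^+ 2))).
  apply: gnp_prob_markov => // G => [|/eqP X0].
    by rewrite mulr_ge0 ?sqr_ge0 // invr_ge0 sqr_ge0.
  by rewrite /X X0 sub0r sqrrN mulVf // expf_eq0 /= gt_eqF.
rewrite gnp_meanZ.
have -> : gnp_mean p (fun G => (X G - a) ^+ 2) = gnp_mean p (fun G => X G ^+ 2) - a ^+ 2.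
  transitivity (gnp_mean p (fun G => X G ^+ 2 + (- (2 * a)) * X G + a ^+ 2 * 1)).
    by apply: eq_gnp_mean => G; ring.
  by rewrite !gnp_meanD !gnp_meanZ -/a gnp_mean1; ring.
apply: (@le_trans _ _ (a ^- 2 * ((1 + 3 * eta) ^+ n * mu ^+ 2 + N * a - a ^+ 2))).
  by rewrite ler_wpM2l ?lerD2r // invr_ge0 sqr_ge0.
have -> : a ^- 2 * ((1 + 3 * eta) ^+ n * mu ^+ 2 + N * a - a ^+ 2) =
   (1 + 3 * eta) ^+ n * (mu / a) ^+ 2 + N / a - 1 by field; rewrite gt_eqF.
rewrite lerD2r; apply: lerD; last first.
  by rewrite ler_wpM2l // lef_pV2 ?posrE // mulr_gt0.
rewrite ler_wpM2l ?exprn_ge0 //; first lra.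
rewrite -exprVn; apply: lerXn2r;
  rewrite ?nnegrE ?divr_ge0 ?invr_ge0 ?(ltW mu0) ?(ltW a0) ?(ltW b0) //.
by rewrite ler_pdivrMr // mulrC ler_pdivlMr // mulrC.
Qed.

End NoHit.
End Hits.

(** * Counting light pairs *)

Section IdealMean.
Variable R : realType.
Implicit Types (n l : nat) (p : R).

Lemma disjoint_forall n (A B : {set 'I_n}) : [disjoint A & B] = [forall z in B, z \notin A].
Proof.
rewrite disjoint_sym disjoint_subset; apply/fintype.subsetP/forall_inP => h z zB.
  by have := h z zB; rewrite inE.
by rewrite inE h.
Qed.

(** Each vertex outside A0 is in A, in B, or in neither, with weights 2 x, x and 1. *)
Lemma sum_disjoint_pairs n (A0 : {set 'I_n}) (x : R) :
  \sum_(w : {set 'I_n} * {set 'I_n} | (A0 \subset w.1) && [disjoint w.1 & w.2])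
     2 ^+ #|w.1 :\: A0| * x ^+ (#|w.1 :\: A0| + #|w.2|) = (1 + 3 * x) ^+ (n - #|A0|).
Proof.
rewrite -(pair_big_dep (fun A : {set 'I_n} => A0 \subset A)
   (fun A B : {set 'I_n} => [disjoint A & B])
   (fun A B : {set 'I_n} => 2 ^+ #|A :\: A0| * x ^+ (#|A :\: A0| + #|B|))) /=.
transitivity (\sum_(A : {set 'I_n} | A0 \subset A)
    (2 * x) ^+ #|A :\: A0| * (1 + x) ^+ (n - #|A|)).
  apply: eq_bigr => A _; rewrite exprMn -mulrA.
  have -> : (1 + x) ^+ (n - #|A|) = \prod_(z | z \notin A) (1 + x).
    by rewrite prodr_const card_notin.
  rewrite prod1D_sets !mulr_sumr; apply: eq_big => [B|B _]; first exact: disjoint_forall.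
  by rewrite prodr_const exprD.
rewrite -[in RHS]card_notin -prodr_const [RHS]big_mkcond /=.
transitivity (\prod_(z < n) ((if z \in A0 then 1 else 2 * x) + (if z \in A0 then 0 else 1 + x))).
  rewrite bigA_distr [LHS]big_mkcond /=; apply: eq_big => [A|A _]; first by rewrite inE.
  case: (boolP (A0 \subset A)) => [A0A|].
    rewrite -card_notin -!prodr_const [X in X * _]big_mkcond [X in _ * X]big_mkcond -big_split /=.
    apply: eq_bigr => z _; rewrite !inE.
    have := fintype.subsetP A0A z.
    by case: (z \in A0); case: (z \in A) => //= h; rewrite ?mulr1 ?mul1r //; have := h isT.
  case/subsetPn => z zA0 zA.
  by rewrite (bigD1 z) //= (negPf zA) zA0 mul0r.
apply: eq_bigr => z _; rewrite inE; case: (z \in A0) => /=; first by rewrite addr0.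
ring.
Qed.

(** Two-sided exponential tilting: pairs of size between m' and m carry
    the generating function at y up to two Chernoff errors, and each of them is weighted
    there by at most y ^ m'. *)
Lemma light_pairs_ge n (A0 : {set 'I_n}) (y s m m' : R) : 0 < y <= 1 -> 0 <= s ->
  expR (- (m' * ln y)) * ((1 + 3 * y) ^+ (n - #|A0|) - expR (- (s * m)) * (1 + 3 * (y * expR s)) ^+ (n - #|A0|)
    - expR (s * m') * (1 + 3 * (y * expR (- s))) ^+ (n - #|A0|)) <=
  \sum_(w : {set 'I_n} * {set 'I_n} | [&& A0 \subset w.1, [disjoint w.1 & w.2] &
     (#|w.1 :\: A0| + #|w.2|)%:R <= m]) 2 ^+ #|w.1 :\: A0|.
Proof.
move=> /andP[y0 y1] s0.
have yE k : y ^+ k = expR (k%:R * ln y) by rewrite expRM_natl lnK.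
have es k (t : R) : expR t ^+ k = expR (k%:R * t) by rewrite expRM_natl.
rewrite -!(sum_disjoint_pairs A0) !mulr_sumr -!sumrB mulr_sumr.
under [leRHS]eq_bigl do rewrite andbA.
rewrite [leRHS]big_mkcondr /=; apply: ler_sum => w _.
set k := (#|_| + _)%N; set c : R := 2 ^+ _; have c0 : 0 < c by rewrite exprn_gt0.
rewrite !exprMn !es !yE.
set Y := expR (k%:R * ln y); have Y0 : 0 < Y by exact: expR_gt0.
rewrite [leLHS](_ : _ = c * (expR (- (m' * ln y)) * Y *
   (1 - expR (- (s * m)) * expR (k%:R * s) - expR (s * m') * expR (k%:R * - s)))); last by ring.
rewrite -!expRD.
have ly : ln y <= 0 by rewrite ln_le0.
have e1 := expR_ge0 (- (s * m) + k%:R * s); have e2 := expR_ge0 (s * m' + k%:R * - s).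
have e3 := expR_gt0 (- (m' * ln y) + k%:R * ln y).
have neg (b : R) : b <= 0 -> c * (expR (- (m' * ln y) + k%:R * ln y) * b) <= 0.
  by move=> b0; rewrite mulr_ge0_le0 ?(ltW c0) // mulr_ge0_le0 // ltW.
case: ifP => km; last first.
  apply: neg; have : 1 <= expR (- (s * m) + k%:R * s); last lra.
  rewrite -[leLHS]expR0 ler_expR.
  have : 0 <= s * (k%:R - m) by rewrite mulr_ge0 // subr_ge0 ltW // ltNge km.
  lra.
have [km'|km'] := ltP k%:R m'.
  apply: le_trans (ltW c0); apply: neg.
  have : 1 <= expR (s * m' + k%:R * - s); last lra.
  rewrite -[leLHS]expR0 ler_expR.
  have : 0 <= s * (m' - k%:R) by rewrite mulr_ge0 // subr_ge0 ltW.
  lra.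
rewrite ler_piMr ?(ltW c0) //.
apply: (@le_trans _ _ (expR (- (m' * ln y) + k%:R * ln y) * 1)).
  by rewrite ler_wpM2l ?(ltW e3) //; lra.
rewrite mulr1 expR_le1.
have : 0 <= (k%:R - m') * - ln y by rewrite mulr_ge0 ?subr_ge0 // oppr_ge0.
lra.
Qed.

(** The number of targets is that of ternary words, whose mean turns from small to
    large at lambda0 N.  Going 7 sqrt N beyond it gains the factor exp (sqrt N / 2): tilt
    the words to density lambda0 + 4 / sqrt N, so that nearly all of their weight lies
    between lambda0 N + sqrt N and lambda0 N + 7 sqrt N. *)
Lemma ideal_mean_ge n (A0 : {set 'I_n}) (S : R) : 2 <= S -> S ^+ 2 = (n - #|A0|)%:R ->
  4 / S <= 1 / 2 - lambda0 ->
  expR (S / 2) / 2 <= ideal_mean (#|A0|%:R + lambda0 * (n - #|A0|)%:R + 7 * S) A0.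
Proof.
move=> S2 SN Sl; have [/andP[l0 l1] _] := @lambda0P R.
set N := (n - #|A0|)%N in SN *.
(* The shifted density; lam * N is lambda0 * N + 4 * S. *)
pose lam := lambda0 + 4 / S.
have S0 : 0 < S by lra.
have lam0 : lambda0 <= lam by rewrite lerDl divr_ge0 // ltW.
have lam1 : lam <= 1 / 2 by rewrite /lam; lra.
have lamp : 0 < lam by lra.
pose y := lam / (3 * (1 - lam)).
have y0 : 0 < y by rewrite divr_gt0 ?mulr_gt0 //; lra.
have y13 : y <= 1 / 3 by rewrite ler_pdivrMr ?mulr_gt0 //; lra.
have y1 : 1 + 3 * y = (1 - lam)^-1 by rewrite /y; field; lra.
have y1y : 3 * y = lam * (1 + 3 * y) by rewrite y1 /y; field; lra.
pose s := S^-1.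
have s0 : 0 < s by rewrite invr_gt0.
have s2 : s <= 1 / 2 by rewrite /s -[leRHS]invrK lef_pV2 ?posrE ?invr_gt0 //; lra.
have sS : s * S = 1 by rewrite mulVf // gt_eqF.
pose m := lambda0 * N%:R + 7 * S; pose m' := lambda0 * N%:R + S.
have mE : m = lam * N%:R + 3 * S by rewrite /m /lam -SN; field; rewrite gt_eqF.
have mE' : m' = lam * N%:R - 3 * S by rewrite /m' /lam -SN; field; rewrite gt_eqF.
have B0 : 0 < 1 + 3 * y by lra.
have e12 : 2 <= expR 1 :> R by have := @expR_ge1Dx R 1; lra.
have e24 : expR (- (2)) <= 1 / 4 :> R.
  rewrite (_ : - (2) = - 1 + - 1 :> R); last by ring.
  have : expR (- 1) <= 1 / 2 :> R by rewrite expRN div1r lef_pV2 ?posrE ?expR_gt0.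
  have := expR_ge0 (- 1 : R); rewrite expRD; nra.
have sN : s * N%:R = S by rewrite -SN expr2 mulrA sS mul1r.
have sN2 : s ^+ 2 * N%:R = 1 by rewrite -SN -exprMn sS expr1n.
have E1 : expR (- (s * m)) * (1 + 3 * (y * expR s)) ^+ N <= (1 + 3 * y) ^+ N / 4.
  have es : expR s <= 1 + s + 2 * s ^+ 2 by apply: expR_le_half; lra.
  have -> : 1 + 3 * (y * expR s) = (1 + 3 * y) * (1 + lam * (expR s - 1)).
    have -> : (1 + 3 * y) * (1 + lam * (expR s - 1)) =
      (1 + 3 * y) + (lam * (1 + 3 * y)) * (expR s - 1) by ring.
    by rewrite -y1y; ring.
  rewrite exprMn mulrCA ler_pM2l ?exprn_gt0 //.
  have e1 : 1 <= expR s by rewrite -[leLHS]expR0 ler_expR ltW.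
  apply: (@le_trans _ _ (expR (- (s * m)) * expR (N%:R * (lam * (expR s - 1))))).
    by rewrite ler_wpM2l ?expR_ge0 // exp_le_expR // addr_ge0 ?mulr_ge0 //; lra.
  rewrite -expRD; apply: le_trans (_ : _ <= expR (- (2))) _; last by lra.
  rewrite ler_expR.
  have h : N%:R * (lam * (expR s - 1)) <= N%:R * (lam * (s + 2 * s ^+ 2)).
    by rewrite ler_wpM2l // ler_wpM2l ?(ltW lamp) //; move: es; clear; lra.
  have -> : s * m = lam * S + 3 by rewrite mE mulrDr [s * (lam * _)]mulrCA sN mulrCA sS; ring.
  have h2 : N%:R * (lam * (s + 2 * s ^+ 2)) = lam * (s * N%:R) + 2 * lam * (s ^+ 2 * N%:R) by ring.
  by rewrite h2 sN sN2 in h; move: h lam1; clear; lra.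
have E2 : expR (s * m') * (1 + 3 * (y * expR (- s))) ^+ N <= (1 + 3 * y) ^+ N / 4.
  have es := expRN_le2 (ltW s0).
  have -> : 1 + 3 * (y * expR (- s)) = (1 + 3 * y) * (1 + lam * (expR (- s) - 1)).
    have -> : (1 + 3 * y) * (1 + lam * (expR (- s) - 1)) =
      (1 + 3 * y) + (lam * (1 + 3 * y)) * (expR (- s) - 1) by ring.
    by rewrite -y1y; ring.
  rewrite exprMn mulrCA ler_pM2l ?exprn_gt0 //.
  have e1 := expR_ge0 (- s).
  apply: (@le_trans _ _ (expR (s * m') * expR (N%:R * (lam * (expR (- s) - 1))))).
    by rewrite ler_wpM2l ?expR_ge0 // exp_le_expR //; nra.
  rewrite -expRD; apply: le_trans (_ : _ <= expR (- (2))) _; last by lra.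
  rewrite ler_expR.
  have h : N%:R * (lam * (expR (- s) - 1)) <= N%:R * (lam * (- s + s ^+ 2)).
    by rewrite ler_wpM2l // ler_wpM2l ?(ltW lamp) //; move: es; clear; lra.
  have -> : s * m' = lam * S - 3 by rewrite mE' mulrBr [s * (lam * _)]mulrCA sN mulrCA sS; ring.
  have h2 : N%:R * (lam * (- s + s ^+ 2)) = - (lam * (s * N%:R)) + lam * (s ^+ 2 * N%:R) by ring.
  by rewrite h2 sN sN2 in h; move: h lam1; clear; lra.
have y01 : 0 < y <= 1 by lra.
have low := light_pairs_ge A0 m m' y01 (ltW s0).
rewrite /= -/N in low.
have ly : ln y <= - (1 / 2).
  have h2 := expR_half_le2 R.
  rewrite -[leRHS]expRK ler_ln ?posrE ?expR_gt0 // expRN.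
  apply: le_trans y13 _; rewrite div1r lef_pV2 ?posrE ?expR_gt0 //; lra.
have lny := tilt_le y0.
have main : expR (S / 2) * 2 ^+ N <= expR (- (m' * ln y)) * (1 + 3 * y) ^+ N.
  have -> : 2 ^+ N = expR (N%:R * ln 2) :> R by rewrite expRM_natl lnK ?posrE.
  have -> : (1 + 3 * y) ^+ N = expR (N%:R * ln (1 + 3 * y)).
    by rewrite expRM_natl lnK ?posrE.
  rewrite -!expRD ler_expR.
  have : N%:R * (lambda0 * ln y + ln 2) <= N%:R * ln (1 + 3 * y) by rewrite ler_wpM2l.
  have : S * (1 / 2) <= S * - ln y by rewrite ler_wpM2l ?(ltW S0) //; move: ly; clear; lra.
  by move: lny; rewrite /m'; clear; lra.
have N2 : 0 < (2 : R) ^+ N by rewrite exprn_gt0.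
rewrite /ideal_mean (eq_bigl (fun w : {set 'I_n} * {set 'I_n} => [&& A0 \subset w.1, [disjoint w.1 & w.2] &
     (#|w.1 :\: A0| + #|w.2|)%:R <= m])); last first.
  move=> w; rewrite /target; case: (boolP (A0 \subset w.1)) => //= A0w; congr (_ && _).
  have -> : #|w.1| = (#|A0| + #|w.1 :\: A0|)%N.
    by rewrite cardsD (finset.setIidPr A0w) subnKC // subset_leq_card.
  by rewrite -addnA [X in X <= _]natrD -addrA lerD2l.
rewrite (eq_bigr (fun w : {set 'I_n} * {set 'I_n} => (2 ^+ N)^-1 * 2 ^+ #|w.1 :\: A0|)); last first.
  move=> w /and3P[A0w _ _]; rewrite /ideal_prob exprVn.
  have c1 : (#|A0| <= #|w.1|)%N by rewrite subset_leq_card.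
  have c2 : (#|w.1| <= n)%N by rewrite -[X in (_ <= X)%N]card_ord max_card.
  have -> : N = (n - #|w.1| + #|w.1 :\: A0|)%N.
    rewrite cardsD (finset.setIidPr A0w) /N; move: c1 c2; clear; lia.
  rewrite exprD invfM -mulrA mulVf ?mulr1 // expf_neq0 //.
rewrite -mulr_sumr [leRHS]mulrC ler_pdivlMr //.
apply: le_trans low.
have ep := expR_gt0 (- (m' * ln y)).
have : expR (- (m' * ln y)) * ((1 + 3 * y) ^+ N / 2) <= expR (- (m' * ln y)) *
  ((1 + 3 * y) ^+ N - expR (- (s * m)) * (1 + 3 * (y * expR s)) ^+ N -
   expR (s * m') * (1 + 3 * (y * expR (- s))) ^+ N).
  by rewrite ler_pM2l //; move: E1 E2; clear; lra.
by move: main; clear; lra.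
Qed.

End IdealMean.

(** * Upper bound inside the window *)

Section Upper.
Variable R : realType.
Local Open Scope classical_set_scope.
Local Open Scope ring_scope.
Implicit Types (n l : nat) (p : R).

Lemma card_initial n l : (l <= n)%N -> #|[set i : 'I_n | (i < l)%N]%SET| = l.
Proof.
move=> ln; rewrite -sum1_card -[RHS]card_ord -sum1_card (big_ord_widen n (fun=> 1%N)) //.
by apply: eq_bigl => i; rewrite inE.
Qed.

(** The relative variance caused by correlations eta <= n ^ -2 in n columns. *)
Lemma far_pairs_error n (eta : R) : (16 <= n)%N -> 0 <= eta <= n%:R ^- 2 ->
  1 / 2 <= (1 - eta) ^+ n /\
  (1 + 3 * eta) ^+ n / ((1 - eta) ^+ n) ^+ 2 <= 1 + 20 / n%:R.
Proof.
move=> n16 /andP[eta0 eta_n].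
have n16R : 16 <= n%:R :> R by rewrite ler_nat.
pose x : R := n%:R^-1.
have x0 : 0 < x by rewrite invr_gt0; lra.
have xn : n%:R * x = 1 by rewrite mulfV // gt_eqF //; lra.
have x16 : 16 * x <= 1 by rewrite -[leRHS]xn ler_wpM2r // ltW.
have xx : x * x <= x * (1 / 16) by rewrite ler_wpM2l ?(ltW x0) //; lra.
have eta_x : eta <= x * x by rewrite -expr2 /x exprVn.
have neta : n%:R * eta <= x.
  apply: (@le_trans _ _ (n%:R * (x * x))); first by rewrite ler_wpM2l.
  by rewrite mulrA xn mul1r.
have b1 : 1 - x <= (1 - eta) ^+ n.
  by apply: le_trans (bernoulli_ineq _ _); lra.
split; first lra.
have b2 : (1 + 3 * eta) ^+ n <= 1 + 6 * x.
  apply: le_trans (exp_le_expR _ _) _; first lra.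
  apply: (@le_trans _ _ (expR (3 * x))); first by rewrite ler_expR; lra.
  by apply: le_trans (expR_le_half _) _; lra.
have b0 : 0 < (1 - eta) ^+ n by lra.
rewrite -/x ler_pdivrMr ?(exprn_gt0 _ b0) //; apply: le_trans b2 _.
have h : (1 - x) ^+ 2 <= ((1 - eta) ^+ n) ^+ 2 by rewrite lerXn2r ?nnegrE //; lra.
apply: (@le_trans _ _ ((1 + 20 * x) * (1 - x) ^+ 2)); last by rewrite ler_wpM2l //; lra.
have : 0 <= x * x * x by rewrite !mulr_ge0 // ltW.
by move: x0 x16 xx; clear; lra.
Qed.

Lemma diagdist_upper_prob n l p : 0 <= p <= 1 -> (0 < l <= n)%N -> (16 <= n)%N ->
  `|1 - 2 * p| ^+ l <= n%:R ^- 2 ->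
  let S := Num.sqrt (n - l)%:R in 2 <= S -> 4 / S <= 1 / 2 - lambda0 ->
  gnp_prob p (fun G : sgraph 'I_n =>
    l%:R + lambda0 * (n - l)%:R + 7 * S < (diagdist G)%:R) <=
  20 / n%:R + 4 * (n%:R ^+ l * expR 1) * expR (- (S / 2)).
Proof.
move=> p01 /andP[l0 ln] n16 eta_n S S2 Sl.
have n0 : (0 < n)%N by apply: leq_trans n16.
pose A0 := [set i : 'I_n | (i < l)%N]%SET.
have cA0 : #|A0| = l by exact: card_initial.
have SN : S ^+ 2 = (n - #|A0|)%:R by rewrite cA0 sqr_sqrtr.
have := ideal_mean_ge S2 SN Sl; rewrite cA0.
set M := _ + _ + _; set mu := ideal_mean M A0 => mu_ge.
have mu0 : 0 < mu by apply: lt_le_trans mu_ge; rewrite divr_gt0 // expR_gt0.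
set eta := `|1 - 2 * p| ^+ l in eta_n.
have eta0 : 0 <= eta by rewrite exprn_ge0.
have n16R : 16 <= n%:R :> R by rewrite ler_nat.
have [b12 far] : 1 / 2 <= (1 - eta) ^+ n /\
    (1 + 3 * eta) ^+ n / ((1 - eta) ^+ n) ^+ 2 <= 1 + 20 / n%:R.
  by apply: far_pairs_error => //; rewrite eta0.
have eta1 : eta < 1.
  have n1 : 1 < n%:R ^+ 2 :> R by rewrite exprn_egt1 // ltr1n (leq_trans _ n16).
  by apply: le_lt_trans eta_n _; rewrite invf_lt1 // (lt_trans _ n1).
have lA0 : (l <= #|A0|)%N by rewrite cA0.
apply: (@le_trans _ _ (gnp_prob p (fun G : sgraph 'I_n =>
    \sum_(w | target M A0 w) hit R w.1 w.2 G == 0))).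
  apply: gnp_prob_sub => // G; apply: contraTT => nz.
  have [w /andP[tw hw]] : exists w, target M A0 w && (odd_outside G w.1 == w.2).
    apply/existsP; apply: contraNT nz => /existsPn no.
    rewrite big1 // => w tw; have := no w; rewrite tw /= /hit => /negPf -> //.
  have [A0w dw Mw] := and3P tw; rewrite -leNgt.
  have wn0 : w.1 != finset.set0.
    rewrite -card_gt0; apply: leq_trans (subset_leq_card A0w).
    by rewrite cA0.
  by apply: le_trans Mw; rewrite ler_nat -(eqP hw) diagdist_le.
apply: le_trans (no_hit_prob n0 p01 lA0 eta1 mu0) _; rewrite -/eta lerBlDr addrAC.
rewrite [X in _ <= X + _]addrC; apply: lerD => //.
  set a := n%:R ^+ l * expR 1.
  have a0 : 0 <= a by rewrite mulr_ge0 ?exprn_ge0 ?expR_ge0.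
  have d0 : 0 < expR (S / 2) / 4 by rewrite divr_gt0 ?expR_gt0.
  have d1 : expR (S / 2) / 4 <= (1 - eta) ^+ n * mu.
    have -> : expR (S / 2) / 4 = 1 / 2 * (expR (S / 2) / 2) by field.
    by rewrite ler_pM // ?divr_ge0 ?expR_ge0.
  have -> : 4 * a * expR (- (S / 2)) = a / (expR (S / 2) / 4).
    by rewrite expRN invf_div [4 * a]mulrC mulrA.
  by rewrite ler_wpM2l // lef_pV2 ?posrE // (lt_le_trans d0).
Qed.

(** The size l of the common part A0 is chosen of order ln n with
    |1 - 2 p| ^ l <= n ^ -2: correlations are then negligible, the cost l is absorbed
    by sqrt n, and the number n ^ l of near sets is small against exp (sqrt n / 4). *)
Lemma dense_diagdist_upper p : 0 < p < 1 -> forall e : R, 0 < e -> \forall n \near \oo,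
  gnp_prob p (fun G : sgraph 'I_n =>
    lambda0 * n%:R + 8 * Num.sqrt n%:R < (diagdist G)%:R :> R) <= e.
Proof.
move=> /andP[p0 p1] e e0.
have p01 : 0 <= p <= 1 by lra.
have [/andP[l0 l1] _] := @lambda0P R.
pose r : R := Num.max `|1 - 2 * p| (1 / 2).
have r1 : r < 1 by rewrite /r gt_max ltr_norml; lra.
have r2 : 1 / 2 <= r by rewrite /r le_max lexx orbT.
have r0 : 0 < r by lra.
pose c := - ln r.
have c0 : 0 < c by rewrite oppr_gt0 ln_lt0 // r0.
pose C := 2 / c + 1.
have C1 : 1 <= C by rewrite /C lerDr divr_ge0 // ltW.
near=> n.
have n0 : (0 < n)%N by near: n; exact: nbhs_infty_gt.
have n16 : (16 <= n)%N by near: n; exact: nbhs_infty_ge.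
have nR0 : 0 < n%:R :> R by rewrite ltr0n.
pose L : R := ln n%:R; pose S : R := Num.sqrt n%:R.
have L4 : 4 <= L by rewrite /L; near: n; exact: near_ln_ge.
have LE : 4 * (4 - ln (e / 2)) <= L by rewrite /L; near: n; exact: near_ln_ge.
have LE2 : 8 / (1 / 2 - lambda0) <= L by rewrite /L; near: n; exact: near_ln_ge.
have ne : 40 / e <= n%:R by near: n; exact: nbhs_infty_ger.
have SL : (4 * C + 1) * L ^+ 2 <= S by rewrite /S /L; near: n; exact: near_sqrt_ge_sqr.
have eL : expR L = n%:R by rewrite lnK.
have S2 : S ^+ 2 = n%:R by rewrite sqr_sqrtr // ltW.
have [LL CLL LS CS S0] : [/\ L <= L ^+ 2, C * L * L <= C * L ^+ 2, L <= S, C * L <= S & 0 <= S].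
  have LL : L <= L ^+ 2 by rewrite expr2 ler_peMl //; move: L4; clear; lra.
  have CL : C * L <= C * L ^+ 2 by rewrite ler_wpM2l //; move: C1; clear; lra.
  have CL0 : 0 <= C * L ^+ 2 by rewrite mulr_ge0 ?sqr_ge0 //; move: C1; clear; lra.
  have CLL : C * L * L <= C * L ^+ 2 by rewrite -mulrA -expr2.
  by split=> //; move: SL LL CL CL0 L4; clear; lra.
have nS : 4 * S <= n%:R by rewrite -S2 expr2 ler_wpM2r // (le_trans L4).
pose l := (Num.truncn (2 * L / c)).+1.
have [lge lle] : 2 * L / c <= l%:R /\ l%:R <= C * L.
  have q0 : 0 <= 2 * L / c.
    by rewrite divr_ge0 ?(ltW c0) // mulr_ge0 //; move: L4; clear; lra.
  have /andP[t1 t2] := truncn_itv q0.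
  split; first exact: ltW.
  rewrite /l -natr1 /C.
  have -> : (2 / c + 1) * L = 2 * L / c + L by field; rewrite gt_eqF.
  by rewrite lerD //; move: L4; clear; lra.
have l_gt0 : (0 < l)%N by [].
move: l l_gt0 lge lle => l l_gt0 lge lle.
have lR0 : 0 <= l%:R :> R by exact: ler0n.
have lnat : (l <= n)%N.
  by rewrite -(ler_nat R); move: lle CS nS S0; clear; lra.
have NE : (n - l)%:R = n%:R - l%:R :> R by rewrite natrB.
pose S' : R := Num.sqrt (n - l)%:R.
have S'2 : S' ^+ 2 = (n - l)%:R by rewrite sqr_sqrtr.
have S'S : S' <= S by rewrite ler_sqrt // NE gerBl.
have SS' : S / 2 <= S'.
  have h0 : S / 2 \is Num.nneg by rewrite nnegrE divr_ge0.
  have h1 : S' \is Num.nneg by rewrite nnegrE sqrtr_ge0.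
  rewrite -(ler_pXn2r (isT : (0 < 2)%N) h0 h1) S'2 NE expr_div_n S2 (_ : 2 ^+ 2 = 4 :> R); last by ring.
  by move: lle CS nS S0; clear; lra.
have S'2' : 2 <= S' by move: SS' LS L4; clear; lra.
have S'l : 4 / S' <= 1 / 2 - lambda0.
  rewrite ler_pdivrMr; last by move: S'2'; clear; lra.
  move: LE2; rewrite ler_pdivrMr; last by move: l1; clear; lra.
  have : (1 / 2 - lambda0) * (L / 2) <= (1 / 2 - lambda0) * S'.
    by rewrite ler_wpM2l //; [move: l1|move: SS' LS]; clear; lra.
  by clear; lra.
have eta_n : `|1 - 2 * p| ^+ l <= n%:R ^- 2.
  apply: (@le_trans _ _ (r ^+ l)).
    by rewrite lerXn2r ?nnegrE ?normr_ge0 ?(ltW r0) // /r le_max lexx.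
  have rE : ln r = - c by rewrite opprK.
  rewrite -(lnK (r0 : r \is Num.pos)) -expRM_natl -eL -exprVn -expRN -expRM_natl ler_expR rE.
  by move: lge; rewrite ler_pdivrMr //; clear; lra.
have l_range : (0 < l <= n)%N by rewrite l_gt0.
apply: (@le_trans _ _ (gnp_prob p (fun G : sgraph 'I_n =>
    l%:R + lambda0 * (n - l)%:R + 7 * S' < (diagdist G)%:R))).
  apply: gnp_prob_sub => // G; apply: le_lt_trans.
  have : @lambda0 R * (n - l)%:R <= lambda0 * n%:R.
    by rewrite ler_wpM2l ?(ltW l0) // NE gerBl.
  by move: lle CS S'S; clear; rewrite -/S; lra.
apply: le_trans (diagdist_upper_prob p01 l_range n16 eta_n S'2' S'l) _; rewrite -/S'.
have -> : e = e / 2 + e / 2 by field.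
apply: lerD.
  move: ne; rewrite !ler_pdivrMr //; move: e0; clear; lra.
have e3 : 4 <= expR 3 :> R by have := @expR_ge1Dx R 3; clear; lra.
apply: (@le_trans _ _ (expR 3 * (n%:R ^+ l * expR 1) * expR (- (S' / 2)))).
  by rewrite ler_wpM2r ?expR_ge0 // ler_wpM2r // mulr_ge0 ?exprn_ge0 ?expR_ge0.
rewrite -eL -expRM_natl -!expRD -[leRHS]lnK ?posrE ?divr_gt0 // ler_expR.
have : l%:R * L <= C * L * L by rewrite ler_wpM2r //; move: L4; clear; lra.
by move: CLL SL SS' LE LL; clear; lra.
Unshelve. all: by end_near. Qed.

End Upper.

(** * The three regimes *)

Section Wrap.
Variable R : realType.
Local Open Scope classical_set_scope.
Local Open Scope ring_scope.

(** Both deviations, K sqrt n ln n below and 8 sqrt n above, are below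
    sqrt n (ln n) ^ 2. *)
Lemma diagdist_window (p : R) : lambda0 <= p <= p0 ->
  aas (fun=> p) (fun n G =>
    `|(diagdist G)%:R - lambda0 * n%:R| <= Num.sqrt n%:R * (ln n%:R) `^ (2 : R)).
Proof.
have [/andP[l0 l1] _] := @lambda0P R.
have [/andP[q0 q1] _] := @p0P R.
move=> pI; have p01 : 0 < p < 1 by lra.
have [K K0 low] := dense_diagdist_lower pI.
apply: aas_small => [_|e e0]; first by lra.
have e2 : 0 < e / 2 by lra.
have {}low := low _ e2; have up := dense_diagdist_upper p01 e2.
near=> n.
have L1 : 8 <= ln n%:R :> R by near: n; exact: near_ln_ge.
have LK : K <= ln n%:R :> R by near: n; exact: near_ln_ge.
have S0 : 0 <= Num.sqrt n%:R :> R by exact: sqrtr_ge0.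
rewrite (_ : e = e / 2 + e / 2); last by lra.
apply: (@le_trans _ _ (gnp_prob p (fun G : sgraph 'I_n =>
    (diagdist G)%:R <= lambda0 * n%:R - K * (Num.sqrt n%:R * ln n%:R)) +
  gnp_prob p (fun G : sgraph 'I_n =>
    lambda0 * n%:R + 8 * Num.sqrt n%:R < (diagdist G)%:R :> R))); last first.
  by apply: lerD; near: n.
apply: gnp_probU => [|G]; first by lra.
rewrite /= (powR_mulrn 2) ?(le_trans _ L1) // ler_norml => out.
apply: contraNT out; rewrite negb_or -ltNge -leNgt => /andP[dl du].
set S := Num.sqrt n%:R in S0 dl du *; set L := ln n%:R in L1 LK dl *.
have LL : 8 * L <= L ^+ 2 by rewrite expr2 ler_wpM2r //; lra.
have h1 : S * (K * L) <= S * L ^+ 2.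
  by rewrite expr2 ler_wpM2l // ler_wpM2r //; lra.
have h2 : S * 8 <= S * L ^+ 2 by rewrite ler_wpM2l //; lra.
lra.
Unshelve. all: by end_near. Qed.

Lemma near_small (q : nat -> R) (p1 : R) : q n @[n --> \oo] --> (0 : R) -> 0 < p1 ->
  (forall n, 0 < q n) -> \forall n \near \oo, 0 < q n <= p1.
Proof.
move=> q0 p10 qpos; have /cvgrPdist_le /(_ p1 p10) := q0.
apply: filterS => n; rewrite sub0r normrN gtr0_norm ?qpos // => ->.
Qed.

End Wrap.

Local Open Scope classical_set_scope.
Local Open Scope ring_scope.

Theorem theorem1p1 (R : realType) :
  (* (i) *)
  ((forall p : R, 0 < p < lambda0 ->
      aas (fun=> p) (fun n G => diagdist G == (mindeg G + 1)%N)) /\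
   (forall p : nat -> R, (forall n, 0 < p n < 1) -> p n @[n --> \oo] --> (0 : R) ->
      aas p (fun n G => diagdist G == (mindeg G + 1)%N))) /\
  (* (ii) *)
  (forall p : R, lambda0 <= p <= p0 ->
    exists C : R,
      aas (fun=> p) (fun n G =>
        `|(diagdist G)%:R - lambda0 * n%:R| <= Num.sqrt n%:R * (ln n%:R) `^ C)) /\
  (* (iii) *)
  ((forall p : R, p0 < p < 1 ->
      aas (fun=> p) (fun n G => diagdist G == (2 + min_symdiff G)%N)) /\
   (forall p : nat -> R, (forall n, 0 < p n < 1) -> p n @[n --> \oo] --> (1 : R) ->
      aas p (fun n G => diagdist G == (2 + min_symdiff G)%N))).
Proof.
have [/andP[l0 l1] _] := @lambda0P R.
have [/andP[q0 q1] _] := @p0P R.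
split; last split; first split.
- move=> p pI; apply: aas_small => [_|e e0]; first by lra.
  exact: dense_mindeg.
- move=> p p01 p_to0; apply: aas_small => [n|e e0].
    by case/andP: (p01 n) => a b; rewrite !ltW.
  have [p1 p10 [M H]] := sparse_mindeg e0.
  have sm := near_small p_to0 p10 (fun n => proj1 (andP (p01 n))).
  near=> n; apply: (H n (p n)); near: n => //.
  exact: near_ln_ge.
- by move=> p pI; exists 2; exact: diagdist_window.
- split.
    move=> p pI; apply: aas_small => [_|e e0]; first by lra.
    exact: dense_min_symdiff.
  move=> p p01 p_to1; apply: aas_small => [n|e e0].
    by case/andP: (p01 n) => a b; rewrite !ltW.
  have [p1 p10 [M H]] := sparse_min_symdiff e0.
  have to0 : 1 - p n @[n --> \oo] --> (0 : R).
    by rewrite -(subrr (1 : R)); apply: cvgB => //; exact: cvg_cst.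
  have pos n : 0 < 1 - p n by rewrite subr_gt0; case/andP: (p01 n).
  have sm := near_small to0 p10 pos.
  near=> n; rewrite -[p n](subKr 1); apply: (H n (1 - p n)); near: n => //.
  exact: near_ln_ge.
Unshelve. all: by end_near. Qed.
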